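(* Let $\lambda>0$, let $A:[0,+\infty)\to\mathbb{R}$ and $f:[0,1]\times[0,+\infty)\to[0,+\infty)$ be continuous, let $b\in L^1\big((0,1];[0,+\infty)\big)$ be positive almost everywhere with $(b*\mathbf{1})(1)\neq0$, let $0<\rho_1<\rho_2$ be such that $A(t)>0$ for each $t\in[\rho_1,\rho_2]$, let $p:[0,1]\to(1,+\infty)$ be continuous with $1<p^-\le p(t)\le p^+<+\infty$ for all $t\in[0,1]$ ($p^-,p^+$ real constants), and let $G$ be a Green's function satisfying the assumptions listed in the context, with associated constants $\alpha,\beta,\eta_0,C_0$. Suppose that for some $q\in(1,p^-)$ we have $b^{\frac{1}{1-q}}\in L^1\big((0,1]\big)$. Suppose moreover that both of the following inequalities hold: (1) $\displaystyle\left[2^{1-p^+}\left(\frac{\lambda f^{m}_{[\alpha,\beta]\times[\eta_0m_{\rho_1},M_{\rho_1}]}}{A(\rho_1)}\max_{\tau\in[0,1]}\int_{\alpha}^{\beta}G(\tau,s)\,ds\right)^{p^-}-1\right]\int_{\alpha}^{\beta}b(1-t)\,dt>\frac{\rho_1}{\eta_0^{p^+}}$; (2) $\displaystyle\max\left\{\left(\frac{\lambda f^{M}_{[0,1]\times[0,M_{\rho_2}]}G^M}{A(\rho_2)}\right)^{p^-},\left(\frac{\lambda f^{M}_{[0,1]\times[0,M_{\rho_2}]}G^M}{A(\rho_2)}\right)^{p^+}\right\}\int_0^1b(1-t)\,dt<\rho_2$. Then the problem $$-A\left(\int_0^1b(1-s)\big(u(s)\big)^{p(s)}\,ds\right)u''(t)=\lambda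 f\big(t,u(t)\big),\quad t\in(0,1),$$ subject to the boundary data encoded by the Green's function $G$, has at least one positive solution $u_0\in\widehat{V}_{\rho_2}\setminus\overline{\widehat{V}_{\rho_1}}$, and $u_0$ satisfies $$\left(\frac{\rho_1}{(b*\mathbf{1})(1)}\right)^{\frac{1}{p^+}}+\varepsilon(\rho_1,b)\le\Vert u_0\Vert_{\infty}\le C_0^{-1}2^{\frac{p^+-q}{p^-}}\left[\rho_2^{\frac{1}{q}}\left(\left(b^{\frac{1}{1-q}}*\mathbf{1}\right)(1)\right)^{\frac{q-1}{q}}+1\right]^{\frac{q}{p^-}}.$$
   Context: Notation. $\mathscr{C}([0,1])$ is the Banach space of continuous real functions on $[0,1]$ with the maximum norm $\Vert\cdot\Vert_\infty$. $\mathbf{1}$ is the constant function $1$. Finite convolution: $(v*w)(t):=\int_0^tv(t-s)w(s)\,ds$, $0\le t\le1$; in particular $(b*\mathbf{1})(1)=\int_0^1b(1-s)\,ds$ and $(b*u^{p(\cdot)})(1):=\int_0^1b(1-s)(u(s))^{p(s)}\,ds$. For continuous $h:[0,1]\times[0,+\infty)\to[0,+\infty)$, $h^m_{[a,b]\times[c,d]}$ and $h^M_{[a,b]\times[c,d]}$ denote respectively the minimum and the maximum of $h$ over $[a,b]\times[c,d]$. Assumptions on $G$: $G:[0,1]\times[0,1]\to[0,+\infty)$ is continuous and is the Green's function of $-u''$ under given (homogeneous) boundary data (e.g. Dirichlet). Put $\mathscr{G}(s):=\max_{t\in[0,1]}G(t,s)$. There are numbers $0\le\alpha<\beta\le1$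 and $\eta_0=\eta_0(\alpha,\beta)\in(0,1]$ with $\min_{t\in[\alpha,\beta]}G(t,s)\ge\eta_0\mathscr{G}(s)$ for each $s\in[0,1]$. Moreover $C_0:=\inf_{s\in(0,1)}\frac{1}{\mathscr{G}(s)}\int_0^1G(t,s)\,dt$ satisfies $C_0>0$ (implicitly $\mathscr{G}(s)>0$ for $s\in(0,1)$). Cone and sets: $$\mathscr{K}:=\Big\{u\in\mathscr{C}([0,1]):u\ge0,\ \min_{t\in[\alpha,\beta]}u(t)\ge\eta_0\Vert u\Vert_\infty,\ (\mathbf{1}*u)(1)\ge C_0\Vert u\Vert_\infty\Big\},$$ and for $\rho>0$, $\widehat{V}_\rho:=\{u\in\mathscr{K}:(b*u^{p(\cdot)})(1)<\rho\}$, a relatively open subset of $\mathscr{K}$; closures are relative to $\mathscr{K}$. A positive solution of the problem subject to the boundary data encoded by $G$ means a nontrivial $u\in\mathscr{K}$, with $A\big((b*u^{p(\cdot)})(1)\big)>0$, that is a fixed point $u=Tu$ of $$(Tu)(t):=\lambda\int_0^1\Big(A\big((b*u^{p(\cdot)})(1)\big)\Big)^{-1}G(t,s)f(s,u(s))\,ds;$$ such a fixed point satisfies the differential equation and the boundary conditions because $G$ is the Green's function. Constants, for $\rho>0$: $$G^M:=\max_{\tau\in[0,1]}\int_0^1G(\tau,s)\,ds,\qquad m_\rho:=\left(\frac{\rho}{(b*\mathbf{1})(1)}\right)^{\frac1{p^+}}+\varepsilon(\rho,b),$$ $$M_\rho:=C_0^{-1}2^{\frac{p^+-q}{p^-}}\left[\rho^{\frac1q}\left(\left(b^{\frac1{1-q}}*\mathbf{1}\right)(1)\right)^{\frac{q-1}{q}}+1\right]^{\frac{q}{p^-}},$$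 where $$\varepsilon(\rho,b):=\begin{cases}\left(\frac{\rho}{(b*\mathbf{1})(1)}\right)^{\frac1{p^-}}-\left(\frac{\rho}{(b*\mathbf{1})(1)}\right)^{\frac1{p^+}},&0<\left(\frac{\rho}{(b*\mathbf{1})(1)}\right)^{\frac1{p^+}}<1,\\0,&\left(\frac{\rho}{(b*\mathbf{1})(1)}\right)^{\frac1{p^+}}\ge1.\end{cases}$$ *)

(* Defs.v *)
From HB Require Import structures.
From mathcomp Require Import all_boot all_order all_algebra.
From mathcomp Require Import all_classical all_reals all_analysis.

Set Implicit Arguments.
Unset Strict Implicit.
Unset Printing Implicit Defensive.

Import Order.TTheory GRing.Theory Num.Theory.
Import numFieldNormedType.Exports.

Local Open Scope classical_set_scope.
Local Open Scope ring_scope.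

(* Functions on [0,1] are total functions R -> R of which only the values on
   [0,1] are constrained; likewise for A, f, b, p and G outside their domains. *)

Section Extrema.
Context {R : realType} {T : Type}.
Implicit Types (g : T -> R) (D : set T).

(* These are attained extrema whenever g is continuous on a nonempty compact
   set D, as in every quantity of the theorem. *)
Definition max_on D g : R := sup [set g x | x in D].
Definition min_on D g : R := inf [set g x | x in D].

End Extrema.

Section Problem.
Context {R : realType}.
Implicit Types (b p u v w g h A : R -> R) (f G : R -> R -> R).

Definition sup_norm u : R := max_on `[0, 1] (fun t : R => `|u t|).

Definition fconv v w (t : R) : R :=
  \int[lebesgue_measure]_(s in `[0, t]) (v (t - s) * w s).

(* (b * u^{p(.)})(1) *)
Definition nonlocal b p u : R := fconv b (fun s => u s `^ p s) 1.

Definition twice_derivable g (t : R) : Prop :=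
  (\forall x \near t, derivable g x 1) /\ derivable g^`()%classic t 1.

Definition is_right_deriv g (x d : R) : Prop :=
  h^-1 * (g (x + h) - g x) @[h --> 0^'+] --> d.

Definition is_left_deriv g (x d : R) : Prop :=
  h^-1 * (g (x + h) - g x) @[h --> 0^'-] --> d.

(* Homogeneous boundary data on [0,1] for a second-order operator: two linear
   relations, the rows of B, between g(0), g'(0), g(1), g'(1). *)
Definition boundary_data (B : 'M[R]_(2, 4)) g : Prop :=
  exists d0 d1 : R,
    [/\ is_right_deriv g 0 d0, is_left_deriv g 1 d1 &
        B *m (\col_(i < 4) [:: g 0; d0; g 1; d1]`_i) = 0].

(* G is the Green's function of -u'' under B: the homogeneous problem has only
   the trivial solution and, for 0 < s < 1, G(., s) solves -u'' = 0 off the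
   diagonal, has derivative jump -1 across it, and satisfies B.  Continuity of
   G on the square is a separate assumption. *)
Definition is_green_function (B : 'M[R]_(2, 4)) G : Prop :=
  (forall g, {within `[0, 1], continuous g} ->
     (forall t : R, t \in `]0, 1[ -> twice_derivable g t /\ g^`(2)%classic t = 0) ->
     boundary_data B g ->
     forall t : R, t \in `[0, 1] -> g t = 0) /\
  (forall s : R, s \in `]0, 1[ ->
     [/\ forall t : R, t \in `]0, 1[ -> t != s ->
           twice_derivable (G ^~ s) t /\ (G ^~ s)^`(2)%classic t = 0,
         exists l r : R, [/\ (G ^~ s)^`()%classic t @[t --> s^'-] --> l,
           (G ^~ s)^`()%classic t @[t --> s^'+] --> r & r - l = -1] &
         boundary_data B (G ^~ s)]).

(* script G (s) *)
Definition green_max G (s : R) : R := max_on `[0, 1] (G ^~ s).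

Definition C0 G : R :=
  inf [set (green_max G s)^-1 *
           \int[lebesgue_measure]_(t in `[0, 1]) G t s | s in `]0, 1[ ].

Definition cone G (alpha beta eta0 : R) : set (R -> R) :=
  [set u : R -> R | [/\ {within `[0, 1], continuous u},
        forall t : R, t \in `[0, 1] -> 0 <= u t,
        min_on `[alpha, beta] u >= eta0 * sup_norm u &
        fconv (cst 1) u 1 >= C0 G * sup_norm u] ].

Definition Vhat (K : set (R -> R)) b p (rho : R) : set (R -> R) :=
  [set u | K u /\ nonlocal b p u < rho].

(* Closure relative to K; the maximum norm induces on continuous functions the
   topology of uniform convergence on [0,1]. *)
Definition rel_closure (K V : set (R -> R)) : set (R -> R) :=
  K `&` closure (V : set {uniform` `[0, 1] -> R}).

Definition operT (lambda : R) A f b p G u (t : R) : R :=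
  lambda * \int[lebesgue_measure]_(s in `[0, 1])
    ((A (nonlocal b p u))^-1 * G t s * f s (u s)).

Definition positive_solution (K : set (R -> R)) (lambda : R) A f b p G u :
    Prop :=
  [/\ K u,
      exists2 t : R, t \in `[0, 1] & u t != 0,
      0 < A (nonlocal b p u) &
      forall t : R, t \in `[0, 1] -> u t = operT lambda A f b p G u t].

Definition solves_bvp (B : 'M[R]_(2, 4)) (lambda : R) A f b p u : Prop :=
  (forall t : R, t \in `]0, 1[ ->
     twice_derivable u t /\
     - A (nonlocal b p u) * u^`(2)%classic t = lambda * f t (u t)) /\
  boundary_data B u.

Definition green_int_max G : R :=
  max_on `[0, 1] (fun tau : R => \int[lebesgue_measure]_(s in `[0, 1]) G tau s).

Definition eps_rho b (pm pp rho : R) : R :=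
  let r := rho / fconv b (cst 1) 1 in
  if 0 < r `^ pp^-1 < 1 then r `^ pm^-1 - r `^ pp^-1 else 0.

Definition m_rho b (pm pp rho : R) : R :=
  (rho / fconv b (cst 1) 1) `^ pp^-1 + eps_rho b pm pp rho.

Definition M_rho G b (pm pp q rho : R) : R :=
  (C0 G)^-1 * 2 `^ ((pp - q) / pm) *
  (rho `^ q^-1 *
     fconv (fun t : R => b t `^ (1 - q)^-1) (cst 1) 1 `^ ((q - 1) / q) + 1) `^ (q / pm).

Definition rect_min f (a b c d : R) : R :=
  min_on (`[a, b] `*` `[c, d]) (fun z => f z.1 z.2).

Definition rect_max f (a b c d : R) : R :=
  max_on (`[a, b] `*` `[c, d]) (fun z => f z.1 z.2).

End Problem.

(* Main.v *)
Require Import Defs.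
From mathcomp Require Import all_boot all_order all_algebra.
From mathcomp Require Import all_classical all_reals all_analysis.
From mathcomp Require Import measurable_realfun.
From mathcomp Require Import zify ring lra.

Set Implicit Arguments.
Unset Strict Implicit.
Unset Printing Implicit Defensive.

Import Order.TTheory GRing.Theory Num.Theory.
Import numFieldNormedType.Exports.

Local Open Scope classical_set_scope.
Local Open Scope ring_scope.

(** Dividing the equation by [A] turns the problem into the fixed point equation
    [u = T u], where [T u] is [a (Phi u)] times the integral of [G t s * f s (u s)],
    [a = lambda / A] and [Phi u = (b * u^p)(1)].  The cone inequalities hold for
    each section [G ^~ s], hence for nonnegative superpositions of sections, so
    [T] maps the cone into itself.  In the cone the nonlocal quantity controls the
    norm from both sides: Hölder's inequality against the dual weight
    [b `^ (1 - q)^-1] bounds the integral of [u] by [Phi u], and the cone bounds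
    the maximum of [u] by its integral ([modular_upper]); conversely a large
    [Phi u] forces a large maximum ([modular_lower]).  Consequently the two
    numerical hypotheses say that [T] expands the level [rho1] of [Phi] and
    compresses the level [rho2]: [Phi u = rho1] gives [rho1 < Phi (T u)]
    ([hammerstein_expands]), and [Phi u = rho2] gives [Phi (T u) < rho2]
    ([hammerstein_compresses]).

    The sublevel sets of [Phi] in the cone are star-shaped about 0 because [Phi]
    strictly increases along rays, and this replaces the fixed point index.  It
    suffices to find [u] in the cone with

    - [T u] proportional to [u], and
    - [Phi u] equal to the truncation of [Phi (T u)] to [[rho1, rho2]].

    A truncation that is active at [rho1] would give [Phi u = rho1] and
    [Phi (T u) <= rho1], against expansion; at [rho2] it is excluded by
    compression.  Hence [Phi u = Phi (T u)], and since these are two points of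
    one ray they are equal ([hammerstein_fixed_point]).

    The two conditions are first solved in finite dimension.  Replacing the
    integral over [s] by a combination of finitely many sections of [G] leaves a
    map of nonnegative coefficient vectors; in polar coordinates its direction
    gives the first condition, and the second one drives the radius, so that
    Brouwer's theorem on a simplex applies ([ray_fixed_point]).  Refining the
    partition and extracting a uniform limit by Ascoli's theorem yields [u]
    ([proportional_solution]).  Brouwer's theorem is obtained from Scarf's
    combinatorial theorem on a grid of the simplex ([scarf], [brouwer]).

    It remains to see that a fixed point solves the boundary value problem.  A
    section of the Green function is affine on both sides of the diagonal with a
    drop of the slope by 1 ([green_affine]), so that the potential of a
    continuous density is an explicit expression in primitives; differentiating
    it twice gives the equation, and the boundary data of the sections integrate
    to those of the potential ([potential_second_derivative],
    [potential_boundary_data]). *)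

(** * Scarf's combinatorial theorem *)

Section ScarfComplex.
Import boot.fintype boot.finset.
Local Open Scope nat_scope.
Local Open Scope set_scope.
Variables (I Z : finType) (r : I -> Z -> nat).
Hypothesis r_inj : forall i, injective (r i).

(** Scarf's generalisation of a face of a triangulation: the orders [r i] play the
    part of barycentric coordinates, and no element exceeds the minimum of [S] in
    every order. *)
Definition dominant (S : {set Z}) : bool :=
  [forall y, exists i, forall z in S, (r i y <= r i z)%N].

Lemma dominantP (S : {set Z}) :
  reflect (forall y, exists i, forall z, z \in S -> (r i y <= r i z)%N)
          (dominant S).
Proof.
apply: (iffP forallP) => H y.
  by have /existsP [i /forall_inP Hi] := H y; exists i.
by have [i Hi] := H y; apply/existsP; exists i; apply/forall_inP.
Qed.

Lemma dominant_sub (S S' : {set Z}) : S \subset S' -> dominant S' -> dominant S.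
Proof.
move=> /subsetP sub /dominantP dom; apply/dominantP => y.
by have [i Hi] := dom y; exists i => z /sub; exact: Hi.
Qed.

Lemma minimizers_exist (S : {set Z}) : S != set0 ->
  exists2 m : I -> Z, forall i, m i \in S &
    forall i z, z \in S -> (r i (m i) <= r i z)%N.
Proof.
case/set0Pn => x0 x0S; exists (fun i => [arg min_(x < x0 in S) r i x]) => [i|i z].
  by case: arg_minnP.
by case: arg_minnP => // x _; apply.
Qed.

(** In a dominant set every element is minimal for some order: otherwise that
    element itself would violate dominance. *)
Lemma dominant_minimizer_surj (S : {set Z}) (m : I -> Z) x :
  dominant S -> (forall i, m i \in S) ->
  (forall i z, z \in S -> (r i (m i) <= r i z)%N) ->
  x \in S -> exists i, m i = x.
Proof.
move=> /dominantP /(_ x) [i Hi] mS mmin xS; exists i.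
by apply: (@r_inj i); apply/eqP; rewrite eqn_leq mmin //= Hi.
Qed.

Section Facet.
Variables (D : {set Z}) (m : I -> Z) (j k : I).
Hypotheses (domD : dominant D) (cardD : #|D|.+1 = #|I|).
Hypotheses (mD : forall i, m i \in D).
Hypothesis m_min : forall i z, z \in D -> (r i (m i) <= r i z)%N.
Hypotheses (jk : j != k) (mjk : m j = m k).

(** The elements that can take the place of the [i]-th minimiser without
    displacing any other. *)
Definition improving i : {set Z} :=
  [set y | [forall i', (i' != i) ==> (r i' (m i') < r i' y)%N]].

Lemma improvingP i y :
  reflect (forall i', i' != i -> (r i' (m i') < r i' y)%N) (y \in improving i).
Proof.
rewrite inE; apply: (iffP forallP) => H i'.
  by move=> ne; have := H i'; rewrite ne.
by apply/implyP; exact: H.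
Qed.

Definition top_improving i w :=
  w \in improving i /\ forall y, y \in improving i -> (r i y <= r i w)%N.

Lemma top_improving_uniq i w w' :
  top_improving i w -> top_improving i w' -> w = w'.
Proof.
move=> [wM wmax] [w'M w'max]; apply: (@r_inj i); apply/eqP.
by rewrite eqn_leq wmax // w'max.
Qed.

Lemma top_improving_exists i : improving i != set0 -> exists w, top_improving i w.
Proof.
case/set0Pn => x0 x0M; case: (arg_maxnP (r i) x0M) => w wM Hw.
by exists w; split=> // y; exact: Hw.
Qed.

(** Pivoting: a facet has one minimiser too few, so some element is minimal for two
    orders [j] and [k]; enlarging it means freeing one of these, and dominance
    forces the new element to be the best improvement in that order. *)
Lemma facet_extension w :
  (w \notin D) && dominant (w |: D) <-> top_improving j w \/ top_improving k w.
Proof.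
split=> [/andP[wD domE]|H].
  set E := w |: D in domE *.
  have E0 : E != set0 by apply/set0Pn; exists w; rewrite !inE eqxx.
  have [m' m'E m'min] := minimizers_exist E0.
  have surj := dominant_minimizer_surj domE m'E m'min.
  have inj : injective m'.
    suff : {in [set: I] &, injective m'} by move=> H i1 i2; apply: H; rewrite inE.
    apply/imset_injP; rewrite (_ : m' @: _ = E) ?cardsU1 ?wD ?cardsT ?add1n ?cardD //.
    apply/setP => x; apply/imsetP/idP => [[i _ ->] //|/surj [i <-]].
    by exists i.
  have wE : w \in E by rewrite !inE eqxx.
  have [i m'i] := surj _ wE.
  have mm' i' : i' != i -> m i' = m' i'.
    move=> ne; have m'D : m' i' \in D.
      have := m'E i'; rewrite !inE => /orP[/eqP e|//].
      by move: ne; rewrite -m'i in e; rewrite (inj _ _ e) eqxx.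
    apply: (@r_inj i'); apply/eqP; rewrite eqn_leq m_min //= m'min //.
    by rewrite !inE mD orbT.
  have ijk : i = j \/ i = k.
    have [|nj] := eqVneq i j; first by left.
    have [|nk] := eqVneq i k; first by right.
    have := mjk; rewrite !mm' 1?eq_sym // => /inj e.
    by move: jk; rewrite e eqxx.
  suff : top_improving i w by case: ijk => ->; [left|right].
  have wi' i' : i' != i -> (r i' (m i') < r i' w)%N.
    move=> ne; rewrite ltn_neqAle mm' // m'min // andbT.
    apply/eqP => /r_inj e; move: ne; rewrite -m'i in e.
    by rewrite (inj _ _ e) eqxx.
  split; first by apply/improvingP.
  move=> y /improvingP yM; have [i2 Hi2] := dominantP _ domE y.
  have [<-|ne] := eqVneq i2 i; first exact: Hi2.
  have := yM _ ne; rewrite ltnNge Hi2 //.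
  by rewrite !inE mD orbT.
have [i ijk [wM wmax]] : exists2 i, i = j \/ i = k & top_improving i w.
  by case: H => H; [exists j; [left|] | exists k; [right|]].
have wgt i' : i' != i -> (r i' (m i') < r i' w)%N by move/improvingP: wM; apply.
apply/andP; split.
  apply/negP => wD.
  have [i' mi'] := dominant_minimizer_surj domD mD m_min wD.
  have [ii'|ne] := eqVneq i' i; last by have := wgt _ ne; rewrite mi' ltnn.
  case: ijk => e.
    have ki : k != i by rewrite e eq_sym.
    by have := wgt _ ki; rewrite -mi' ii' e mjk ltnn.
  have ji : j != i by rewrite e.
  by have := wgt _ ji; rewrite -mi' ii' e mjk ltnn.
apply/dominantP => y.
have [yM|] := boolP (y \in improving i).
  exists i => z; rewrite !inE => /orP[/eqP ->|zD]; first exact: wmax.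
  have [i2 Hi2] := dominantP _ domD y.
  have [<-|ne] := eqVneq i2 i; first exact: Hi2.
  by move/improvingP: yM => /(_ _ ne); rewrite ltnNge Hi2.
rewrite inE negb_forall => /existsP [i']; rewrite negb_imply -leqNgt => /andP[ne le].
exists i' => z; rewrite !inE => /orP[/eqP ->|zD].
  by apply: leq_trans le _; exact/ltnW/wgt.
by apply: leq_trans le _; exact: m_min.
Qed.

Lemma improving_disjoint y : y \in improving j -> y \in improving k -> False.
Proof.
move=> /improvingP yj /improvingP yk.
have [i Hi] := dominantP _ domD y.
have [e|ne] := eqVneq i j; last by have := yj _ ne; rewrite ltnNge Hi.
by have := yk i; rewrite e jk => /(_ isT); rewrite -e ltnNge Hi.
Qed.

Lemma card_facet_extension_two :
  improving j != set0 -> improving k != set0 ->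
  #|[set w | (w \notin D) && dominant (w |: D)]| = 2.
Proof.
move=> /top_improving_exists [wj Hj] /top_improving_exists [wk Hk].
rewrite (_ : finset _ = [set wj; wk]).
  rewrite cards2; case: eqVneq => // e; exfalso.
  by apply: (@improving_disjoint wj); [case: Hj | rewrite e; case: Hk].
apply/setP => w; rewrite !inE; apply/idP/idP => [/facet_extension[] H|].
- by rewrite (top_improving_uniq H Hj) eqxx.
- by rewrite (top_improving_uniq H Hk) eqxx orbT.
- by case/orP => /eqP ->; apply/facet_extension; [left|right].
Qed.

Lemma card_facet_extension_one :
  improving j != set0 -> improving k = set0 ->
  #|[set w | (w \notin D) && dominant (w |: D)]| = 1.
Proof.
move=> /top_improving_exists [wj Hj] k0.
rewrite (_ : finset _ = [set wj]) ?cards1 //.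
apply/setP => w; rewrite !inE; apply/idP/idP => [/facet_extension[] H|].
- by rewrite (top_improving_uniq H Hj) eqxx.
- by case: H; rewrite k0 inE.
- by move/eqP => ->; apply/facet_extension; left.
Qed.

End Facet.

Lemma facet_data (D : {set Z}) : dominant D -> D != set0 -> #|D|.+1 = #|I| ->
  exists m : I -> Z, [/\ forall i, m i \in D,
    forall i z, z \in D -> (r i (m i) <= r i z)%N &
    exists j k, j != k /\ m j = m k].
Proof.
move=> domD D0 cardD; have [m mD m_min] := minimizers_exist D0.
exists m; split=> //.
have : ~~ injectiveb m.
  apply/injectiveP => minj; have := leq_imset_card m [set: I].
  have : #|m @: [set: I]| = #|I| by rewrite card_imset // cardsT.
  have : (#|m @: [set: I]| <= #|D|)%N.
    apply/subset_leq_card/subsetP => x /imsetP[i _ ->].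
    exact: mD.
  by rewrite -cardD => h1 h2; rewrite h2 ltnn in h1.
by case/injectivePn => j [k jk e]; exists j, k.
Qed.

End ScarfComplex.

Section ParityOfLabels.
Import boot.fintype boot.finset.
Local Open Scope nat_scope.
Local Open Scope set_scope.
Variables (I Z : finType) (l : Z -> I) (i0 : I).

(** The Sperner counting step: a set of the size of the label set that misses a
    label has an even number of facets carrying all labels but [i0]. *)
Lemma even_almost_full_facets (S : {set Z}) : #|S| = #|I| -> l @: S != [set: I] ->
  ~~ odd #|[set x in S | l @: (S :\ x) == [set~ i0]]|.
Proof.
move=> cardS nfull.
set Q := finset _; have [->|] := eqVneq Q set0; first by rewrite cards0.
case/set0Pn => x; rewrite inE => /andP[xS /eqP lx].
have i0S : i0 \notin l @: S.
  apply: contra nfull => i0S; rewrite eqEsubset subsetT /=; apply/subsetP => i _.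
  have [->//|ne] := eqVneq i i0.
  have : i \in l @: (S :\ x) by rewrite lx !inE.
  by apply/subsetP; apply: imsetS; exact: subD1set.
have lne z : z \in S -> l z != i0.
  by move=> zS; apply: contra i0S => /eqP <-; exact: imset_f.
have linj : {in S :\ x &, injective l}.
  by apply/imset_injP; rewrite lx cardsC1 -cardS (cardsD1 x S) xS.
have : l x \in l @: (S :\ x) by rewrite lx !inE lne.
case/imsetP => x' x'S lxx'; move: (x'S); rewrite !inE => /andP[x'x x'S0].
rewrite (_ : Q = [set x; x']) ?cards2 1?eq_sym ?x'x //.
apply/setP => z; rewrite !inE; apply/idP/idP => [/andP[zS /eqP lz]|].
  have [//|zx] := eqVneq z x.
  have : l z \in l @: (S :\ z) by rewrite lz !inE lne.
  case/imsetP => z'; rewrite !inE => /andP[z'z z'S] lzz'.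
  have [z'x|z'x] := eqVneq z' x.
    by apply/orP; right; apply/eqP/linj => //; rewrite ?inE ?zx // lzz' z'x.
  by move: z'z; rewrite (linj z' z) ?eqxx // !inE ?zx ?z'x.
case/orP => /eqP ->; first by rewrite xS lx eqxx.
rewrite x'S0 -lx /= eqEsubset; apply/andP; split; apply/subsetP => i /imsetP[y].
  rewrite !inE => /andP[yx' yS] ->; have [->|yx] := eqVneq y x.
    by rewrite lxx'; exact: imset_f.
  by apply: imset_f; rewrite !inE yx.
rewrite !inE => /andP[yx yS] ->; have [->|yx'] := eqVneq y x'.
  by rewrite -lxx'; apply: imset_f; rewrite !inE eq_sym x'x.
by apply: imset_f; rewrite !inE yx'.
Qed.

End ParityOfLabels.

Section Scarf.
Import boot.fintype boot.finset.
Local Open Scope nat_scope.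
Local Open Scope set_scope.
Variables (I T : finType) (rho : I -> T -> nat) (c : T -> I).
Hypothesis rho_inj : forall i, injective (rho i).
Hypotheses (I_gt1 : (1 < #|I|)%N) (t0 : T).
Local Notation Z := (T + I)%type.

(** Each label is adjoined as a slack element: the least one for its own order
    and above all of [T] for the others. *)
Definition slack_rank (i : I) (z : Z) : nat :=
  match z with
  | inl x => (rho i x).+1
  | inr j => if j == i then 0%N else (\max_x rho i x + enum_rank j).+2
  end.

Definition slack_label (z : Z) : I := match z with inl x => c x | inr j => j end.

Lemma slack_rank_inj i : injective (slack_rank i).
Proof.
have M x : (rho i x <= \max_x rho i x)%N by exact: leq_bigmax.
move=> [x|j] [x'|j'] /=; last (case: eqP => [->|_]; case: eqP => [->|_] //).
- by case=> /rho_inj ->.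
- by case: eqP => // _ []; have := M x; lia.
- by case: eqP => // _ []; have := M x'; lia.
- by case=> /addnI /val_inj /enum_rank_inj ->.
Qed.

Local Notation dom := (dominant slack_rank).

Lemma dominant_slack_facet i0 : dom [set inr i | i in [set~ i0]].
Proof.
apply/dominantP => -[x|j].
  exists i0 => z /imsetP [j]; rewrite !inE => /negPf ne -> /=; rewrite ne.
  by have := leq_bigmax (F := rho i0) x; lia.
by exists j => z _; rewrite /= eqxx.
Qed.

Lemma card_slack_facet i0 : #|[set (inr i : Z) | i in [set~ i0]]|.+1 = #|I|.
Proof.
rewrite card_imset; last by move=> ? ? [].
by rewrite cardsC1 prednK // ltnW.
Qed.

(** The facet of all slack elements but one lies on the boundary: a second extension
    would exceed one of them in the order [i0], where they are above all of [T], and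
    a further slack element is least in its own order. *)
Lemma facet_extensions_outer i0 (D := [set (inr i : Z) | i in [set~ i0]]) :
  #|[set w | (w \notin D) && dom (w |: D)]| = 1.
Proof.
have D0 : D != set0.
  by rewrite -card_gt0; have := card_slack_facet i0; rewrite -/D; lia.
have [m [mD m_min [j [k [jk mjk]]]]] :=
  facet_data (dominant_slack_facet i0) D0 (card_slack_facet i0).
have inD i : (inr i \in D) = (i != i0).
  apply/imsetP/idP => [[i'] |ne]; first by rewrite !inE => ? [->].
  by exists i; rewrite ?inE.
have m_slack i : i != i0 -> m i = inr i.
  move=> ne; have := m_min i (inr i); rewrite inD => /(_ ne) /=.
  rewrite eqxx; case: (m i) => [x|i'] //=.
  by case: eqP => [->|].
wlog ji0 : j k jk mjk / j = i0.
  move=> H; have [ji0|nj] := eqVneq j i0; first exact: H jk mjk ji0.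
  have [ki0|nk] := eqVneq k i0; first by apply: (H k j) => //; rewrite eq_sym.
  by move: mjk jk; rewrite !m_slack // => -[->]; rewrite eqxx.
have ki0 : k != i0 by rewrite -ji0 eq_sym.
apply: (card_facet_extension_one slack_rank_inj (dominant_slack_facet i0)
  (card_slack_facet i0) mD m_min jk mjk).
  apply/set0Pn; exists (inl t0); apply/improvingP => i; rewrite ji0 => ne.
  by rewrite m_slack //= eqxx.
apply/setP => y; rewrite [RHS]inE; apply/negP => /improvingP yM.
have := yM j jk; rewrite mjk m_slack // ji0.
case: y yM => [x|i] yM /=.
  by rewrite (negPf ki0); have := leq_bigmax (F := rho i0) x; lia.
case: (eqVneq i i0) => [//|ne]; rewrite (negPf ki0).
have [->|ik] := eqVneq i k; first by rewrite ltnn.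
by have := yM i ik; rewrite m_slack //= eqxx.
Qed.

(** A facet with an element of [T] is interior: the slack element of each of the
    two orders sharing a minimiser is an improvement. *)
Lemma facet_extensions_inner (D : {set Z}) x : dom D -> #|D|.+1 = #|I| ->
  inl x \in D -> #|[set w | (w \notin D) && dom (w |: D)]| = 2.
Proof.
move=> domD cardD xD.
have D0 : D != set0 by apply/set0Pn; exists (inl x).
have [m [mD m_min [j [k [jk mjk]]]]] := facet_data domD D0 cardD.
have m_cases i : m i = inr i \/ exists x', m i = inl x'.
  have := m_min i _ xD; case: (m i) => [x'|i'] /=; first by right; exists x'.
  case: eqP => [->|_]; first by left.
  by have := leq_bigmax (F := rho i) x; lia.
have slack_not i i' : i != i' -> m i = m i' -> inr i \notin D.
  move=> ne mii'; apply/negP => iD.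
  have e : m i = inr i.
    have := m_min i (inr i) iD; rewrite /= eqxx.
    by case: (m i) => //= i2; case: eqP => [->|].
  have [e'|[x' e']] := m_cases i'; move: mii'; rewrite e e' //.
  by case=> h; rewrite h eqxx in ne.
have nonempty i i' : i != i' -> m i = m i' -> improving slack_rank m i != set0.
  move=> ne mii'; apply/set0Pn; exists (inr i); apply/improvingP => i2 ne2.
  rewrite /= eq_sym (negPf ne2).
  have [->|[x' ->]] := m_cases i2; rewrite /= ?eqxx //.
  by have := leq_bigmax (F := rho i2) x'; lia.
apply: (card_facet_extension_two slack_rank_inj domD cardD mD m_min jk mjk).
  exact: nonempty jk mjk.
by apply: (@nonempty k j); rewrite 1?eq_sym.
Qed.

(** Double counting of pairs of a dominant set and a facet labelled by all labels
    but [i0]: the facets are extended in two ways, except the outer one, while a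
    set without all labels has an even number of such facets. *)
Lemma full_dominant_exists :
  exists S : {set Z}, [/\ dom S, #|S| = #|I| & slack_label @: S = [set: I]].
Proof.
have [i0 _] : exists i : I, true by apply/card_gt0P; exact: ltnW.
pose room S := dom S && (#|S| == #|I|).
have [/existsP [S /andP[/andP[domS /eqP cS] /eqP lS]]|no_full] :=
  boolP [exists S, room S && (slack_label @: S == [set: I])]; first by exists S.
exfalso.
pose door (D : {set Z}) :=
  [&& dom D, #|D|.+1 == #|I| & slack_label @: D == [set~ i0]].
pose almost (S : {set Z}) (x : Z) := (x \in S) && (slack_label @: (S :\ x) == [set~ i0]).
have even_rooms : ~~ odd (\sum_(S | room S) #|[set x | almost S x]|).
  apply: (big_ind (fun n => ~~ odd n)) => [//|a b|S rS].
    by rewrite oddD => /negPf -> /negPf ->.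
  apply: even_almost_full_facets; first by case/andP: rS => _ /eqP.
  by apply: contra no_full => lS; apply/existsP; exists S; rewrite rS.
have odd_doors :
    odd (\sum_(D | door D) #|[set w | (w \notin D) && dom (w |: D)]|).
  pose D0 := [set (inr i : Z) | i in [set~ i0]].
  have doorD0 : door D0.
    rewrite /door dominant_slack_facet card_slack_facet eqxx /=.
    rewrite -imset_comp; apply/eqP/setP => i; apply/imsetP/idP => [[i' h ->] //|h].
    by exists i.
  rewrite (bigD1 D0) //= facet_extensions_outer oddD /=.
  apply: (big_ind (fun n => ~~ odd n)) => [//|a b|D].
    by rewrite oddD => /negPf -> /negPf ->.
  case/andP => /and3P[domD /eqP cD /eqP lD] nD0.
  have [z] : exists z, (z \in D) && (z \notin D0).
    apply/existsP; apply: contraNT nD0; rewrite negb_exists => /forallP H.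
    rewrite eqEcard; apply/andP; split.
      by apply/subsetP => z zD; have := H z; rewrite zD negbK.
    by rewrite -ltnS cD card_slack_facet.
  case: z => [x|i] /andP[zD zD0].
    by rewrite (facet_extensions_inner domD cD zD).
  have := imset_f slack_label zD; rewrite lD => /= ii0.
  by rewrite (imset_f inr ii0) in zD0.
move: odd_doors; rewrite -[X in odd X](_ : \sum_(S | room S) #|[set x | almost S x]| = _);
  first by apply/negP.
under eq_bigr do rewrite -sum1_card.
under [RHS]eq_bigr do rewrite -sum1_card.
(* A dominant set with a distinguished element is a facet with an extension. *)
rewrite !pair_big_dep /=.
rewrite (reindex_onto (fun p : {set Z} * Z => (p.2 |: p.1, p.2))
                      (fun p : {set Z} * Z => (p.1 :\ p.2, p.2))) /=; last first.
  case=> S x /=; rewrite !inE => /andP[_ /andP[xS _]].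
  by rewrite setD1K.
apply: eq_bigl => -[D x] /=; rewrite !inE /almost /room /door setU11 /=.
have [xD|xD] := boolP (x \in D).
  have /negPf -> : (((x |: D) :\ x, x) != (D, x)).
    by apply/eqP => -[e]; move: xD; rewrite -e !inE eqxx.
  by rewrite !andbF.
rewrite setU1K // eqxx andbT cardsU1 xD add1n /=.
have [domE|] := boolP (dom (x |: D)); last by rewrite andbF.
by rewrite (dominant_sub (subsetU1 x D) domE) andbT.
Qed.

(** The slack elements of the full set stand for the labels that [X] does not carry;
    dropping them leaves dominance in the orders that it does carry. *)
Theorem scarf : exists X : {set T}, forall y,
  exists2 i, i \in c @: X & forall x, x \in X -> (rho i y <= rho i x)%N.
Proof.
have [S [domS cardS labS]] := full_dominant_exists.
pose X := [set x | inl x \in S]; exists X => y.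
have [i Hi] := dominantP _ _ domS (inl y).
have iS : inr i \notin S by apply/negP => /Hi; rewrite /= eqxx.
exists i; last by move=> x; rewrite inE => /Hi.
have : i \in slack_label @: S by rewrite labS inE.
case/imsetP => -[x|i'] zS /= e; last by rewrite e zS in iS.
by rewrite e; apply: imset_f; rewrite inE.
Qed.

End Scarf.

(** * Brouwer's theorem on the simplex *)

Section Subsequences.
Context {R : realType}.
Implicit Types (u v w : nat -> R).

Lemma cvgn_le u v (a b : R) : (forall n, u n <= v n) ->
  u n @[n --> \oo] --> a -> v n @[n --> \oo] --> b -> a <= b.
Proof.
by move=> uv ua vb; apply: (ler_cvg_to ua vb); near=> n; exact: uv.
Unshelve. all: by end_near. Qed.

Lemma cvgn_unique u (a b : R) :
  u n @[n --> \oo] --> a -> u n @[n --> \oo] --> b -> a = b.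
Proof.
move=> ua ub; apply/eqP; rewrite eq_le.
by rewrite (cvgn_le _ ua ub) ?(cvgn_le _ ub ua).
Qed.

Lemma cvgn_close u v w (a : R) : (forall n, `|u n - w n| <= v n) ->
  v n @[n --> \oo] --> (0 : R) -> w n @[n --> \oo] --> a -> u n @[n --> \oo] --> a.
Proof.
move=> uw v0 wa; rewrite -[a]add0r.
have -> : u = (fun n => (u n - w n) + w n) by apply/funext => n; rewrite subrK.
apply: cvgD wa; apply: norm_cvg0; apply: (squeeze_cvgr _ (cvg_cst 0) v0).
by near=> n; rewrite normr_ge0 uw.
Unshelve. all: by end_near. Qed.

Lemma cvgn_sum (I : finType) (u : nat -> I -> R) (a : I -> R) :
  (forall i, u n i @[n --> \oo] --> a i) ->
  \sum_i u n i @[n --> \oo] --> \sum_i a i.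
Proof.
by move=> ua; apply: cvg_big => [|i _]; [exact: add_continuous|exact: ua].
Qed.

Lemma cvg_along (T : topologicalType) (u : nat -> T) (l : T) (phi : nat -> nat) :
  (forall n, n <= phi n)%N -> u n @[n --> \oo] --> l ->
  u (phi n) @[n --> \oo] --> l.
Proof.
move=> phi_ge ul; apply: (cvg_comp phi u _ ul) => A [N _ HN].
by exists N => // n /= Nn; apply: HN => /=; apply: leq_trans (phi_ge n).
Qed.

(** The indices are only required to tend to infinity, which is enough for limits
    along them. *)
Lemma cluster_subsequence (T : pseudoMetricType R) (u : nat -> T) (l : T) :
  cluster (u n @[n --> \oo]) l ->
  exists2 phi : nat -> nat, (forall n, n <= phi n)%N &
    u (phi n) @[n --> \oo] --> l.
Proof.
move=> cl; have near_l (n : nat) : exists m, (n <= m)%N /\ ball l n.+1%:R^-1 (u m).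
  have Fn : (u k @[k --> \oo]) [set u k | k in [set k | (n <= k)%N]].
    by exists n => // k /= nk; exists k.
  have [x [[k nk <-] Bk]] :=
    cl _ _ Fn (nbhsx_ballx l _ (ltac:(by rewrite invr_gt0) : 0 < n.+1%:R^-1 :> R)).
  by exists k.
have [phi Hphi] := choice near_l.
exists phi => [n|]; first by case: (Hphi n).
apply/cvg_ballP => e e0; near=> n.
apply: (@le_ball _ _ _ n.+1%:R^-1); last by case: (Hphi n).
by apply: ltW; near: n; exact: (near_infty_natSinv_lt (PosNum e0)).
Unshelve. all: by end_near. Qed.

End Subsequences.

Section Brouwer.
Context {R : realType}.

Definition simplex N (x : 'I_N -> R) := (forall i, 0 <= x i) /\ \sum_i x i = 1.

Section Grid.
Variables (N m : nat).

Definition grid := {g : {ffun 'I_N -> 'I_m.+1} | (\sum_i g i == m)%N}.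

Definition grid_point (g : grid) (i : 'I_N) : R := (val g i)%:R / m%:R.

Lemma grid_sum (g : grid) : (\sum_i val g i = m)%N.
Proof. exact/eqP/(valP g). Qed.

Lemma grid_point_simplex (g : grid) : (0 < m)%N -> simplex (grid_point g).
Proof.
move=> m_gt0; split=> [i|]; first by rewrite divr_ge0.
rewrite -mulr_suml -natr_sum grid_sum divff // pnatr_eq0; lia.
Qed.

Lemma grid_above (a : 'I_N -> nat) (i0 : 'I_N) : (\sum_i a i <= m)%N ->
  exists g : grid, forall i, (a i <= val g i)%N.
Proof.
move=> am; pose g i := (a i + (i == i0) * (m - \sum_j a j))%N.
have sg : (\sum_i g i = m)%N.
  rewrite big_split /= [X in (_ + X)%N](bigD1 i0) //= eqxx mul1n [X in (_ + (_ + X))%N]big1.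
    by rewrite addn0 subnKC.
  by move=> i /negPf ->.
have gm i : (g i < m.+1)%N by rewrite ltnS -sg (bigD1 i) //= leq_addr.
have Hg : (\sum_i [ffun i => Ordinal (gm i)] i == m)%N.
  by apply/eqP; rewrite -[RHS]sg; apply: eq_bigr => i _; rewrite ffunE.
exists (exist (fun h : {ffun 'I_N -> 'I_m.+1} => (\sum_i h i == m)%N) _ Hg) => i /=.
by rewrite ffunE /= /g; lia.
Qed.

(** The order by the [i]-th coordinate, with ties broken by the enumeration so that
    it becomes injective. *)
Definition grid_rank (i : 'I_N) (g : grid) : nat :=
  (val g i * #|{: grid}| + enum_rank g)%N.

Lemma grid_rank_inj i : injective (grid_rank i).
Proof.
move=> g h /(congr1 (fun k => k %% #|{: grid}|)%N).
by rewrite /grid_rank !modnMDl !modn_small ?ltn_ord // => /val_inj /enum_rank_inj.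
Qed.

Lemma grid_rank_le i (g h : grid) :
  (grid_rank i g <= grid_rank i h)%N -> (val g i <= val h i)%N.
Proof.
apply: contraTT; rewrite -!ltnNge => lt; rewrite /grid_rank.
apply: (@leq_trans ((val h i).+1 * #|{: grid}|)).
  by rewrite mulSn addnC ltn_add2r ltn_ord.
by apply: leq_trans (leq_addr _ _); rewrite leq_mul2r lt orbT.
Qed.

End Grid.

Lemma simplex_label N (F : ('I_N -> R) -> ('I_N -> R)) x :
  simplex x -> simplex (F x) -> exists i, x i <= F x i.
Proof.
move=> [_ sx] [_ sF]; apply: contrapT => /forallNP H.
have N0 : (0 < N)%N.
  by case: N F x sx sF H => // F x; rewrite big_ord0 => /eqP; rewrite eq_sym oner_eq0.
have : \sum_i F x i < \sum_i x i.
  apply: ltr_sum; first by apply/hasP; exists (Ordinal N0); rewrite ?mem_index_enum.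
  by move=> i _; rewrite ltNge; apply/negP/H.
by rewrite sx sF ltxx.
Qed.

(** The label of a grid point is a coordinate that [F] does not decrease.  In the
    set given by [scarf] the minima of the labelled coordinates nearly add up to
    [m], for otherwise some grid point would exceed all of them; so the set has
    small diameter, its unlabelled coordinates are small, and it contains points
    at which each labelled coordinate does not decrease. *)
Lemma brouwer_approx N (F : ('I_N -> R) -> ('I_N -> R)) m :
  (1 < N)%N -> (0 < m)%N -> (forall x, simplex x -> simplex (F x)) ->
  exists z : 'I_N -> R, exists w : 'I_N -> 'I_N -> R,
    [/\ simplex z, forall i, simplex (w i),
        forall i j, `|w i j - z j| <= N%:R / m%:R &
        forall i, z i <= F (w i) i + N%:R / m%:R].
Proof.
move=> N1 m0 FS.
have i0 : 'I_N by exact: Ordinal (ltnW N1).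
have labelled (g : grid N m) : exists i, grid_point g i <= F (grid_point g) i.
  by apply: simplex_label; [|apply: FS]; exact: grid_point_simplex.
have [c Hc] := choice labelled.
have [t0 _] : exists g : grid N m, forall i, (0 <= val g i)%N.
  by apply: (@grid_above N m (fun=> 0%N) i0); rewrite big1.
have [X HX] := scarf c (@grid_rank_inj N m) (ltac:(by rewrite card_ord) : (1 < #|'I_N|)%N) t0.
have [i1 /imsetP [x0 x0X _] _] := HX t0.
pose mn i := [arg min_(x < x0 in X) val x i].
have mnX i : mn i \in X by rewrite /mn; case: arg_minnP.
have mn_min i x : x \in X -> (val (mn i) i <= val x i)%N.
  by rewrite /mn; case: arg_minnP => // ? _; apply.
pose b i := if i \in c @: X then nat_of_ord (val (mn i) i) else 0%N.
have b_le i x : x \in X -> (b i <= val x i)%N.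
  by move=> xX; rewrite /b; case: ifP => // _; exact: mn_min.
have sum_b : (m < \sum_i b i + N)%N.
  pose a i := if i \in c @: X then (val (mn i) i).+1 else 0%N.
  have : (\sum_i a i <= \sum_i b i + N)%N.
    rewrite -[N in (_ + N)%N]card_ord -sum1_card -big_split /=.
    by apply: leq_sum => i _; rewrite /a /b; case: ifP => _; rewrite ?addn1.
  apply: leq_trans; rewrite ltnNge; apply/negP => /(grid_above i0) [g Hg].
  have [i iC Hi] := HX g; have := grid_rank_le (Hi _ (mnX i)).
  by have := Hg i; rewrite /a iC => h1 h2; have := leq_trans h1 h2; rewrite ltnn.
have le_b i x : x \in X -> (val x i <= b i + N)%N.
  move=> xX; have sx := grid_sum x.
  have : (\sum_(j | j != i) b j <= \sum_(j | j != i) val x j)%N.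
    by apply: leq_sum => j _; exact: b_le.
  by move: sx sum_b; rewrite (bigD1 i) //= [in (_ < _)%N](bigD1 i) //=; lia.
have mR : 0 < m%:R :> R by rewrite ltr0n.
have close x y j : x \in X -> y \in X ->
    `|grid_point x j - grid_point y j| <= N%:R / m%:R.
  move=> xX yX; rewrite -mulrBl normrM [`|_^-1|]gtr0_norm ?invr_gt0 //.
  rewrite ler_pM2r ?invr_gt0 // ler_norml.
  have := b_le j x xX; have := b_le j y yX; have := le_b j x xX; have := le_b j y yX.
  move: (nat_of_ord _) (nat_of_ord _) (b j) => p q r h1 h2 h3 h4.
  have h5 : (p <= q + N)%N by lia.
  have h6 : (q <= p + N)%N by lia.
  move: h5 h6; rewrite -!(ler_nat R) !natrD; lra.
have carrier i : exists x, x \in X /\ (i \in c @: X -> c x = i).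
  have [/imsetP [x xX ->]|_] := boolP (i \in c @: X); first by exists x.
  by exists x0.
have [w Hw] := choice carrier.
exists (grid_point x0), (fun i => grid_point (w i)); split.
- exact: grid_point_simplex.
- by move=> i; exact: grid_point_simplex.
- by move=> i j; apply: close => //; case: (Hw i).
- move=> i; have [wX cw] := Hw i; have [iC|iC] := boolP (i \in c @: X).
    have := Hc (w i); rewrite (cw iC); have := close _ _ i wX x0X.
    rewrite ler_norml; lra.
  have [F0 _] := FS _ (grid_point_simplex (w i) m0).
  have : grid_point x0 i <= N%:R / m%:R.
    rewrite ler_pM2r ?invr_gt0 // ler_nat.
    by have := le_b i x0 x0X; rewrite /b (negPf iC).
  by have := F0 i; lra.
Qed.

(** Sequential continuity, in the only form in which it is produced and used. *)
Definition simplex_continuous N (g : ('I_N -> R) -> R) :=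
  forall (xs : nat -> 'I_N -> R) x, (forall k, simplex (xs k)) -> simplex x ->
    (forall i, xs k i @[k --> \oo] --> x i) -> g (xs k) @[k --> \oo] --> g x.

(** In the limit no coordinate decreases under [F], and the coordinates of both
    points add up to 1. *)
Theorem brouwer N (F : ('I_N -> R) -> ('I_N -> R)) : (1 < N)%N ->
  (forall x, simplex x -> simplex (F x)) ->
  (forall i, simplex_continuous (F ^~ i)) ->
  exists2 x, simplex x & forall i, F x i = x i.
Proof.
move=> N1 FS Fc.
have [z Hz] := choice (fun m => brouwer_approx N1 (ltn0Sn m) FS).
have [w Hw] := choice Hz; clear Hz.
pose zr m : 'rV[R]_N := \row_i z m i.
have zS m : simplex (z m) by case: (Hw m).
have cptK : compact [set v : 'rV[R]_N | forall i, `[0 : R, 1]%classic (v ord0 i)].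
  by apply: (@rV_compact R N (fun=> `[0 : R, 1]%classic)) => _; exact: segment_compact.
have [l [_ /cluster_subsequence [phi phi_ge cvl]]] :
    [set v : 'rV[R]_N | forall i, `[0 : R, 1]%classic (v ord0 i)] `&`
      cluster (zr m @[m --> \oo]) !=set0.
  apply: cptK; exists 0%N => // m _ i /=; rewrite mxE in_itv /=.
  have [z0 z1] := zS m; rewrite z0 -z1 (bigD1 i) //= lerDl.
  by apply: sumr_ge0.
have cvz i : z (phi m) i @[m --> \oo] --> l ord0 i.
  have -> : (fun m => z (phi m) i) = (fun v : 'rV[R]_N => v ord0 i) \o (zr \o phi).
    by apply/funext => m; rewrite /= mxE.
  by apply: (cvg_comp (zr \o phi) _ cvl); exact: coord_continuous.
have lS : simplex (fun i => l ord0 i).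
  split=> [i|].
    by apply: (cvgn_le _ (cvg_cst 0) (cvz i)) => m; case: (zS (phi m)).
  rewrite -(cvg_lim _ (cvgn_sum cvz)) //.
  by under eq_fun do rewrite (zS _).2; exact: lim_cst.
exists (fun i => l ord0 i) => //.
have small : N%:R / (phi m).+1%:R @[m --> \oo] --> (0 : R).
  rewrite -[X in _ --> X](mulr0 N%:R); apply: cvgM (cvg_cst _) _.
  exact: (@cvg_along R (@harmonic R) 0 phi phi_ge (@cvg_harmonic R)).
have cvw i j : w (phi m) i j @[m --> \oo] --> l ord0 j.
  by apply: (cvgn_close _ small (cvz j)) => m; case: (Hw (phi m)).
have le i : l ord0 i <= F (fun i => l ord0 i) i.
  have cF : F (w (phi m) i) i + N%:R / (phi m).+1%:R @[m --> \oo] -->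
      F (fun i => l ord0 i) i + 0.
    apply: (cvgD _ small); apply: (Fc i (fun m => w (phi m) i)) lS _ => [k|j].
      by case: (Hw (phi k)).
    exact: cvw.
  by rewrite -[leRHS]addr0; apply: (cvgn_le _ (cvz i) cF) => m; case: (Hw (phi m)).
have [_ s1] := lS; have [_ s2] := FS _ lS.
move=> i; apply/eqP; rewrite -subr_eq0.
have : \sum_j (F (fun i => l ord0 i) j - l ord0 j) == 0 by rewrite sumrB s1 s2 subrr.
by rewrite psumr_eq0 => [/allP/(_ i)|j _]; rewrite ?subr_ge0 ?mem_index_enum //; apply.
Unshelve. all: by end_near. Qed.

End Brouwer.

(** * Fixed rays of a positive map *)

Section Clamp.
Context {R : realType}.
Implicit Types a b x : R.

Definition clamp a b x := Num.max a (Num.min x b).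

Lemma clamp_bounds a b x : a <= b -> a <= clamp a b x <= b.
Proof. by move=> ab; rewrite /clamp le_max lexx /= ge_max ab ge_min lexx orbT. Qed.

Lemma clamp_id a b x : a <= x <= b -> clamp a b x = x.
Proof. by move=> /andP[ax xb]; rewrite /clamp min_l // max_r. Qed.

Lemma clamp_continuous a b : continuous (clamp a b).
Proof.
move=> x; apply: (@continuous_max _ _ (cst a) (fun y => Num.min y b)).
  exact: cst_continuous.
by apply: (@continuous_min _ _ id (cst b)); [exact: cvg_id|exact: cst_continuous].
Qed.

Lemma clamp_cvg a b (u : nat -> R) x : u n @[n --> \oo] --> x ->
  clamp a b (u n) @[n --> \oo] --> clamp a b x.
Proof. by move=> ux; apply: continuous_cvg ux; exact: clamp_continuous. Qed.

End Clamp.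

Section RayFixedPoint.
Context {R : realType}.
Variables (n : nat) (r0 : R).
Hypotheses (n_gt0 : (0 < n)%N) (r0_gt0 : 0 < r0).

Definition corner (c : 'I_n -> R) := (forall k, 0 <= c k) /\ \sum_k c k <= r0.

Definition corner_continuous (g : ('I_n -> R) -> R) :=
  forall (cs : nat -> 'I_n -> R) c, (forall m, corner (cs m)) -> corner c ->
    (forall k, cs m k @[m --> \oo] --> c k) -> g (cs m) @[m --> \oo] --> g c.

Variables (T : ('I_n -> R) -> ('I_n -> R)) (psi : ('I_n -> R) -> R).
Hypothesis T_ge0 : forall c, corner c -> forall k, 0 <= T c k.
Hypothesis T_gt0 : forall c, corner c -> 0 < \sum_k T c k.
Hypothesis T_cont : forall k, corner_continuous (T ^~ k).
Hypothesis psi_cont : corner_continuous psi.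
Hypothesis psi_gt0 : 0 < psi (fun=> 0).
Hypothesis psi_lt0 : forall c, corner c -> \sum_k c k = r0 -> psi c < 0.

Let from_simplex (y : 'I_n.+1 -> R) (k : 'I_n) := r0 * y (lift ord0 k).
Let radius c := clamp 0 r0 (\sum_k c k + psi c).
(** In units of [r0], the last [n] coordinates form the vector with the direction of
    [T c] and total mass [radius c], and the first one is the mass missing to [r0]. *)
Let F (y : 'I_n.+1 -> R) (i : 'I_n.+1) : R :=
  let c := from_simplex y in
  if unlift ord0 i is Some k then radius c / r0 * (T c k / \sum_j T c j)
  else 1 - radius c / r0.

Let from_simplex_corner y : simplex y -> corner (from_simplex y).
Proof.
move=> [y0 y1]; split=> [k|]; first by rewrite mulr_ge0 // ltW.
rewrite -mulr_sumr -[leRHS]mulr1 ler_pM2l // -y1 big_ord_recl lerDr.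
exact: y0.
Qed.

Let F_simplex y : simplex y -> simplex (F y).
Proof.
move=> yS; have cC := from_simplex_corner yS.
have /andP[rad0 rad1] := clamp_bounds (\sum_k from_simplex y k + psi (from_simplex y)) (ltW r0_gt0).
have q0 : 0 <= radius (from_simplex y) / r0 by rewrite divr_ge0 // ltW.
have q1 : radius (from_simplex y) / r0 <= 1 by rewrite ler_pdivrMr ?mul1r.
split=> [i|].
  rewrite /F; case: unlift => [k|]; last by rewrite subr_ge0.
  by rewrite mulr_ge0 // divr_ge0 ?T_ge0 // ltW ?T_gt0.
rewrite big_ord_recl {1}/F unlift_none.
under eq_bigr do rewrite /F liftK.
rewrite -mulr_sumr -mulr_suml divff ?gt_eqF ?T_gt0 // mulr1; lra.
Qed.

Let F_cont i : simplex_continuous (F ^~ i).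
Proof.
move=> ys y ysS yS yc.
have cS m := from_simplex_corner (ysS m); have cC := from_simplex_corner yS.
have cc k : from_simplex (ys m) k @[m --> \oo] --> from_simplex y k.
  by apply: cvgM; [exact: cvg_cst|exact: yc].
have rc : radius (from_simplex (ys m)) @[m --> \oo] --> radius (from_simplex y).
  by apply: clamp_cvg; apply: cvgD; [exact: cvgn_sum|exact: psi_cont].
rewrite /F; case: unlift => [k|].
  apply: cvgM; first by apply: cvgM; [exact: rc|exact: cvg_cst].
  apply: cvgM; first exact: T_cont.
  apply: cvgV; first by rewrite gt_eqF ?T_gt0.
  by apply: cvgn_sum => j; exact: T_cont.
by apply: cvgB; [exact: cvg_cst|apply: cvgM; [exact: rc|exact: cvg_cst]].
Qed.

(** The map to which Brouwer's theorem applies keeps the direction of [T] and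
    moves the radius by [psi], so that a fixed point is a zero of [psi] on which
    [T] is radial. *)
Theorem ray_fixed_point : exists c, [/\ corner c, 0 < \sum_k c k, psi c = 0 &
  forall k, c k * \sum_j T c j = T c k * \sum_j c j].
Proof.
have [y yS Fy] := brouwer (ltac:(by rewrite ltnS) : (1 < n.+1)%N) F_simplex F_cont.
set c := from_simplex y; have cC : corner c by exact: from_simplex_corner.
have S0 := T_gt0 cC.
have ck k : c k = radius c * (T c k / \sum_j T c j).
  rewrite {1}/c /from_simplex -Fy /F liftK -/c.
  by rewrite mulrA [r0 * (_ / _)]mulrCA divff ?mulr1 // gt_eqF.
have sc : \sum_k c k = radius c.
  under eq_bigr do rewrite ck.
  by rewrite -mulr_sumr -mulr_suml divff ?mulr1 // gt_eqF.
have [c0 cr0] := cC.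
have s_gt0 : psi c <= 0 -> 0 < \sum_k c k.
  move=> psic; rewrite lt_neqAle sumr_ge0 // andbT; apply/eqP => s0.
  have e : c = fun=> 0.
    apply/funext => k; have /eqP := esym s0.
    by rewrite psumr_eq0 // => /allP/(_ k); rewrite mem_index_enum => /(_ isT)/eqP.
  by move: psic; rewrite e leNgt psi_gt0.
have psic : psi c = 0.
  have := sc; rewrite /radius /clamp; have [neg|pos|//] := ltgtP (psi c) 0.
    have s0 := s_gt0 (ltW neg); rewrite min_l; last by apply: le_trans cr0; lra.
    by rewrite /Num.max; case: ltP => _ e; exfalso; move: e s0 neg; move: (psi c) (\sum_k _) => p s; lra.
  have s0 : 0 <= \sum_k c k by exact: sumr_ge0.
  have [cr|rc] := leP (\sum_k c k + psi c) r0.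
    rewrite max_r ?addr_ge0 // ?(ltW pos) // => e; exfalso.
    by move: e pos; move: (psi c) (\sum_k _) => p s; lra.
  rewrite max_r ?(ltW r0_gt0) // => e; by have := psi_lt0 cC e; rewrite ltNge (ltW pos).
exists c; split => //; first by apply: s_gt0; rewrite psic.
by move=> k; rewrite {1}ck -sc -mulrA divfK ?gt_eqF // mulrC.
Qed.

End RayFixedPoint.

(** * Integrals over the unit interval *)

Section UnitIntervalIntegral.
Context {R : realType}.
Implicit Types g h w : R -> R.
Local Notation mu := (@lebesgue_measure R).
Local Notation I01 := (`[0%R, 1%R]%classic : set R).

Definition L1 g := mu.-integrable I01 (EFin \o g).
Definition intg g : R := \int[mu]_(s in `[0, 1]) g s.

Let mI01 : measurable I01. Proof. exact: measurable_itv. Qed.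

Lemma lebesgue_I01 : mu I01 = 1%:E.
Proof. by rewrite lebesgue_measure_itv /= lte_fin ltr01 -EFinB subr0. Qed.

Let lebesgue_I01_fin : (mu I01 < +oo)%E.
Proof. by rewrite lebesgue_I01 ltry. Qed.

Lemma L1_bounded g (M : R) : measurable_fun I01 g ->
  (forall s : R, s \in `[0, 1] -> `|g s| <= M) -> L1 g.
Proof.
move=> mg gM; apply: measurable_bounded_integrable => //.
by exists M; split=> [|x Mx s /gM gs]; [exact: num_real|apply: le_trans gs (ltW Mx)].
Qed.

Lemma L1_weighted w g (M : R) : L1 w -> measurable_fun I01 g ->
  (forall s : R, s \in `[0, 1] -> `|g s| <= M) -> L1 (fun s => w s * g s).
Proof.
move=> iw mg gM; rewrite /L1 (_ : EFin \o _ = ((EFin \o w) \* (EFin \o g))%E) //.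
apply: integrableMl => //.
by exists M; split=> [|x Mx s /gM gs]; [exact: num_real|apply: le_trans gs (ltW Mx)].
Qed.

Lemma continuous_bounded_I01 g : {within `[0, 1], continuous g} ->
  exists M : R, forall s : R, s \in `[0, 1] -> `|g s| <= M.
Proof.
move=> cg; have [|c _ Hc] := @EVT_max R (fun s => `|g s|) 0 1 ler01; last by exists `|g c|.
by move=> x; apply: cvg_norm; exact: cg.
Qed.

Lemma continuous_L1 g : {within `[0, 1], continuous g} -> L1 g.
Proof. by move=> cg; apply: continuous_compact_integrable => //; exact: segment_compact. Qed.

Lemma continuous_measurable_I01 g : {within `[0, 1], continuous g} -> measurable_fun I01 g.
Proof. by move=> cg; exact: subspace_continuous_measurable_fun. Qed.

Lemma le_intg g h : L1 g -> L1 h ->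
  (forall s : R, s \in `[0, 1] -> g s <= h s) -> intg g <= intg h.
Proof. by move=> ig ih gh; exact: le_Rintegral. Qed.

Lemma intg_ge0 g : (forall s : R, s \in `[0, 1] -> 0 <= g s) -> 0 <= intg g.
Proof. by move=> g0; exact: Rintegral_ge0. Qed.

Lemma eq_intg g h : (forall s : R, s \in `[0, 1] -> g s = h s) -> intg g = intg h.
Proof. by move=> gh; apply: eq_Rintegral => s; rewrite inE => /gh. Qed.

Lemma L1D g h : L1 g -> L1 h -> L1 (fun s => g s + h s).
Proof. exact: integrableD. Qed.

Lemma L1B g h : L1 g -> L1 h -> L1 (fun s => g s - h s).
Proof. exact: integrableB. Qed.

Lemma L1Z k g : L1 g -> L1 (fun s => k * g s).
Proof. exact: integrableZl. Qed.

Lemma L1_cst k : L1 (fun=> k).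
Proof. by apply: (@L1_bounded _ `|k|) => //; exact: measurable_cst. Qed.

Lemma intgD g h : L1 g -> L1 h -> intg (fun s => g s + h s) = intg g + intg h.
Proof. exact: RintegralD. Qed.

Lemma intgB g h : L1 g -> L1 h -> intg (fun s => g s - h s) = intg g - intg h.
Proof. exact: RintegralB. Qed.

Lemma intgZ k g : L1 g -> intg (fun s => k * g s) = k * intg g.
Proof. exact: RintegralZl. Qed.

Lemma intg_cst k : intg (fun=> k) = k.
Proof.
transitivity (k * fine (mu I01)); first exact: Rintegral_cst.
by rewrite lebesgue_I01 mulr1.
Qed.

Lemma L1_sum (I : Type) (r : seq I) (F : I -> R -> R) :
  (forall i, L1 (F i)) -> L1 (fun s => \sum_(i <- r) F i s).
Proof.
move=> iF; elim: r => [|i r IH]; first by under eq_fun do rewrite big_nil; exact: L1_cst.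
by under eq_fun do rewrite big_cons; exact: L1D.
Qed.

Lemma intg_sum (I : Type) (r : seq I) (F : I -> R -> R) :
  (forall i, L1 (F i)) -> intg (fun s => \sum_(i <- r) F i s) = \sum_(i <- r) intg (F i).
Proof.
move=> iF; elim: r => [|i r IH].
  by under eq_fun do rewrite big_nil; rewrite big_nil intg_cst.
under eq_fun do rewrite big_cons; rewrite intgD ?big_cons ?IH //; exact: L1_sum.
Qed.

Lemma intg_norm_le g h : L1 g -> L1 h ->
  (forall s : R, s \in `[0, 1] -> `|g s| <= h s) -> `|intg g| <= intg h.
Proof.
move=> ig ih gh; rewrite ler_norml -[- intg h]mulN1r -intgZ //.
by apply/andP; split; apply: le_intg => //; [exact: L1Z|..] => s /gh;
   rewrite ler_norml ?mulN1r => /andP[].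
Qed.

Lemma intg_le_cst g (M : R) : L1 g -> (forall s : R, s \in `[0, 1] -> g s <= M) -> intg g <= M.
Proof. by move=> ig gM; rewrite -[leRHS]intg_cst; apply: le_intg => //; exact: L1_cst. Qed.

Lemma cvg_weighted_intg w (g : nat -> R -> R) g0 (M : R) : L1 w ->
  (forall n, measurable_fun I01 (g n)) ->
  (forall n (s : R), s \in `[0, 1] -> `|g n s| <= M) ->
  (forall s : R, s \in `[0, 1] -> g n s @[n --> \oo] --> g0 s) ->
  intg (fun s => w s * g n s) @[n --> \oo] --> intg (fun s => w s * g0 s).
Proof.
move=> iw mg gM gg0.
have mw : measurable_fun I01 w by apply/measurable_EFinP; exact: measurable_int iw.
have mg0 : measurable_fun I01 g0 by exact: measurable_fun_cvg mg gg0.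
have iM : L1 (fun s => `|w s| * M).
  under eq_fun do rewrite mulrC; apply: L1Z; exact: (integrable_norm iw).
have := @dominated_convergence _ _ R mu I01 mI01
  (fun n => EFin \o (fun s => w s * g n s)) (EFin \o (fun s => w s * g0 s))
  (EFin \o (fun s => `|w s| * M)).
case => //.
- by move=> n; apply/measurable_EFinP; exact: (measurable_funM mw (mg n)).
- by apply/measurable_EFinP; exact: (measurable_funM mw mg0).
- apply: aeW => s sI; apply: cvg_EFin; first exact: nearW.
  by apply: cvgM; [exact: cvg_cst | exact: gg0].
- apply: aeW => s n sI /=; rewrite lee_fin normrM ler_wpM2l //; exact: gM.
move=> i0 _; rewrite -[X in _ --> X -> _](@fineK R); last exact: integrable_fin_num.
by move/fine_cvg.
Qed.

End UnitIntervalIntegral.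

(** * The modular of a variable exponent *)

Section Powers.
Context {R : realType}.
Implicit Types (x M e : R).

Lemma powR_le_max x M e (pm pp : R) : 0 < pm -> 0 <= x <= M -> pm <= e <= pp ->
  x `^ e <= Num.max (M `^ pm) (M `^ pp).
Proof.
move=> pm0 /andP[x0 xM] /andP[pme epp].
have M0 := le_trans x0 xM; have e0 := le_trans (ltW pm0) pme.
apply: le_trans (ge0_ler_powR e0 _ _ xM) _; rewrite ?nnegrE // le_max.
have [M1|/ltW M1] := leP M 1; last by rewrite (ler_powR M1 epp) orbT.
have [->|Mn0] := eqVneq M 0.
  have pp0 := lt_le_trans pm0 (le_trans pme epp).
  by rewrite !powR0 ?lexx // gt_eqF // (lt_le_trans pm0 pme).
by rewrite ger_powR // M1 andbT lt_neqAle eq_sym Mn0.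
Qed.

Lemma cvg_powR (u : nat -> R) x e : 1 <= e -> (forall n, 0 <= u n) ->
  u n @[n --> \oo] --> x -> u n `^ e @[n --> \oo] --> x `^ e.
Proof.
move=> e1 u0 ux; have x0 : 0 <= x by exact: (cvgn_le u0 (cvg_cst 0) ux).
have e0 : 0 < e by exact: lt_le_trans ltr01 e1.
move: x0; rewrite le_eqVlt => /predU1P[x0|x0]; last first.
  apply: (@continuous_cvg _ _ _ _ _ u (fun y : R => y `^ e)) ux.
  apply: differentiable_continuous; apply/derivable1_diffP.
  by apply: derivable_powR; rewrite in_itv /= andbT.
rewrite -x0 powR0 ?gt_eqF //; rewrite -x0 in ux.
apply: (squeeze_cvgr _ (cvg_cst 0) ux); near=> n; rewrite powR_ge0 /=.
have [->|un0] := eqVneq (u n) 0; first by rewrite powR0 ?gt_eqF.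
have un : 0 < u n by rewrite lt_neqAle eq_sym un0 u0.
apply: ge1r_powR e1; rewrite un /=; apply: ltW; near: n.
exact: (cvgr_lt _ ux _ ltr01).
Unshelve. all: by end_near. Qed.

End Powers.

Section Modular.
Context {R : realType}.
Local Notation I01 := (`[0%R, 1%R]%classic : set R).
Variables (w p : R -> R) (pm pp : R).
Hypothesis w_L1 : L1 w.
Hypothesis w_ge0 : forall s : R, s \in `[0, 1] -> 0 <= w s.
Hypothesis p_meas : measurable_fun I01 p.
Hypothesis pm_gt1 : 1 < pm.
Hypothesis p_bounds : forall s : R, s \in `[0, 1] -> pm <= p s <= pp.
Implicit Types u v : R -> R.

Definition modular u := intg (fun s => w s * u s `^ p s).

Let pm_gt0 : 0 < pm. Proof. exact: lt_trans ltr01 pm_gt1. Qed.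

Lemma measurable_pow u : measurable_fun I01 u ->
  measurable_fun I01 (fun s => u s `^ p s).
Proof.
move=> mu; have mu0 : measurable_fun I01 (fun s => u s == 0).
  by apply: (measurable_fun_eqr mu (g := cst 0)); exact: measurable_cst.
have sub P : measurable_fun I01 P -> forall B, measurable_fun (I01 `&` B) P.
  by move=> mP B; apply: (@measurable_funS _ _ _ _ I01) mP => //; exact: subIsetl.
rewrite /powR; apply: measurable_fun_if => //; apply: sub.
  apply: (@measurableT_comp _ _ _ _ _ _ (fun b : bool => b%:R : R)) => //.
  by apply: (measurable_fun_eqr p_meas (g := cst 0)); exact: measurable_cst.
apply: measurableT_comp => //; apply: measurable_funM => //.
by apply: measurableT_comp => //; exact: measurable_ln.
Qed.

Lemma pow_bound u (M : R) : (forall s : R, s \in `[0, 1] -> 0 <= u s <= M) ->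
  forall s : R, s \in `[0, 1] -> `|u s `^ p s| <= Num.max (M `^ pm) (M `^ pp).
Proof.
by move=> uM s sI; rewrite ger0_norm ?powR_ge0 //; apply: powR_le_max (p_bounds sI); rewrite ?uM.
Qed.

Lemma modular_L1 u (M : R) : measurable_fun I01 u ->
  (forall s : R, s \in `[0, 1] -> 0 <= u s <= M) -> L1 (fun s => w s * u s `^ p s).
Proof.
by move=> mu uM; apply: L1_weighted w_L1 (measurable_pow mu) (pow_bound uM).
Qed.

Lemma modular_le u (M : R) : measurable_fun I01 u ->
  (forall s : R, s \in `[0, 1] -> 0 <= u s <= M) ->
  modular u <= Num.max (M `^ pm) (M `^ pp) * intg w.
Proof.
move=> mu uM; rewrite -intgZ //; apply: le_intg; [exact: modular_L1 uM|exact: L1Z|].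
move=> s sI; rewrite mulrC ler_wpM2r ?w_ge0 //.
by apply: le_trans (ler_norm _) (pow_bound uM sI).
Qed.

(** The exponents exceed 1, so scaling by [a <= 1] scales each power by at most
    [a]. *)
Lemma modular_shrink u (M a : R) : measurable_fun I01 u ->
  (forall s : R, s \in `[0, 1] -> 0 <= u s <= M) -> 0 < a <= 1 ->
  modular (fun s => a * u s) <= a * modular u.
Proof.
move=> mu uM /andP[a0 a1]; rewrite -intgZ; last exact: modular_L1 uM.
have auM (s : R) : s \in `[0, 1] -> 0 <= a * u s <= M.
  move=> sI; case/andP: (uM s sI) => us0 usM; rewrite mulr_ge0 ?(ltW a0) //=.
  by apply: le_trans usM; rewrite ler_piMl.
apply: le_intg.
- by apply: (modular_L1 _ auM); apply: measurable_funM => //; exact: measurable_cst.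
- by apply: L1Z; exact: modular_L1 uM.
- move=> s sI; rewrite mulrCA ler_wpM2l ?w_ge0 //.
  case/andP: (uM s sI) => us0 _; case/andP: (p_bounds sI) => ps _.
  by apply: ge1r_powRZ; rewrite ?a0 // (le_trans (ltW pm_gt1)).
Qed.

(** The modular is strictly increasing along rays, by [modular_shrink] for [a] or
    for [a^-1]. *)
Lemma modular_scale_eq u (M a : R) : measurable_fun I01 u ->
  (forall s : R, s \in `[0, 1] -> 0 <= u s <= M) -> 0 < a -> 0 < modular u ->
  modular (fun s => a * u s) = modular u -> a = 1.
Proof.
move=> mu uM a0 Phi0 /eqP PhiE; apply/eqP; rewrite eq_le.
apply/andP; split; rewrite leNgt; apply/negP => alt.
  have mau : measurable_fun I01 (fun s => a * u s).
    by apply: measurable_funM => //; exact: measurable_cst.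
  have auM (s : R) : s \in `[0, 1] -> 0 <= a * u s <= a * M.
    by move=> /uM /andP[us0 usM]; rewrite ler_pM2l // usM mulr_ge0 // ltW.
  have a1 : 0 < a^-1 <= 1 by rewrite invr_gt0 a0 invf_le1 // ltW.
  have := modular_shrink mau auM a1.
  under [X in modular X]eq_fun do rewrite mulKf ?gt_eqF //.
  by rewrite (eqP PhiE) ler_pMl // leNgt invf_lt1 // alt.
have a1 : 0 < a <= 1 by rewrite a0 ltW.
by have := modular_shrink mu uM a1; rewrite (eqP PhiE) ler_pMl // leNgt alt.
Qed.

Lemma cvg_modular (u : nat -> R -> R) u0 (M : R) :
  (forall n, measurable_fun I01 (u n)) ->
  (forall n (s : R), s \in `[0, 1] -> 0 <= u n s <= M) ->
  (forall s : R, s \in `[0, 1] -> u n s @[n --> \oo] --> u0 s) ->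
  modular (u n) @[n --> \oo] --> modular u0.
Proof.
move=> mu uM uu0; apply: (cvg_weighted_intg w_L1 (fun n => measurable_pow (mu n))).
  by move=> n s; apply: pow_bound; exact: uM.
move=> s sI; apply: cvg_powR; last exact: uu0.
  by case/andP: (p_bounds sI) => ps _; exact: le_trans (ltW pm_gt1) ps.
by move=> n; case/andP: (uM n s sI).
Qed.

End Modular.

(** * Compactness, Ascoli's theorem and partitions *)

Section Compactness.
Context {R : realType}.

Lemma rectangle_compact (a b c d : R) : compact (`[a, b] `*` `[c, d] : set (R * R)).
Proof. by apply: compact_setX; exact: segment_compact. Qed.

Lemma bounded_on_rectangle (h : R * R -> R) (a b c d : R) :
  {within `[a, b] `*` `[c, d], continuous h} ->
  exists H, forall x y : R, x \in `[a, b] -> y \in `[c, d] -> h (x, y) <= H.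
Proof.
move=> ch; have [[z zK]|K0] := pselect ((`[a, b] `*` `[c, d] : set (R * R)) !=set0).
  have [||z0 _ Hz] := @compact_EVT_max _ R h (`[a, b] `*` `[c, d]) _ _ ch.
  - by exists z.
  - exact: rectangle_compact.
  - by exists (h z0) => x y xI yI; apply: Hz; rewrite inE.
by exists 0 => x y xI yI; case: K0; exists (x, y).
Qed.

Lemma uniformly_continuous_on_rectangle (h : R * R -> R) (a b c d e : R) :
  continuous h -> 0 < e ->
  exists2 r : R, 0 < r & forall x x' y y' : R,
    x \in `[a, b] -> y \in `[c, d] -> `|x - x'| < r -> `|y - y'| < r ->
    `|h (x, y) - h (x', y')| <= e.
Proof.
move=> ch e0.
have := (compact_near_coveringP _).1 (@rectangle_compact a b c d) R 0^'+
  (fun r z => forall z', ball z r z' -> `|h z - h z'| <= e) _.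
case.
  move=> z zK; have e2 : 0 < e / 2 by rewrite divr_gt0.
  have /cvgrPdist_lt /(_ _ e2) := ch z.
  rewrite -nbhs_ballE => -[r0 /= r00 Hr].
  have r2 : 0 < r0 / 2 by rewrite divr_gt0.
  exists (ball z (r0 / 2), [set r | 0 < r < r0 / 2]).
    split; first exact: nbhsx_ballx.
    apply: (@filterS _ _ _) (filterI (nbhs_right_gt 0) (nbhs_right_lt r2)).
    by move=> r [] /= -> ->.
  move=> [z1 r] /= [zz1 /andP[r_gt0 rr0]] z' z1z'.
  have B1 : ball z r0 z1 by apply: le_ball zz1; rewrite ler_pdivrMr // ler_peMr ?ler1n // ltW.
  have B2 : ball z r0 z'.
    rewrite [r0]splitr; apply: ball_triangle zz1 _.
    by apply: le_ball z1z'; exact: ltW.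
  have := Hr _ B1; have := Hr _ B2; rewrite /= => h1 h2.
  rewrite [e]splitr; apply: le_trans (ler_distD (h z) _ _) _.
  by rewrite lerD // ltW // distrC.
move=> r0 /= r00 Hr; exists (r0 / 2); first by rewrite divr_gt0.
move=> x x' y y' xI yI xx' yy'; apply: (Hr (r0 / 2)) => //=.
- by rewrite sub0r normrN gtr0_norm ?divr_gt0 // ltr_pdivrMr // ltr_pMr // ltr1n.
- by rewrite divr_gt0.
Qed.

End Compactness.

Section Ascoli.
Context {R : realType}.

Lemma clamp01_in (t : R) : clamp 0 1 t \in `[0, 1].
Proof. by rewrite in_itv /= clamp_bounds. Qed.

(** Composing with the retraction onto the interval turns a family on [0,1] into
    one on the whole line, to which Ascoli's theorem applies. *)
Lemma ascoli_sequence (u : nat -> R -> R) (M : R) :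
  (forall m (t : R), t \in `[0, 1] -> 0 <= u m t <= M) ->
  (forall (t e : R), t \in `[0, 1] -> 0 < e -> exists2 r : R, 0 < r &
     forall m (t' : R), t' \in `[0, 1] -> `|t - t'| < r -> `|u m t - u m t'| <= e) ->
  exists (phi : nat -> nat) (u0 : R -> R),
    [/\ forall n, (n <= phi n)%N, continuous u0 &
        forall t, u (phi n) (clamp 0 1 t) @[n --> \oo] --> u0 t].
Proof.
move=> uM ueq; pose v m := u m \o clamp 0 1.
pose W : set (R -> R) := [set v m | m in [set: nat]].
have veq (x e : R) : 0 < e -> \forall y \near x, forall m, `|v m x - v m y| <= e.
  move=> e0; have [r r0 Hr] := ueq _ _ (clamp01_in x) e0.
  have /cvgrPdist_lt /(_ _ r0) := @clamp_continuous R 0 1 x.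
  by apply: filterS => y xy m; apply: Hr => //; exact: clamp01_in.
have W_eq : equicontinuous W id.
  move=> x E; rewrite -entourage_ballE => -[e /= e0 He].
  have e2 : 0 < e / 2 by rewrite divr_gt0.
  apply: filterS (veq x _ e2) => y xy _ [m _ <-] /=; apply: He => /=.
  by apply: le_lt_trans (xy m) _; rewrite ltr_pdivrMr // ltr_pMr // ltr1n.
have W_pc : pointwise_precompact W id.
  move=> x; apply: (@precompact_subset _ _ `[0, M]%classic).
    by move=> _ [_ [m _ <-] <-] /=; rewrite in_itv /=; apply: uM; exact: clamp01_in.
  by apply: compact_precompact; [exact: Rhausdorff|exact: segment_compact].
have := pointwise_precompact_equicontinuous W_pc W_eq.
rewrite precompactE => /(_ (@Rhausdorff R)) Wcpt.
have [u0 [_ cl]] := Wcpt (v n @[n --> \oo]) _ (ltac:(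
  by exists 0%N => // n _ /=; apply: subset_closure; exists n)).
have near_u0 (k : nat) : exists m, (k <= m)%N /\
    forall y : R, y \in `[0, 1] -> `|u0 y - v m y| < k.+1%:R^-1.
  have Fk : (v n @[n --> \oo]) [set v n | n in [set n | (k <= n)%N]].
    by exists k => // n /= kn; exists n.
  have k0 : 0 < k.+1%:R^-1 :> R by rewrite invr_gt0.
  have entE : entourage [set z : R * R | `|z.1 - z.2| < k.+1%:R^-1].
    by rewrite -entourage_ballE; exists k.+1%:R^-1.
  have [_ [[m km <-] Hm]] := cl _ _ Fk (fam_nbhs u0 entE (@segment_compact R 0 1)).
  by exists m; split => // y yI; apply: Hm.
have [phi Hphi] := choice near_u0.
have phi_ge n : (n <= phi n)%N by case: (Hphi n).
have cv t : u (phi n) (clamp 0 1 t) @[n --> \oo] --> u0 (clamp 0 1 t).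
  apply: (@cvgn_close _ _ harmonic (cst (u0 (clamp 0 1 t)))).
  - move=> n; rewrite /= distrC ltW //; have [_ /(_ _ (clamp01_in t))] := Hphi n.
    by rewrite /v /= (clamp_id (clamp_bounds t ler01)).
  - exact: cvg_harmonic.
  - exact: cvg_cst.
exists phi, (u0 \o clamp 0 1); split=> // x.
apply/cvgrPdist_le => e e0; apply: filterS (veq x _ e0) => y xy.
apply: (@cvgn_le _ (fun n => `|v (phi n) x - v (phi n) y|) (cst e)).
- by move=> n; exact: xy.
- by apply: cvg_norm; apply: cvgB; exact: cv.
- exact: cvg_cst.
Qed.

End Ascoli.

Section Partition.
Context {R : realType}.
Local Notation I01 := (`[0%R, 1%R]%classic : set R).

(** The tags avoid the end points of the interval, where the maximum of the
    Green function may vanish. *)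
Lemma tagged_partition (r : R) : 0 < r ->
  exists n (tag : 'I_n -> R) (piece : 'I_n -> R -> R),
  [/\ (0 < n)%N, forall k, tag k \in `]0, 1[,
      forall k, measurable_fun I01 (piece k) /\ forall s, 0 <= piece k s <= 1,
      forall s : R, s \in `[0, 1] -> \sum_k piece k s = 1 &
      forall k (s : R), piece k s != 0 -> `|tag k - s| < r].
Proof.
move=> r0; pose N := (Num.truncn (2 / r)).+1.
have N0 : 0 < N%:R :> R by rewrite ltr0n.
have Nr : 2 / N%:R < r.
  by rewrite ltr_pdivrMr // mulrC -ltr_pdivrMr //; exact: truncnS_gt.
pose cell k (s : R) := (k%:R <= s * N%:R) && (s * N%:R < k.+1%:R).
(* Cell [k] starts at [k / N]; cell [N] is needed for the point 1 alone. *)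
exists N.+1, (fun k : 'I_N.+1 => k.+1%:R / N.+2%:R), (fun k s => (cell k s)%:R).
split=> //.
- move=> k; rewrite in_itv /= divr_gt0 ?ltr0n // ltr_pdivrMr ?ltr0n // mul1r ltr_nat.
  by rewrite ltnS ltn_ord.
- move=> k; split; last by move=> s; rewrite ler0n lern1 leq_b1.
  apply: (@measurableT_comp _ _ _ _ _ _ (fun b : bool => b%:R : R)) => //.
  apply: measurable_and.
    apply: (measurable_fun_ler (f := cst _)); first exact: measurable_cst.
    by apply: measurable_funM => //; exact: measurable_cst.
  apply: (measurable_fun_ltr (g := cst _)); last exact: measurable_cst.
  by apply: measurable_funM => //; exact: measurable_cst.
- move=> s /andP[s0 s1]; have sN0 : 0 <= s * N%:R by rewrite mulr_ge0 // ltW.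
  have kN : (Num.truncn (s * N%:R) < N.+1)%N.
    have /andP[le _] := truncn_itv sN0; rewrite ltnS -(ler_nat R).
    by apply: le_trans le _; rewrite ler_piMl // ltW.
  rewrite (bigD1 (Ordinal kN)) //= /cell truncn_itv // big1 ?addr0 // => k.
  rewrite -truncn_eq // => /eqP ne; case: eqP => // e.
  by case: ne; apply/val_inj.
- move=> k s; rewrite pnatr_eq0 eqb0 negbK => /andP[ks sk].
  apply: le_lt_trans Nr.
  have kN : k.+1%:R <= N.+1%:R :> R by rewrite ler_nat ltn_ord.
  have N2 : 0 < N.+2%:R :> R by rewrite ltr0n.
  rewrite -(ler_pM2r N0) divfK ?gt_eqF // -[N%:R in leLHS](gtr0_norm N0) -normrM mulrBl.
  have q1 : k.+1%:R / N.+2%:R * N%:R <= k.+1%:R :> R.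
    by rewrite mulrAC ler_pdivrMr // ler_pM2l ?ltr0n // ler_nat; lia.
  have q2 : k.+1%:R - 2 <= k.+1%:R / N.+2%:R * N%:R :> R.
    have -> : k.+1%:R / N.+2%:R * N%:R = k.+1%:R - 2 * (k.+1%:R / N.+2%:R) :> R.
      have -> : N%:R = N.+2%:R - 2 :> R by rewrite -natrB.
      by field; rewrite gt_eqF.
    rewrite lerD2l lerN2 ler_piMr // ler_pdivrMr // mul1r ler_nat.
    by have := ltn_ord k; lia.
  have e : k.+1%:R = k%:R + 1 :> R by rewrite -natr1.
  rewrite ler_norml; set A := _ * N%:R in q1 q2 *; set B := s * N%:R in ks sk *.
  rewrite e in q1 q2 sk; clearbody A B; move: (k%:R) ks q1 q2 sk => C *.
  by apply/andP; split; lra.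
Qed.

End Partition.

(** * Compression and expansion for nonlocal Hammerstein operators *)

Section JointContinuity.
Context {R : realType}.
Local Notation I01 := (`[0%R, 1%R]%classic : set R).
Variable h : R -> R -> R.
Hypothesis h_cont : continuous (fun z : R * R => h z.1 z.2).

Lemma continuous_graph (u : R -> R) : continuous u -> continuous (fun s => h s (u s)).
Proof.
move=> cu s; apply: (@continuous2_cvg _ _ _ _ _ _ id u h _ _ (@h_cont (s, u s))).
  exact: cvg_id.
exact: cu.
Qed.

Lemma continuous_left (s : R) : continuous (h ^~ s).
Proof.
move=> t; apply: (@continuous2_cvg _ _ _ _ _ _ id (cst s) h _ _ (@h_cont (t, s))).
  exact: cvg_id.
exact: cvg_cst.
Qed.

Lemma continuous_right (t : R) : continuous (h t).
Proof.
move=> s; apply: (@continuous2_cvg _ _ _ _ _ _ (cst t) id h _ _ (@h_cont (t, s))).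
  exact: cvg_cst.
exact: cvg_id.
Qed.

Lemma cvg_right (t : R) (x : nat -> R) x0 :
  x n @[n --> \oo] --> x0 -> h t (x n) @[n --> \oo] --> h t x0.
Proof. by move=> xx0; apply: continuous_cvg xx0; exact: continuous_right. Qed.

End JointContinuity.

Section Hammerstein.
Context {R : realType}.
Local Notation I01 := (`[0%R, 1%R]%classic : set R).
Variables (f G : R -> R -> R) (w p a : R -> R).
Variables (pm pp alpha beta eta0 c0 M rho1 rho2 abar Gmax H : R).
Hypothesis f_cont : continuous (fun z : R * R => f z.1 z.2).
Hypothesis f_ge0 : forall s x, 0 <= f s x.
Hypothesis f_le : forall s x : R, s \in `[0, 1] -> x \in `[0, M] -> f s x <= H.
Hypothesis G_cont : continuous (fun z : R * R => G z.1 z.2).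
Hypothesis G_ge0 : forall t s, 0 <= G t s.
Hypothesis G_le : forall t s : R, t \in `[0, 1] -> s \in `[0, 1] -> G t s <= Gmax.
Hypothesis w_L1 : L1 w.
Hypothesis w_ge0 : forall s : R, s \in `[0, 1] -> 0 <= w s.
Hypothesis p_meas : measurable_fun I01 p.
Hypothesis pm_gt1 : 1 < pm.
Hypothesis p_bounds : forall s : R, s \in `[0, 1] -> pm <= p s <= pp.
Hypothesis a_cont : continuous a.
Hypothesis a_gt0 : forall x, 0 < a x.
Hypothesis a_le : forall x, a x <= abar.
Hypotheses (rho1_gt0 : 0 < rho1) (rho12 : rho1 < rho2) (M_gt0 : 0 < M).
Hypotheses (alpha_ge0 : 0 <= alpha) (beta_le1 : beta <= 1).
Hypothesis G_harnack : forall t t' s : R, t \in `[alpha, beta] -> t' \in `[0, 1] ->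
  s \in `[0, 1] -> eta0 * G t' s <= G t s.
Hypothesis G_mass : forall s t' : R, s \in `]0, 1[ -> t' \in `[0, 1] ->
  c0 * G t' s <= intg (G ^~ s).
Hypothesis G_mass_gt0 : forall s : R, s \in `]0, 1[ -> 0 < intg (G ^~ s).
Local Notation Phi := (modular w p).

Definition kernel_cone (u : R -> R) :=
  [/\ continuous u, forall t, 0 <= u t,
      forall t t' : R, t \in `[alpha, beta] -> t' \in `[0, 1] -> eta0 * u t' <= u t &
      forall t' : R, t' \in `[0, 1] -> c0 * u t' <= intg u].

Definition hammerstein (u : R -> R) (t : R) := intg (fun s => G t s * f s (u s)).

Hypothesis cone_bound : forall u, kernel_cone u -> Phi u <= rho2 ->
  forall t : R, t \in `[0, 1] -> u t <= M.

Lemma continuous_bm (u : R -> R) : continuous u -> measurable_fun I01 u.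
Proof. by move=> cu; apply: continuous_measurable_I01; exact: continuous_subspaceT. Qed.

Lemma continuous_L1T (u : R -> R) : continuous u -> L1 u.
Proof. by move=> cu; apply: continuous_L1; exact: continuous_subspaceT. Qed.

Lemma subitv01 (s : R) : s \in `]0, 1[ -> s \in `[0, 1].
Proof. by rewrite !in_itv /= => /andP[s0 s1]; rewrite !ltW. Qed.

Section Discretization.
Variables (n : nat) (tag : 'I_n -> R) (piece : 'I_n -> R -> R) (eps : R).
Hypotheses (n_gt0 : (0 < n)%N) (eps_gt0 : 0 < eps).
Hypothesis tag_in : forall k, tag k \in `]0, 1[.
Hypothesis piece_meas : forall k, measurable_fun I01 (piece k).
Hypothesis piece_ge0 : forall k s, 0 <= piece k s <= 1.
Hypothesis piece_sum : forall s : R, s \in `[0, 1] -> \sum_k piece k s = 1.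
Hypothesis tag_close : forall k (t s : R), t \in `[0, 1] -> s \in `[0, 1] ->
  piece k s != 0 -> `|G t (tag k) - G t s| <= eps.

Definition combination (c : 'I_n -> R) (t : R) := \sum_k c k * G t (tag k).

(** The coefficient of the section [G ^~ (tag k)] in the discretised operator.  The
    additional [eps] keeps the total mass positive even where [f] vanishes, as
    normalisation of the direction requires. *)
Definition cell_mass (u : R -> R) k :=
  a (Phi u) * intg (fun s => piece k s * f s (u s)) + eps * intg (piece k).

Lemma piece_L1 k : L1 (piece k).
Proof.
by apply: (@L1_bounded _ _ 1) => // s _; case/andP: (piece_ge0 k s) => p0 p1; rewrite ger0_norm.
Qed.

Lemma piece_weighted_L1 k (g : R -> R) : continuous g -> L1 (fun s => piece k s * g s).
Proof.
move=> cg; have [B HB] := continuous_bounded_I01 (continuous_subspaceT cg).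
by apply: (L1_weighted (piece_L1 k) _ HB); exact: continuous_bm.
Qed.

Lemma sum_piece (g : R -> R) : continuous g ->
  \sum_k intg (fun s => piece k s * g s) = intg g.
Proof.
move=> cg; rewrite -intg_sum => [|k]; last exact: piece_weighted_L1.
by apply: eq_intg => s sI; rewrite -mulr_suml piece_sum ?mul1r.
Qed.

Lemma sum_piece1 : \sum_k intg (piece k) = 1.
Proof.
rewrite -[RHS](intg_cst (1 : R)) -(@sum_piece (fun=> 1)); last by move=> ?; exact: cvg_cst.
by apply: eq_bigr => k _; apply: eq_intg => s _; rewrite mulr1.
Qed.

Lemma combination_continuous c : continuous (combination c).
Proof.
apply: continuous_big => [|k _]; first exact: add_continuous.
by move=> t; apply: cvgM; [exact: cvg_cst|exact: continuous_left].
Qed.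

Lemma combination_ge0 c t : (forall k, 0 <= c k) -> 0 <= combination c t.
Proof. by move=> c0'; apply: sumr_ge0 => k _; rewrite mulr_ge0. Qed.

Lemma combination_le c r t : (forall k, 0 <= c k) -> \sum_k c k <= r ->
  t \in `[0, 1] -> combination c t <= r * Gmax.
Proof.
move=> c0' cr tI; have Gmax0 : 0 <= Gmax.
  by apply: le_trans (G_ge0 t t) (G_le tI tI).
apply: le_trans (ler_wpM2r Gmax0 cr); rewrite mulr_suml.
by apply: ler_sum => k _; rewrite ler_wpM2l // G_le // subitv01.
Qed.

Lemma intg_combination c : intg (combination c) = \sum_k c k * intg (G ^~ (tag k)).
Proof.
have cG k : continuous (G ^~ (tag k)) by exact: continuous_left.
rewrite intg_sum => [|k]; last by apply: L1Z; exact: continuous_L1T.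
by apply: eq_bigr => k _; rewrite intgZ //; exact: continuous_L1T.
Qed.

Lemma combination_cone c : (forall k, 0 <= c k) -> kernel_cone (combination c).
Proof.
move=> c0'; split; [exact: combination_continuous|by move=> t; exact: combination_ge0|..].
  move=> t t' tI t'I; rewrite /combination mulr_sumr; apply: ler_sum => k _.
  by rewrite mulrCA ler_wpM2l // G_harnack // subitv01.
move=> t' t'I; rewrite intg_combination /combination mulr_sumr; apply: ler_sum => k _.
by rewrite mulrCA ler_wpM2l // G_mass.
Qed.

Lemma cvg_combination (cs : nat -> 'I_n -> R) c t :
  (forall k, cs m k @[m --> \oo] --> c k) ->
  combination (cs m) t @[m --> \oo] --> combination c t.
Proof. by move=> cc; apply: cvgn_sum => k; apply: cvgM; [exact: cc|exact: cvg_cst]. Qed.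

Lemma cvg_modular_combination (cs : nat -> 'I_n -> R) c r :
  (forall m k, 0 <= cs m k) -> (forall m, \sum_k cs m k <= r) ->
  (forall k, cs m k @[m --> \oo] --> c k) ->
  Phi (combination (cs m)) @[m --> \oo] --> Phi (combination c).
Proof.
move=> cs0 csr cc.
apply: (cvg_modular w_L1 p_meas pm_gt1 p_bounds (M := r * Gmax)).
- by move=> m; apply: continuous_bm; exact: combination_continuous.
- by move=> m s sI; rewrite combination_ge0 ?combination_le.
- by move=> s _; exact: cvg_combination.
Qed.

Lemma cell_mass_ge0 u k : 0 <= cell_mass u k.
Proof.
have p0 s : 0 <= piece k s by case/andP: (piece_ge0 k s).
by rewrite addr_ge0 // mulr_ge0 ?(ltW eps_gt0) ?(ltW (a_gt0 _)) // intg_ge0 // => s _; rewrite mulr_ge0.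
Qed.

Lemma sum_cell_mass u : continuous u ->
  \sum_k cell_mass u k = a (Phi u) * intg (fun s => f s (u s)) + eps.
Proof.
move=> cu; rewrite big_split /= -!mulr_sumr sum_piece1 mulr1 sum_piece //.
exact: continuous_graph.
Qed.

Lemma sum_cell_mass_gt0 u : continuous u -> 0 < \sum_k cell_mass u k.
Proof.
by move=> cu; rewrite sum_cell_mass // ltr_wpDl // mulr_ge0 ?(ltW (a_gt0 _)) // intg_ge0.
Qed.

Lemma sum_cell_mass_le u B : continuous u ->
  (forall s : R, s \in `[0, 1] -> f s (u s) <= B) ->
  \sum_k cell_mass u k <= abar * B + eps.
Proof.
move=> cu fB; rewrite sum_cell_mass // lerD2r.
have cf : L1 (fun s => f s (u s)) by apply: continuous_L1T; exact: continuous_graph.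
by apply: ler_pM => //; [exact: ltW|exact: intg_ge0|exact: intg_le_cst].
Qed.

Lemma cvg_cell_mass (cs : nat -> 'I_n -> R) c r k :
  (forall m k, 0 <= cs m k) -> (forall m, \sum_k cs m k <= r) ->
  (forall k, cs m k @[m --> \oo] --> c k) ->
  cell_mass (combination (cs m)) k @[m --> \oo] --> cell_mass (combination c) k.
Proof.
move=> cs0 csr cc; apply: cvgD (cvg_cst _).
apply: cvgM.
  by apply: continuous_cvg (cvg_modular_combination cs0 csr cc); exact: a_cont.
have [B HB] := bounded_on_rectangle (a := 0) (b := 1) (c := 0) (d := r * Gmax)
  (continuous_subspaceT f_cont).
apply: (cvg_weighted_intg (piece_L1 k) (M := B)).
- move=> m; apply: continuous_bm; apply: continuous_graph => //.
  exact: combination_continuous.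
- move=> m s sI; rewrite ger0_norm //; apply: (HB s) => //.
  by rewrite in_itv /= combination_ge0 ?combination_le.
- by move=> s _; apply: cvg_right => //; exact: cvg_combination.
Qed.

(** The signs that [ray_fixed_point] needs: the zero function has modular 0, below
    the truncation, while coefficients of total mass [r0] have modular above [rho2],
    as [cone_bound] would otherwise bound their mass. *)
Lemma discrete_solution : exists c, [/\ forall k, 0 <= c k, 0 < \sum_k c k,
  Phi (combination c) =
    clamp rho1 rho2 (Phi (combination (cell_mass (combination c)))) &
  forall k, c k * \sum_j cell_mass (combination c) j =
    cell_mass (combination c) k * \sum_j c j].
Proof.
pose g k := intg (G ^~ (tag k)).
have g0 k : 0 < g k by exact: G_mass_gt0.
(* A combination bounded by [M] has integral at most [M], which bounds each
   coefficient by [M / g k]. *)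
pose r0 := M * \sum_k (g k)^-1 + 1.
have r0_gt0 : 0 < r0.
  by rewrite ltr_wpDl // mulr_ge0 ?(ltW M_gt0) // sumr_ge0 // => k _; rewrite invr_ge0 ltW.
pose T c := cell_mass (combination c).
pose psi c := clamp rho1 rho2 (Phi (combination (T c))) - Phi (combination c).
have [B HB] := bounded_on_rectangle (a := 0) (b := 1) (c := 0) (d := r0 * Gmax)
  (continuous_subspaceT f_cont).
have T_le c : corner r0 c -> \sum_k T c k <= abar * B + eps.
  move=> [c0' cr]; apply: sum_cell_mass_le; first exact: combination_continuous.
  move=> s sI; apply: HB => //.
  by rewrite in_itv /= combination_ge0 ?combination_le.
have psi0 : 0 < psi (fun=> 0).
  have -> : psi (fun=> 0) = clamp rho1 rho2 (Phi (combination (T (fun=> 0)))).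
    rewrite /psi (_ : Phi (combination (fun=> 0)) = 0) ?subr0 //.
    rewrite -[RHS](intg_cst (0 : R)); apply: eq_intg => s sI.
    rewrite /combination big1 ?powR0 ?mulr0 // => [|k _]; last by rewrite mul0r.
    have /andP[ps _] := p_bounds sI.
    by rewrite gt_eqF // (lt_le_trans _ ps) // (lt_trans ltr01).
  by apply: lt_le_trans rho1_gt0 _; case/andP: (clamp_bounds (Phi (combination (T (fun=> 0)))) (ltW rho12)).
have psi_r0 c : corner r0 c -> \sum_k c k = r0 -> psi c < 0.
  move=> [c0' _] cr; rewrite subr_lt0.
  have /andP[_ le2] := clamp_bounds (Phi (combination (T c))) (ltW rho12).
  apply: le_lt_trans le2 _; rewrite ltNge; apply/negP => le2.
  have uM := cone_bound (combination_cone c0') le2.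
  have : intg (combination c) <= M.
    by apply: intg_le_cst => //; apply: continuous_L1T; exact: combination_continuous.
  rewrite intg_combination => IM.
  have ck k : c k <= M * (g k)^-1.
    rewrite ler_pdivlMr //; apply: le_trans IM; rewrite (bigD1 k) //= lerDl.
    by apply: sumr_ge0 => j _; rewrite mulr_ge0 // ltW //; exact: g0.
  have : \sum_k c k <= M * \sum_k (g k)^-1 by rewrite mulr_sumr; exact: ler_sum.
  by rewrite cr /r0; lra.
have [c [[c0' cr] cpos psic Hc]] : exists c, [/\ corner r0 c, 0 < \sum_k c k, psi c = 0 &
    forall k, c k * \sum_j T c j = T c k * \sum_j c j].
  apply: ray_fixed_point => //.
  - by move=> c _ k; exact: cell_mass_ge0.
  - by move=> c _; apply: sum_cell_mass_gt0; exact: combination_continuous.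
  - move=> k cs c csC cC cc; apply: (@cvg_cell_mass cs c r0 k) => //.
      by move=> m j; case: (csC m).
    by move=> m; case: (csC m).
  - move=> cs c csC cC cc; apply: cvgB.
      apply: clamp_cvg; apply: (cvg_modular_combination (r := abar * B + eps)).
      + by move=> m k; exact: cell_mass_ge0.
      + by move=> m; exact: T_le.
      + move=> k; apply: (@cvg_cell_mass cs c r0 k) => //.
          by move=> m j; case: (csC m).
        by move=> m; case: (csC m).
    apply: (@cvg_modular_combination cs c r0) => //.
      by move=> m j; case: (csC m).
    by move=> m; case: (csC m).
exists c; split=> //; apply/eqP; rewrite eq_sym -subr_eq0; exact/eqP.
Qed.

(** [v] is the discretised image of [u], so it differs from the true image by the
    oscillation of [G] over a cell and by the added mass. *)
Lemma approximate_solution : exists u v sigma, [/\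
  kernel_cone u, kernel_cone v, 0 < sigma, (forall t, u t = sigma * v t) &
  Phi u = clamp rho1 rho2 (Phi v)] /\
  (forall t : R, t \in `[0, 1] ->
     `|v t - a (Phi u) * hammerstein u t| <= eps * (abar * H + Gmax)) /\
  (forall (t t' d : R), (forall s : R, s \in `[0, 1] -> `|G t s - G t' s| <= d) ->
     `|v t - v t'| <= d * (abar * H + eps)).
Proof.
have [c [c0' cpos PhiE Hc]] := discrete_solution.
set u := combination c in PhiE Hc.
have cu : continuous u by exact: combination_continuous.
have uK : kernel_cone u by exact: combination_cone.
have S0 : 0 < \sum_j cell_mass u j by exact: sum_cell_mass_gt0.
have uM t : t \in `[0, 1] -> u t <= M.
  apply: cone_bound => //; rewrite PhiE.
  by case/andP: (clamp_bounds (Phi (combination (cell_mass u))) (ltW rho12)).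
have u0 t : 0 <= u t by case: uK.
have fH (s : R) : s \in `[0, 1] -> f s (u s) <= H.
  by move=> sI; apply: f_le => //; rewrite in_itv /= u0 uM.
have cf : continuous (fun s => f s (u s)) by exact: continuous_graph.
have intf : intg (fun s => f s (u s)) <= H by apply: intg_le_cst => //; exact: continuous_L1T.
exists u, (combination (cell_mass u)), ((\sum_j c j) / \sum_j cell_mass u j).
split; [split=> //|split].
- by apply: combination_cone => k; exact: cell_mass_ge0.
- by rewrite divr_gt0.
- move=> t; rewrite /combination mulr_sumr; apply: eq_bigr => k _.
  rewrite mulrA; congr (_ * _); rewrite mulrAC [_ * cell_mass _ _]mulrC -Hc.
  by rewrite mulfK // gt_eqF.
- move=> t tI.
  have piece0 k s : 0 <= piece k s by case/andP: (piece_ge0 k s).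
  have -> : combination (cell_mass u) t - a (Phi u) * hammerstein u t =
      a (Phi u) * (\sum_k (intg (fun s => piece k s * f s (u s)) * G t (tag k))
        - hammerstein u t) + eps * \sum_k intg (piece k) * G t (tag k).
    rewrite mulrBr addrAC; congr (_ - _); rewrite !mulr_sumr -big_split /=.
    by apply: eq_bigr => k _; rewrite mulrDl !mulrA.
  rewrite [leRHS]mulrDr; apply: le_trans (ler_normD _ _) _; apply: lerD; last first.
    rewrite ger0_norm; last first.
      rewrite mulr_ge0 ?(ltW eps_gt0) // sumr_ge0 // => k _.
      by rewrite mulr_ge0 // intg_ge0.
    rewrite ler_wpM2l ?(ltW eps_gt0) // -[leRHS]mul1r -sum_piece1 mulr_suml.
    apply: ler_sum => k _; rewrite ler_wpM2l ?intg_ge0 //.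
    by apply: G_le => //; exact: subitv01.
  rewrite normrM gtr0_norm // mulrCA; apply: ler_pM => //; first exact: ltW.
  have cGf k : continuous (fun s => (G t (tag k) - G t s) * f s (u s)).
    move=> s; apply: cvgM; last exact: cf.
    by apply: cvgB; [exact: cvg_cst|exact: continuous_right].
  have -> : \sum_k (intg (fun s => piece k s * f s (u s)) * G t (tag k)) - hammerstein u t
      = \sum_k intg (fun s => piece k s * ((G t (tag k) - G t s) * f s (u s))).
    have cGf' : continuous (fun s => G t s * f s (u s)).
      by move=> s; apply: cvgM; [exact: continuous_right|exact: cf].
    rewrite /hammerstein -sum_piece // -sumrB; apply: eq_bigr => k _.
    rewrite mulrC -intgZ; last exact: piece_weighted_L1.
    rewrite -intgB; [|apply: L1Z; exact: piece_weighted_L1|exact: piece_weighted_L1].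
    by apply: eq_intg => s _; ring.
  apply: le_trans (ler_norm_sum _ _ _) _.
  rewrite -(sum_piece cf) in intf.
  apply: (@le_trans _ _ (eps * \sum_k intg (fun s => piece k s * f s (u s)))); last first.
    by rewrite ler_wpM2l // ltW.
  rewrite mulr_sumr; apply: ler_sum => k _.
  rewrite -intgZ; last exact: piece_weighted_L1.
  apply: intg_norm_le; [exact: piece_weighted_L1|apply: L1Z; exact: piece_weighted_L1|].
  move=> s sI; rewrite !normrM ger0_norm // [`|f _ _|]ger0_norm // mulrCA.
  have [->|ps] := eqVneq (piece k s) 0; first by rewrite !mul0r !mulr0.
  by rewrite ler_wpM2r ?mulr_ge0 // tag_close.
- move=> t t' d Gd.
  have d0 : 0 <= d by apply: le_trans (Gd 0 _); rewrite ?in_itv /= ?lexx ?ler01.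
  rewrite /combination -sumrB; apply: le_trans (ler_norm_sum _ _ _) _.
  apply: (@le_trans _ _ (d * \sum_k cell_mass u k)).
    rewrite mulr_sumr; apply: ler_sum => k _; rewrite -mulrBr normrM ger0_norm ?cell_mass_ge0 //.
    by rewrite mulrC ler_wpM2r ?cell_mass_ge0 // Gd // subitv01.
  by rewrite ler_wpM2l //; exact: sum_cell_mass_le.
Qed.

End Discretization.

Hypothesis cone_expand : forall u, kernel_cone u -> Phi u = rho1 ->
  rho1 < Phi (fun t => a (Phi u) * hammerstein u t).
Hypothesis cone_compress : forall u, kernel_cone u -> Phi u = rho2 ->
  Phi (fun t => a (Phi u) * hammerstein u t) < rho2.

Let image u t := a (Phi u) * hammerstein u t.

Let I0 : (0 : R) \in `[0, 1]. Proof. by rewrite in_itv /= lexx ler01. Qed.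

Lemma hammerstein_continuous (u : R -> R) : continuous u -> continuous (hammerstein u).
Proof.
move=> cu t; have cf := continuous_graph f_cont cu.
have If0 : 0 <= intg (fun s => f s (u s)) by exact: intg_ge0.
have iGf x : L1 (fun s => G x s * f s (u s)).
  by apply: continuous_L1T => s; apply: cvgM; [exact: continuous_right|exact: cf].
apply/cvgrPdist_le => e e0.
have e1 : 0 < e / (intg (fun s => f s (u s)) + 1) by rewrite divr_gt0 // ltr_wpDl.
have [r r0 Hr] := uniformly_continuous_on_rectangle t t 0 1 G_cont e1.
have := nbhsx_ballx t r r0; apply: filterS => t' tt'.
rewrite /hammerstein -intgB //.
apply: (@le_trans _ _ (e / (intg (fun s => f s (u s)) + 1) * intg (fun s => f s (u s)))).
  rewrite -intgZ; last exact: continuous_L1T.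
  apply: intg_norm_le.
  - exact: L1B.
  - by apply: L1Z; exact: continuous_L1T.
  - move=> s sI; rewrite -mulrBl normrM [`|f _ _|]ger0_norm // ler_wpM2r //.
    by apply: Hr; rewrite ?in_itv /= ?lexx ?subrr ?normr0.
by rewrite mulrAC ler_pdivrMr ?ltr_wpDl // ler_pM2l // lerDl.
Qed.

Lemma hammerstein_ge0 u t : 0 <= hammerstein u t.
Proof. by apply: intg_ge0 => s _; rewrite mulr_ge0. Qed.

Let image_continuous (u : R -> R) : continuous u -> continuous (image u).
Proof.
by move=> cu t; apply: cvgM; [exact: cvg_cst|exact: hammerstein_continuous].
Qed.

Let image_ge0 u t : 0 <= image u t.
Proof. by rewrite mulr_ge0 ?hammerstein_ge0 // ltW. Qed.

Let image_le (u : R -> R) (t : R) : continuous u -> (forall s, 0 <= u s) ->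
  (forall s : R, s \in `[0, 1] -> u s <= M) -> t \in `[0, 1] ->
  image u t <= abar * (Gmax * H).
Proof.
move=> cu u0 uM tI; apply: ler_pM; rewrite ?hammerstein_ge0 ?(ltW (a_gt0 _)) //.
apply: intg_le_cst => [|s sI].
  apply: continuous_L1T => s; apply: cvgM; first exact: continuous_right.
  exact: continuous_graph.
by apply: ler_pM => //; [exact: G_le|apply: f_le; rewrite // in_itv /= u0 uM].
Qed.

Let kappa := rho1 / (intg w + rho1 + 1).

Let intw_ge0 : 0 <= intg w. Proof. exact: intg_ge0. Qed.

Let kappa_gt0 : 0 < kappa.
Proof. by rewrite divr_gt0 // !ltr_wpDl // addr_ge0 // ltW. Qed.

Let kappa_lt1 : kappa < 1.
Proof.
have d0 : 0 < intg w + rho1 + 1 by rewrite ltr_wpDl // addr_ge0 // ltW.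
by rewrite /kappa ltr_pdivrMr // mul1r; move: intw_ge0; lra.
Qed.

(** The constant [kappa] is below 1, so that a function bounded by it has modular at
    most [kappa * intg w], and is chosen to make this less than [rho1]. *)
Lemma modular_large (v : R -> R) : continuous v -> (forall t, 0 <= v t) -> rho1 <= Phi v ->
  exists2 t : R, t \in `[0, 1] & kappa < v t.
Proof.
move=> cv v0 Phiv; apply: contrapT => H0.
have vk (s : R) : s \in `[0, 1] -> 0 <= v s <= kappa.
  by move=> sI; rewrite v0 leNgt; apply/negP => ks; apply: H0; exists s.
have := le_trans Phiv (modular_le w_L1 w_ge0 p_meas pm_gt1 p_bounds (continuous_bm cv) vk).
apply/negP; rewrite -ltNge.
have /andP[pm_p p_pp] := p_bounds I0.
have k1 : 0 < kappa <= 1 by rewrite kappa_gt0 ltW.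
apply: (@le_lt_trans _ _ (kappa * intg w)).
  have pp1 : 1 <= pp by exact: le_trans (ltW pm_gt1) (le_trans pm_p p_pp).
  by apply: ler_wpM2r => //; rewrite ge_max !ge1r_powR // ltW.
have d0 : 0 < intg w + rho1 + 1 by rewrite ltr_wpDl // addr_ge0 // ltW.
rewrite /kappa mulrAC ltr_pdivrMr // ltr_pM2l //.
by move: rho1_gt0; lra.
Qed.

(** The factor between [u m] and [v m] must stay bounded for the family to be
    equicontinuous.  It does because [v m] is not small: either its modular
    reaches [rho1], or the truncation is active at [rho1], where expansion makes
    the exact image large and [v m] is close to it. *)
Lemma approximate_solutions :
  exists (u v : nat -> R -> R) (sigma e : nat -> R),
  [/\ forall m, kernel_cone (u m) /\ kernel_cone (v m),
      forall m t, u m t = sigma m * v m t,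
      forall m, Phi (u m) = clamp rho1 rho2 (Phi (v m)),
      e m @[m --> \oo] --> (0 : R) /\ forall m (t : R), t \in `[0, 1] ->
        `|v m t - image (u m) t| <= e m <= 1 &
      exists2 L : R, 0 < L & forall m (t t' d : R),
        (forall s : R, s \in `[0, 1] -> `|G t s - G t' s| <= d) ->
        `|u m t - u m t'| <= d * L].
Proof.
pose C := abar * H + Gmax.
have abar0 : 0 <= abar := le_trans (ltW (a_gt0 0)) (a_le 0).
have f_max0 : 0 <= H by apply: le_trans (f_ge0 0 0) (f_le I0 _); rewrite in_itv /= lexx ltW.
have Gmax0 : 0 <= Gmax := le_trans (G_ge0 0 0) (G_le I0 I0).
have C0 : 0 <= C by rewrite addr_ge0 ?mulr_ge0.
(* Then the error [eps m * C] is at most [kappa / 2], and an image exceeding [kappa]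
   somewhere leaves [v m] at least [kappa / 2] there. *)
pose q := kappa / 2 / (C + 1).
have C1 : 0 < C + 1 by rewrite ltr_wpDl.
have k20 : 0 < kappa / 2 by exact: divr_gt0.
have k2k : kappa / 2 <= kappa by rewrite ler_pdivrMr // ler_peMr ?ler1n // ltW.
have q0 : 0 < q by exact: divr_gt0.
have qC : q * C <= kappa / 2.
  by rewrite /q mulrAC ler_pdivrMr // ler_pM2l // lerDl.
have k2 : kappa / 2 <= 1 by move: kappa_gt0 kappa_lt1; move: kappa => k; lra.
have q1 : q <= 1.
  by apply: le_trans k2; rewrite /q ler_pdivrMr // ler_peMr ?lerDr // ltW.
pose eps (m : nat) := q / m.+1%:R.
have eps0 m : 0 < eps m by rewrite divr_gt0.
have epsq m : eps m <= q.
  by rewrite ler_pdivrMr ?ltr0n // ler_peMr ?(ltW q0) // ler1n.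
have epsC m : eps m * C <= kappa / 2.
  by apply: le_trans qC; rewrite ler_wpM2r.
have approx m : exists uvs : (R -> R) * (R -> R) * R,
  [/\ kernel_cone uvs.1.1, kernel_cone uvs.1.2, 0 < uvs.2,
    (forall t, uvs.1.1 t = uvs.2 * uvs.1.2 t) &
    Phi uvs.1.1 = clamp rho1 rho2 (Phi uvs.1.2)] /\
  (forall t : R, t \in `[0, 1] -> `|uvs.1.2 t - image uvs.1.1 t| <= eps m * C) /\
  (forall (t t' d : R), (forall s : R, s \in `[0, 1] -> `|G t s - G t' s| <= d) ->
     `|uvs.1.2 t - uvs.1.2 t'| <= d * (abar * H + eps m)).
  have [r r0 Hr] := uniformly_continuous_on_rectangle 0 1 0 1 G_cont (eps0 m).
  have [n [tag [piece [n0 tagI pieceP piece1 close]]]] := tagged_partition r0.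
  have [|||k t s tI sI ps|u [v [sg H0]]] :=
      @approximate_solution n tag piece (eps m) n0 (eps0 m) tagI.
  - by move=> k; case: (pieceP k).
  - by move=> k; case: (pieceP k).
  - exact: piece1.
  - by apply: (Hr t t _ _ tI (subitv01 (tagI k)) _ (close k s ps)); rewrite subrr normr0.
  - by exists (u, v, sg).
have [uvs Huvs] := choice approx.
have vlarge m : exists2 t : R, t \in `[0, 1] & kappa / 2 <= (uvs m).1.2 t.
  have [[uK vK _ _ PhiE] [close _]] := Huvs m.
  have [cv v0 _ _] := vK; have [cu u0 _ _] := uK.
  have [Phiv|Phiv] := leP rho1 (Phi (uvs m).1.2).
    have [t tI kt] := modular_large cv v0 Phiv; exists t => //.
    exact: le_trans k2k (ltW kt).
  have Phiu : Phi (uvs m).1.1 = rho1.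
    rewrite PhiE /clamp min_l; last exact/ltW/(lt_trans Phiv).
    by rewrite max_l // ltW.
  have [t tI kt] := modular_large (image_continuous cu) (@image_ge0 _) (ltW (cone_expand uK Phiu)).
  exists t => //; have := le_trans (close t tI) (epsC m).
  rewrite ler_norml => /andP[+ _]; rewrite lerBrDr; apply: le_trans.
  by rewrite addrC lerBrDr -splitr ltW.
exists (fun m => (uvs m).1.1), (fun m => (uvs m).1.2), (fun m => (uvs m).2).
exists (fun m => eps m * C); split.
- by move=> m; case: (Huvs m) => -[].
- by move=> m; case: (Huvs m) => -[].
- by move=> m; case: (Huvs m) => -[].
- split.
    rewrite -[X in _ --> X](mul0r C); apply: cvgM (cvg_cst C).
    rewrite -[X in _ --> X](mulr0 q); apply: cvgM; [exact: cvg_cst|exact: cvg_harmonic].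
  move=> m t tI; have [_ [close _]] := Huvs m.
  by rewrite close // (le_trans (epsC m)).
- exists (M / (kappa / 2) * (abar * H + 1)).
    by apply: mulr_gt0; [exact: divr_gt0|rewrite ltr_wpDl // mulr_ge0].
  move=> m t t' d Gd; have [[uK vK sg0 uE PhiE] [_ mod]] := Huvs m.
  have [t1 t1I vt1] := vlarge m.
  have d0 : 0 <= d by apply: le_trans (Gd 0 I0).
  have sgM : (uvs m).2 <= M / (kappa / 2).
    rewrite ler_pdivlMr //.
    apply: (@le_trans _ _ ((uvs m).2 * (uvs m).1.2 t1)); first by rewrite ler_pM2l.
    rewrite -uE; apply: cone_bound => //; rewrite PhiE.
    by case/andP: (clamp_bounds (Phi (uvs m).1.2) (ltW rho12)).
  rewrite !uE -mulrBr normrM (gtr0_norm sg0) mulrCA.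
  apply: ler_pM => //; first exact: ltW.
  apply: le_trans (mod _ _ _ Gd) _; rewrite ler_wpM2l // lerD2l.
  exact: le_trans (epsq m) q1.
Qed.

(** Proportionality is written without division, so that it passes to the limit
    without knowing the limit of the factors. *)
Lemma proportional_solution : exists u, [/\ kernel_cone u,
  (forall t : R, t \in `[0, 1] -> u t <= M),
  Phi u = clamp rho1 rho2 (Phi (image u)) &
  forall t t' : R, t \in `[0, 1] -> t' \in `[0, 1] ->
    u t * image u t' = image u t * u t'].
Proof.
have [us [vs [sg [e [UV uE PhiE [e0 close] [L L0 mod]]]]]] := approximate_solutions.
have uK m := (UV m).1; have vK m := (UV m).2.
have us0 m t : 0 <= us m t by case: (uK m).
have vs0 m t : 0 <= vs m t by case: (vK m).
have cus m : continuous (us m) by case: (uK m).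
have usM m (t : R) : t \in `[0, 1] -> us m t <= M.
  apply: cone_bound => //; rewrite PhiE.
  by case/andP: (clamp_bounds (Phi (vs m)) (ltW rho12)).
have usb m (t : R) : t \in `[0, 1] -> 0 <= us m t <= M by move=> tI; rewrite us0 usM.
have [t d tI d0|phi [u [phi_ge cu cvu]]] := ascoli_sequence usb.
  have [r r0 Hr] := uniformly_continuous_on_rectangle t t 0 1 G_cont (divr_gt0 d0 L0).
  exists r => // m t' t'I tt'.
  rewrite -[leRHS](divfK (lt0r_neq0 L0)); apply: mod => s sI; apply: Hr => //.
    by rewrite in_itv /= lexx.
  by rewrite subrr normr0.
have cvI (t : R) : t \in `[0, 1] -> us (phi n) t @[n --> \oo] --> u t.
  by move=> tI; have := cvu t; rewrite clamp_id.
have u0 t : 0 <= u t by apply: (cvgn_le _ (cvg_cst 0) (cvu t)) => m; exact: us0.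
have uM (t : R) : t \in `[0, 1] -> u t <= M.
  by move=> tI; apply: (cvgn_le _ (cvI t tI) (cvg_cst M)) => m; exact: usM.
have cvPhi : Phi (us (phi n)) @[n --> \oo] --> Phi u.
  apply: (cvg_modular w_L1 p_meas pm_gt1 p_bounds (M := M)) => //.
  - by move=> n; exact: continuous_bm.
  - by move=> n s sI; exact: usb.
have cva : a (Phi (us (phi n))) @[n --> \oo] --> a (Phi u).
  by apply: continuous_cvg cvPhi; exact: a_cont.
have cvim (t : R) : t \in `[0, 1] -> image (us (phi n)) t @[n --> \oo] --> image u t.
  move=> tI; apply: cvgM => //.
  apply: (cvg_weighted_intg (M := H)).
  - by apply: continuous_L1T; exact: continuous_right.
  - by move=> n; apply: continuous_bm; exact: continuous_graph.
  - move=> n s sI; rewrite ger0_norm //; apply: f_le => //.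
    by rewrite in_itv /=; exact: usb.
  - by move=> s sI; apply: cvg_right => //; exact: cvI.
have cvv (t : R) : t \in `[0, 1] -> vs (phi n) t @[n --> \oo] --> image u t.
  move=> tI; apply: (cvgn_close _ (cvg_along phi_ge e0) (cvim t tI)) => n.
  by case/andP: (close (phi n) t tI).
have vsM m (t : R) : t \in `[0, 1] -> vs m t <= abar * (Gmax * H) + 1.
  move=> tI; have /andP[c1 c2] := close m t tI.
  have := le_trans c1 c2; rewrite ler_norml => /andP[_].
  have := image_le (cus m) (us0 m) (usM m) tI; lra.
have cvPhiv : Phi (vs (phi n)) @[n --> \oo] --> Phi (image u).
  apply: (cvg_modular w_L1 p_meas pm_gt1 p_bounds (M := abar * (Gmax * H) + 1)) => //.
  - by move=> n; apply: continuous_bm; case: (vK (phi n)).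
  - by move=> n s sI; rewrite vs0 vsM.
have uKu : kernel_cone u.
  split=> // [t t' tI t'I|t' t'I].
    have t01 : t \in `[0, 1].
      by move: tI; rewrite !in_itv /= => /andP[h1 h2]; rewrite (le_trans alpha_ge0) // (le_trans h2).
    apply: (cvgn_le _ (cvgM (cvg_cst eta0) (cvI t' t'I)) (cvI t t01)) => m.
    by case: (uK (phi m)) => _ _ h _; exact: h.
  have cvint : intg (us (phi n)) @[n --> \oo] --> intg u.
    have -> : intg u = intg (fun s => 1 * u s) by apply: eq_intg => s _; rewrite mul1r.
    have -> : (fun n => intg (us (phi n))) = (fun n => intg (fun s => 1 * us (phi n) s)).
      by apply/funext => n; apply: eq_intg => s _; rewrite mul1r.
    apply: (cvg_weighted_intg (L1_cst 1) (M := M)) => [n|n s sI|s sI].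
    - exact: continuous_bm.
    - by rewrite ger0_norm // usM.
    - exact: cvI.
  apply: (cvgn_le _ (cvgM (cvg_cst c0) (cvI t' t'I)) cvint) => m.
  by case: (uK (phi m)) => _ _ _; apply.
have PhiuE : Phi u = clamp rho1 rho2 (Phi (image u)).
  have := @clamp_cvg _ rho1 rho2 _ _ cvPhiv; under eq_fun do rewrite -PhiE.
  exact: cvgn_unique cvPhi.
have cross (t t' : R) : t \in `[0, 1] -> t' \in `[0, 1] -> u t * image u t' = image u t * u t'.
  move=> tI t'I.
  have h1 : us (phi n) t * vs (phi n) t' @[n --> \oo] --> u t * image u t'.
    by apply: cvgM; [exact: cvI|exact: cvv].
  have h2 : vs (phi n) t * us (phi n) t' @[n --> \oo] --> image u t * u t'.
    by apply: cvgM; [exact: cvv|exact: cvI].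
  apply: cvgn_unique h2; rewrite (_ : (fun n => _) = (fun n => us (phi n) t * vs (phi n) t')) //.
  by apply/funext => n; rewrite !uE -mulrA mulrCA.
by exists u.
Qed.

(** The cone form of the compression-expansion principle, for an operator that
    is a positive multiple, depending on the modular, of a Hammerstein one. *)
Theorem hammerstein_fixed_point : exists u, [/\ kernel_cone u, rho1 < Phi u < rho2 &
  forall t : R, t \in `[0, 1] -> u t = a (Phi u) * hammerstein u t].
Proof.
have [u [uK uM PhiuE cross]] := proportional_solution.
have [cu u0 _ _] := uK.
have [y yE] : exists y, y = Phi (image u) by exact: (ex_intro _ _ erefl).
have [x xE] : exists x, x = Phi u by exact: (ex_intro _ _ erefl).
rewrite -xE -yE in PhiuE.
have y_gt : x = rho1 -> rho1 < y by rewrite yE xE; exact: cone_expand.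
have y_lt : x = rho2 -> y < rho2 by rewrite yE xE; exact: cone_compress.
(* The truncation is active at neither end. *)
have [yx y1 y2] : [/\ y = x, rho1 < y & y < rho2].
  have [y1|y1] := leP y rho1.
    have := y_gt; rewrite PhiuE /clamp min_l ?max_l //; last exact: le_trans y1 (ltW rho12).
    by move=> /(_ erefl); rewrite ltNge y1.
  have [y2|y2] := leP rho2 y; last by rewrite PhiuE clamp_id // !ltW.
  have := y_lt; rewrite PhiuE /clamp min_r ?max_r ?(ltW rho12) // => /(_ erefl).
  by rewrite ltNge y2.
have rPhi : rho1 <= Phi u by rewrite -xE -yx ltW.
have rPhi' : rho1 <= Phi (image u) by rewrite -yE ltW.
have [t1 t1I ut1] := modular_large cu u0 rPhi.
have [t2 t2I it2] := modular_large (image_continuous cu) (@image_ge0 u) rPhi'.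
clear rPhi'; have ut1_gt0 := lt_trans kappa_gt0 ut1.
have [s sE] : exists s, s = image u t1 / u t1 by exact: (ex_intro _ _ erefl).
have imE (t : R) : t \in `[0, 1] -> image u t = s * u t.
  move=> tI; apply: (mulIf (lt0r_neq0 ut1_gt0)).
  have := cross t t1 tI t1I; rewrite mulrC => <-.
  by rewrite sE [RHS]mulrAC divfK // lt0r_neq0.
have it2_gt0 : 0 < s * u t2 by rewrite -imE //; exact: lt_trans kappa_gt0 it2.
have s_gt0 : 0 < s.
  by rewrite -(pmulr_lgt0 s (_ : 0 < u t2)) // lt_neqAle u0 andbT;
     apply: contraTN it2_gt0 => /eqP <-; rewrite mulr0 ltxx.
have Phi_gt0 : 0 < Phi u by exact: lt_le_trans rho1_gt0 rPhi.
have ub (t : R) : t \in `[0, 1] -> 0 <= u t <= M by move=> tI; rewrite u0 uM.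
have s1 : s = 1.
  have := modular_scale_eq w_L1 w_ge0 p_meas pm_gt1 p_bounds (continuous_bm cu) ub s_gt0.
  apply; first exact: Phi_gt0.
  by rewrite -xE -yx yE; apply: eq_intg => t tI; rewrite imE.
exists u; split; [exact: uK|by rewrite -xE -yx y1|].
by move=> t tI; rewrite -[RHS]/(image u t) imE // s1 mul1r.
Qed.

End Hammerstein.

(** * Power estimates and a weighted Hölder inequality *)

Section PowerEstimates.
Context {R : realType}.
Implicit Types (x N r e : R).

Lemma one_powR e : 1 `^ e = 1 :> R. Proof. by rewrite powR1. Qed.

Lemma powRK x e : 0 <= x -> e != 0 -> (x `^ e) `^ e^-1 = x.
Proof. by move=> x0 e0; rewrite -powRrM mulfV // powRr1. Qed.

Lemma powRVK x e : 0 <= x -> e != 0 -> (x `^ e^-1) `^ e = x.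
Proof. by move=> x0 e0; rewrite -powRrM mulVf // powRr1. Qed.

Lemma powR_le1 x e : 0 < e -> 0 <= x <= 1 -> x `^ e <= 1.
Proof.
move=> e0 /andP[x0 x1]; rewrite -[leRHS](one_powR e).
by apply: ge0_ler_powR; rewrite ?nnegrE ?(ltW e0).
Qed.

Lemma powR_ge1 x e : 0 <= e -> 1 <= x -> 1 <= x `^ e.
Proof. by move=> e0 x1; rewrite -[leLHS](powRr0 x) ler_powR. Qed.

Lemma powR_le_inv r x e : 0 < e -> 0 <= r -> 0 <= x -> r <= x `^ e -> r `^ e^-1 <= x.
Proof.
move=> e0 r0 x0 rx; rewrite -[leRHS](powRK x0 (lt0r_neq0 e0)).
by apply: ge0_ler_powR rx; rewrite ?nnegrE ?invr_ge0 ?powR_ge0 ?(ltW e0).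
Qed.

(** The inverse of the larger of two powers, written as in the definition of the
    lower radius: below 1 the smaller exponent is the relevant one. *)
Lemma threshold_le r N (pm pp : R) : 0 < pm -> pm <= pp -> 0 < r -> 0 <= N ->
  r <= Num.max (N `^ pm) (N `^ pp) ->
  r `^ pp^-1 + (if 0 < r `^ pp^-1 < 1 then r `^ pm^-1 - r `^ pp^-1 else 0) <= N.
Proof.
move=> pm0 pmpp r0 N0 rN; have pp0 := lt_le_trans pm0 pmpp.
rewrite powR_gt0 //=; have [N1|N1] := leP 1 N.
  have rpp : r `^ pp^-1 <= N.
    apply: powR_le_inv => //; first exact: ltW.
    by apply: le_trans rN _; rewrite ge_max lexx andbT ler_powR.
  case: ltP => r1; last by rewrite addr0.
  rewrite subrKC; apply: le_trans N1; apply: powR_le1; rewrite ?invr_gt0 // ltW //=.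
  rewrite leNgt; apply/negP => r_gt1.
  have : 1 <= r `^ pp^-1 by apply: powR_ge1; [rewrite invr_ge0 ltW|exact: ltW].
  by rewrite leNgt r1.
have Ngt0 : 0 < N.
  rewrite lt_neqAle N0 andbT; apply/eqP => e0; move: rN.
  by rewrite -e0 !powR0 ?gt_eqF // maxxx leNgt r0.
have rpm : r <= N `^ pm.
  by apply: le_trans rN _; rewrite ge_max lexx /= ger_powR // Ngt0 ltW.
have r_lt1 : r < 1.
  apply: le_lt_trans rpm _; rewrite -[ltRHS](one_powR pm).
  by apply: gt0_ltr_powR; rewrite ?nnegrE.
have -> : r `^ pp^-1 < 1.
  rewrite -[ltRHS](one_powR pp^-1).
  by apply: gt0_ltr_powR; rewrite ?nnegrE ?invr_gt0 ?(ltW r0).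
by rewrite subrKC; apply: powR_le_inv => //; exact: ltW.
Qed.

(** A pointwise form of the factor in the expansion condition: if [Y <= 1] its left
    side is at most 0, and otherwise the exponent may be raised from [pm] to [e]. *)
Lemma powR_expand_le (Y eta : R) (pm pp e : R) : 1 < pm -> pm <= e <= pp ->
  0 <= Y -> 0 < eta <= 1 ->
  eta `^ pp * (2 `^ (1 - pp) * Y `^ pm - 1) <= (eta * Y) `^ e.
Proof.
move=> pm1 /andP[pme epp] Y0 /andP[eta0 eta1].
have c1 : 2 `^ (1 - pp) <= 1 :> R.
  rewrite -[leRHS](powRr0 2); apply: ler_powR; first by rewrite ler1n.
  by rewrite subr_le0 (le_trans (ltW pm1)) // (le_trans pme).
have zY : 2 `^ (1 - pp) * Y `^ pm - 1 <= Y `^ e.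
  have [Y1|Y1] := leP 1 Y.
    rewrite lerBlDr; apply: le_trans (_ : Y `^ e <= _); last by rewrite lerDl.
    apply: (@le_trans _ _ (Y `^ pm)); last exact: ler_powR.
    by rewrite ler_piMl ?powR_ge0.
  apply: le_trans (powR_ge0 _ _); rewrite subr_le0 mulr_ile1 ?powR_ge0 //.
  by apply: powR_le1; rewrite ?Y0 ?(ltW Y1) // (lt_trans ltr01).
rewrite powRM // ?(ltW eta0) //.
have [z0|z0] := leP 0 (2 `^ (1 - pp) * Y `^ pm - 1).
  by apply: ler_pM; rewrite ?powR_ge0 // ger_powR // eta0.
apply: (@le_trans _ _ 0); last by rewrite mulr_ge0 ?powR_ge0.
by rewrite mulr_ge0_le0 ?powR_ge0 // ltW.
Qed.

End PowerEstimates.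

Section WeightedHoelder.
Context {R : realType}.
Local Notation mu := (@lebesgue_measure R).
Local Notation I01 := (`[0%R, 1%R]%classic : set R).

Lemma ae_le_intg (g h : R -> R) : L1 g -> L1 h ->
  (forall s : R, s \in `[0, 1] -> 0 <= g s) -> (forall s : R, s \in `[0, 1] -> 0 <= h s) ->
  {ae mu, forall s : R, s \in `[0, 1] -> g s <= h s} -> intg g <= intg h.
Proof.
move=> ig ih g0 h0 gh; apply: fine_le; [exact: integrable_fin_num..|].
apply: ae_ge0_le_integral => //.
- exact: measurable_int ig.
- exact: measurable_int ih.
Qed.

Variables (w : R -> R) (q : R).
Hypothesis q_gt1 : 1 < q.
Hypothesis w_L1 : L1 w.
Hypothesis w_ge0 : forall s : R, s \in `[0, 1] -> 0 <= w s.
Hypothesis w_gt0 : {ae mu, forall s : R, s \in `[0, 1] -> 0 < w s}.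
Hypothesis wq_L1 : L1 (fun s => w s `^ (1 - q)^-1).

Let q' := q / (q - 1).
Let q_gt0 : 0 < q. Proof. exact: lt_trans ltr01 q_gt1. Qed.
Let q1_gt0 : 0 < q - 1. Proof. by rewrite subr_gt0. Qed.
Let q'_gt0 : 0 < q'. Proof. exact: divr_gt0. Qed.
Let qq' : q^-1 + q'^-1 = 1.
Proof. by rewrite /q' invf_div mulrBl mul1r mulfV ?gt_eqF // addrC subrK. Qed.

(** Young's inequality with a free scale, integrated; the scale is optimised in
    [weighted_hoelder]. *)
Lemma young_integrated (g : R -> R) (k : R) : 0 < k ->
  L1 g -> L1 (fun s => w s * g s `^ q) -> (forall s : R, s \in `[0, 1] -> 0 <= g s) ->
  intg g <= k `^ q / q * intg (fun s => w s * g s `^ q) +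
            k `^ (- q') / q' * intg (fun s => w s `^ (1 - q)^-1).
Proof.
move=> k0 ig iwg g0; rewrite -!intgZ // -intgD //; [|exact: L1Z..].
have c1 : 0 <= k `^ q / q by rewrite divr_ge0 ?powR_ge0 // ltW.
have c2 : 0 <= k `^ (- q') / q' by rewrite divr_ge0 ?powR_ge0 // ltW.
apply: ae_le_intg => //.
- by apply: L1D; exact: L1Z.
- by move=> s sI; rewrite addr_ge0 // mulr_ge0 ?powR_ge0 // mulr_ge0 ?powR_ge0 ?w_ge0.
apply: (@filterS _ _ (ae_filter_ringOfSetsType mu) _ _ _ w_gt0) => s + sI => /(_ sI) ws.
pose x := k * (w s `^ q^-1 * g s); pose y := k^-1 * w s `^ (- q^-1).
have x0 : 0 <= x by rewrite mulr_ge0 ?(ltW k0) // mulr_ge0 ?powR_ge0 ?g0.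
have y0 : 0 <= y by rewrite mulr_ge0 ?powR_ge0 // invr_ge0 ltW.
have xy : g s = x * y.
  have wn : w s `^ q^-1 != 0 by rewrite lt0r_neq0 // powR_gt0.
  by rewrite /x /y powRN mulrACA divff ?lt0r_neq0 // mul1r mulrAC divff // mul1r.
rewrite [leLHS]xy; apply: le_trans (conjugate_powR x0 y0 q_gt0 q'_gt0 qq') _.
rewrite /x /y !powRM ?powR_ge0 ?mulr_ge0 ?powR_ge0 ?g0 ?invr_ge0 ?(ltW k0) //.
rewrite powRVK ?(ltW ws) ?gt_eqF // -[k^-1]powR_inv1 ?(ltW k0) // -!powRrM.
have -> : - q^-1 * q' = (1 - q)^-1.
  by rewrite /q' mulNr mulrA mulVf ?gt_eqF // mul1r -invrN opprB.
by rewrite mulN1r mulrAC [X in _ + X <= _]mulrAC.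
Qed.

(** If the dual weight had integral 0, Young's inequality for the constant 1 would
    bound 1 by arbitrarily small multiples of the integral of [w]. *)
Lemma dual_weight_gt0 : 0 < intg (fun s => w s `^ (1 - q)^-1).
Proof.
set D := intg _; have D0 : 0 <= D by apply: intg_ge0 => s _; exact: powR_ge0.
rewrite lt_neqAle D0 andbT; apply/eqP => De.
have W0 : 0 <= intg w by exact: intg_ge0.
have W1 : 0 < intg w + 1 by rewrite ltr_wpDl.
(* The scale for which the bound is [intg w / (intg w + 1) / q]. *)
pose k := ((intg w + 1)^-1) `^ q^-1.
have k0 : 0 < k by rewrite powR_gt0 // invr_gt0.
have iw1 : L1 (fun s => w s * 1 `^ q) by under eq_fun do rewrite one_powR mulr1.
have := @young_integrated (fun=> 1) k k0 (L1_cst 1) iw1 (fun _ _ => ler01).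
rewrite -/D -De mulr0 addr0 intg_cst /k powRVK ?invr_ge0 ?(ltW W1) ?gt_eqF //.
have -> : intg (fun s => w s * 1 `^ q) = intg w by apply: eq_intg => s _; rewrite one_powR mulr1.
apply/negP; rewrite -ltNge mulrAC ltr_pdivrMr // mul1r mulrC ltr_pdivrMr //.
apply: lt_le_trans (_ : intg w + 1 <= _); first by rewrite ltrDl.
by rewrite ler_peMl ?ltW.
Qed.

(** The scale in [young_integrated] is chosen to make both terms proportional to
    the right-hand side, with factors [q^-1] and [q'^-1]. *)
Lemma weighted_hoelder (g : R -> R) (r : R) : 0 < r ->
  L1 g -> L1 (fun s => w s * g s `^ q) -> (forall s : R, s \in `[0, 1] -> 0 <= g s) ->
  intg (fun s => w s * g s `^ q) <= r ->
  intg g <= r `^ q^-1 * intg (fun s => w s `^ (1 - q)^-1) `^ ((q - 1) / q).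
Proof.
move=> r0 ig iwg g0 gr; have := dual_weight_gt0.
set D := intg (fun s => w s `^ _) => D0.
pose k := (D / r) `^ (q^-1 / q').
have Dr : 0 < D / r by rewrite divr_gt0.
have k0 : 0 < k by rewrite powR_gt0.
apply: le_trans (young_integrated k0 ig iwg g0) _; rewrite -/D.
have kq : k `^ q * r = r `^ q^-1 * D `^ ((q - 1) / q).
  have -> : k `^ q = (D / r) `^ ((q - 1) / q).
    rewrite /k -powRrM; congr (_ `^ _); rewrite mulrAC mulVf ?gt_eqF // mul1r.
    by rewrite /q' invf_div.
  rewrite powRM ?(ltW D0) ?invr_ge0 ?(ltW r0) // -mulrA mulrC; congr (_ * _).
  rewrite -[r^-1]powR_inv1 ?(ltW r0) // -powRrM -[X in _ * X = _](powRr1 (ltW r0)).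
  rewrite -powRD; last by rewrite (gt_eqF r0) implybT.
  by congr (_ `^ _); rewrite mulrBl divff ?gt_eqF //; ring.
have kq' : k `^ (- q') * D = r `^ q^-1 * D `^ ((q - 1) / q).
  have -> : k `^ (- q') = (r / D) `^ q^-1.
    rewrite /k -powRrM mulrN divfK ?gt_eqF // powRN.
    by rewrite -powR_inv1 ?powR_ge0 // powRAC powR_inv1 ?(ltW Dr) // invf_div.
  rewrite powRM ?(ltW r0) ?invr_ge0 ?(ltW D0) // -mulrA; congr (_ * _).
  rewrite -[D^-1]powR_inv1 ?(ltW D0) // -powRrM -[X in _ * X = _](powRr1 (ltW D0)).
  rewrite -powRD; last by rewrite (gt_eqF D0) implybT.
  by congr (_ `^ _); rewrite mulrBl divff ?gt_eqF //; ring.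
apply: (@le_trans _ _ (k `^ q / q * r + k `^ (- q') / q' * D)).
  by rewrite lerD2r ler_wpM2l // divr_ge0 ?powR_ge0 // ltW.
by rewrite mulrAC kq [X in _ + X]mulrAC kq' -mulrDr qq' mulr1.
Qed.

End WeightedHoelder.

(** * The modular against the norm in the cone *)

Section ModularBounds.
Context {R : realType}.
Local Notation mu := (@lebesgue_measure R).
Local Notation I01 := (`[0%R, 1%R]%classic : set R).
Variables (w p : R -> R) (pm pp : R).
Hypothesis w_L1 : L1 w.
Hypothesis w_ge0 : forall s : R, s \in `[0, 1] -> 0 <= w s.
Hypothesis p_meas : measurable_fun I01 p.
Hypothesis pm_gt1 : 1 < pm.
Hypothesis p_bounds : forall s : R, s \in `[0, 1] -> pm <= p s <= pp.
Local Notation Phi := (modular w p).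

Lemma exponents_le : pm <= pp.
Proof.
have I0 : (0 : R) \in `[0, 1] by rewrite in_itv /= lexx ler01.
by have /andP[] := p_bounds I0; exact: le_trans.
Qed.

(** A function bounded by [N] has modular at most
    [max (N `^ pm, N `^ pp) * intg w]; solving for [N] gives the lower radius. *)
Lemma modular_lower (u : R -> R) (N r : R) : measurable_fun I01 u ->
  (forall s : R, s \in `[0, 1] -> 0 <= u s <= N) -> 0 < r -> 0 < intg w ->
  r <= Phi u ->
  (r / intg w) `^ pp^-1 + (if 0 < (r / intg w) `^ pp^-1 < 1
     then (r / intg w) `^ pm^-1 - (r / intg w) `^ pp^-1 else 0) <= N.
Proof.
move=> mu_ uN r0 W0 rPhi; have I0 : (0 : R) \in `[0, 1] by rewrite in_itv /= lexx ler01.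
apply: threshold_le.
- exact: lt_trans pm_gt1.
- exact: exponents_le.
- exact: divr_gt0.
- by have /andP[] := uN _ I0; exact: le_trans.
- rewrite ler_pdivrMr //; apply: le_trans rPhi _.
  exact: (modular_le w_L1 w_ge0 p_meas pm_gt1 p_bounds mu_ uN).
Qed.

Variable q : R.
Hypotheses (q_gt1 : 1 < q) (q_lt : q < pm).
Hypothesis w_gt0 : {ae mu, forall s : R, s \in `[0, 1] -> 0 < w s}.
Hypothesis wq_L1 : L1 (fun s => w s `^ (1 - q)^-1).

(** Hölder's inequality against the dual weight bounds the integral of
    [u `^ (p / q)]; up to an additive 1 this controls the constant power [pm / q],
    and Jensen's inequality gives back the integral of [u]. *)
Lemma modular_upper (u : R -> R) (N r : R) : measurable_fun I01 u ->
  (forall s : R, s \in `[0, 1] -> 0 <= u s <= N) -> 0 < r -> Phi u <= r ->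
  intg u <= (r `^ q^-1 * intg (fun s => w s `^ (1 - q)^-1) `^ ((q - 1) / q) + 1) `^ (q / pm).
Proof.
move=> mu_ uN r0 Phir; have q0 : 0 < q by exact: lt_trans q_gt1.
have u0 (s : R) : s \in `[0, 1] -> 0 <= u s by move=> /uN /andP[].
have mpow (e : R -> R) : measurable_fun I01 e -> measurable_fun I01 (fun s => u s `^ e s).
  by move=> me; exact: measurable_pow.
have pq_meas : measurable_fun I01 (fun s => p s / q).
  by apply: measurable_funM => //; exact: measurable_cst.
have pq_bounds (s : R) : s \in `[0, 1] -> pm / q <= p s / q <= pp / q.
  by move=> /p_bounds /andP[h1 h2]; rewrite !ler_pM2r ?invr_gt0 // h1.
have pmq0 : 1 < pm / q by rewrite ltr_pdivlMr // mul1r.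
have g_L1 : L1 (fun s => u s `^ (p s / q)).
  exact: (L1_bounded (mpow _ pq_meas) (pow_bound pmq0 pq_bounds uN)).
have gq s : (u s `^ (p s / q)) `^ q = u s `^ p s.
  by rewrite -powRrM divfK // gt_eqF.
have hoelder1 : intg (fun s => u s `^ (p s / q)) <=
    r `^ q^-1 * intg (fun s => w s `^ (1 - q)^-1) `^ ((q - 1) / q).
  apply: (weighted_hoelder q_gt1 w_L1 w_ge0 w_gt0 wq_L1 r0 g_L1).
  - under eq_fun do rewrite gq.
    exact: (modular_L1 w_L1 p_meas pm_gt1 p_bounds mu_ uN).
  - by move=> s _; exact: powR_ge0.
  - by under eq_fun do rewrite gq.
set J := _ * _ in hoelder1 *.
have J0 : 0 <= J by rewrite mulr_ge0 ?powR_ge0.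
have u_L1 : L1 u.
  by apply: (L1_bounded mu_ (M := N)) => s sI; have /andP[h1 h2] := uN s sI; rewrite ger0_norm.
have upm_L1 : L1 (fun s => 1 * u s `^ (pm / q)).
  apply: (@modular_L1 R (fun=> 1) (fun=> pm / q) (pm / q) (pm / q) _ _ pmq0 _ u N) => //.
  - exact: L1_cst.
  - by move=> s _; rewrite lexx.
have one_weight : intg (fun s => 1 `^ (1 - pm / q)^-1) = 1 :> R.
  by under eq_intg do rewrite one_powR; rewrite intg_cst.
have ones_L1 : L1 (fun s : R => (1 : R) `^ (1 - pm / q)^-1) by exact: L1_cst.
have := weighted_hoelder pmq0 (L1_cst 1) (fun _ _ => ler01) _ ones_L1
  (ltr_wpDl J0 ltr01) u_L1 upm_L1 u0.
rewrite one_weight one_powR mulr1 invf_div; apply.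
  by apply: aeW => s _; exact: ltr01.
apply: (@le_trans _ _ (intg (fun s => u s `^ (p s / q) + 1))).
  apply: le_intg => //; first by apply: L1D => //; exact: L1_cst.
  move=> s sI; rewrite mul1r; have [u1|u1] := leP (u s) 1.
    apply: (@le_trans _ _ 1); last by rewrite lerDr powR_ge0.
    by apply: powR_le1; rewrite ?u0 // (lt_trans ltr01).
  apply: (@le_trans _ _ (u s `^ (p s / q))); last by rewrite lerDl.
  by apply: ler_powR; [exact: ltW|case/andP: (pq_bounds s sI)].
by rewrite intgD ?intg_cst ?lerD2r //; exact: L1_cst.
Qed.

End ModularBounds.

Section ConeEstimates.
Context {R : realType}.
Local Notation mu := (@lebesgue_measure R).
Local Notation I01 := (`[0%R, 1%R]%classic : set R).
Variables (f G : R -> R -> R) (w p : R -> R).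
Variables (pm pp alpha beta eta0 c0 k : R).
Hypothesis f_cont : continuous (fun z : R * R => f z.1 z.2).
Hypothesis f_ge0 : forall s x, 0 <= f s x.
Hypothesis G_cont : continuous (fun z : R * R => G z.1 z.2).
Hypothesis G_ge0 : forall t s, 0 <= G t s.
Hypothesis w_L1 : L1 w.
Hypothesis w_ge0 : forall s : R, s \in `[0, 1] -> 0 <= w s.
Hypothesis p_meas : measurable_fun I01 p.
Hypothesis pm_gt1 : 1 < pm.
Hypothesis p_bounds : forall s : R, s \in `[0, 1] -> pm <= p s <= pp.
Hypotheses (k_gt0 : 0 < k) (eta0_gt0 : 0 < eta0) (eta0_le1 : eta0 <= 1).
Hypotheses (alpha_ge0 : 0 <= alpha) (beta_le1 : beta <= 1).
Hypothesis G_harnack : forall t t' s : R, t \in `[alpha, beta] -> t' \in `[0, 1] ->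
  s \in `[0, 1] -> eta0 * G t' s <= G t s.
Local Notation Phi := (modular w p).

Lemma subitv_ab (s : R) : s \in `[alpha, beta] -> s \in `[0, 1].
Proof.
by rewrite !in_itv /= => /andP[h1 h2]; rewrite (le_trans alpha_ge0) // (le_trans h2).
Qed.

Lemma L1_sub (g : R -> R) : L1 g -> mu.-integrable `[alpha, beta] (EFin \o g).
Proof.
move=> ig; refine (integrableS _ _ _ ig); [exact: measurable_itv..|].
by move=> s; exact: subitv_ab.
Qed.

Lemma le_intg_sub (g h : R -> R) : L1 g -> L1 h ->
  (forall s : R, s \in `[0, 1] -> 0 <= h s) ->
  (forall s : R, s \in `[alpha, beta] -> g s <= h s) ->
  \int[mu]_(s in `[alpha, beta]) g s <= intg h.
Proof.
have sub : `[alpha, beta]%classic `<=` I01 by move=> s; exact: subitv_ab.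
have mab : measurable (`[alpha, beta]%classic : set R) by exact: measurable_itv.
move=> ig ih h0 gh.
apply: (@le_trans _ _ (\int[mu]_(s in `[alpha, beta]) h s)).
  by apply: le_Rintegral => //; exact: L1_sub.
apply: fine_le.
- by apply: integrable_fin_num => //; exact: L1_sub.
- exact: integrable_fin_num.
- apply: ge0_subset_integral => //; first exact: measurable_int ih.
Qed.

Section Image.
Variable u : R -> R.
Hypotheses (u_cont : continuous u) (u_ge0 : forall t, 0 <= u t).
Let Tu t := k * hammerstein f G u t.

Let kernel_L1 t : L1 (fun s => G t s * f s (u s)).
Proof.
apply: continuous_L1T => s; apply: cvgM; first exact: continuous_right.
exact: continuous_graph.
Qed.

Let Tu_cont : continuous Tu.
Proof.
by move=> t; apply: cvgM; [exact: cvg_cst|exact: hammerstein_continuous].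
Qed.

Let Tu_ge0 t : 0 <= Tu t.
Proof. by rewrite mulr_ge0 ?(ltW k_gt0) //; exact: hammerstein_ge0. Qed.

Let Tu_bounded : exists N, forall s : R, s \in `[0, 1] -> 0 <= Tu s <= N.
Proof.
have [N HN] := continuous_bounded_I01 (continuous_subspaceT Tu_cont).
by exists N => s /HN; rewrite Tu_ge0 ger0_norm.
Qed.

Lemma hammerstein_harnack (t t' : R) : t \in `[alpha, beta] -> t' \in `[0, 1] ->
  eta0 * Tu t' <= Tu t.
Proof.
move=> tI t'I; rewrite mulrCA ler_wpM2l ?(ltW k_gt0) // -intgZ //.
apply: le_intg => //; first exact: L1Z.
by move=> s sI; rewrite mulrA ler_wpM2r // G_harnack.
Qed.

(** On [[alpha, beta]] the Harnack inequality bounds [Tu / eta0] from below by all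
    values of [Tu], hence by [k * fm] times the maximum in the hypothesis; the modular
    is bounded from below by its part over this interval. *)
Lemma hammerstein_expands (fm r : R) : 0 <= fm -> 0 < r ->
  (forall s : R, s \in `[alpha, beta] -> fm <= f s (u s)) ->
  (2 `^ (1 - pp) * (k * fm * max_on `[0, 1] (fun t : R =>
       \int[mu]_(s in `[alpha, beta]) G t s)) `^ pm - 1) *
    (\int[mu]_(s in `[alpha, beta]) w s) > r / eta0 `^ pp ->
  r < Phi Tu.
Proof.
move=> fm0 r0 f_ge; set Y := k * fm * _ => ineq.
have kf0 : 0 <= k * fm by rewrite mulr_ge0 // ltW.
have Nn_le (t' t : R) : t' \in `[0, 1] -> t \in `[alpha, beta] ->
    k * fm * (\int[mu]_(s in `[alpha, beta]) G t' s) <= Tu t / eta0.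
  move=> t'I tI; rewrite ler_pdivlMr // mulrC.
  apply: le_trans (hammerstein_harnack tI t'I); rewrite ler_pM2l // -mulrA ler_pM2l //.
  have iG : L1 (G t') by apply: continuous_L1T; exact: continuous_right.
  rewrite -RintegralZl //; last exact: L1_sub.
  apply: le_intg_sub => //; first exact: L1Z.
    by move=> s _; rewrite mulr_ge0.
  by move=> s sI; rewrite mulrC ler_wpM2l // f_ge.
have Y_le (t : R) : t \in `[alpha, beta] -> Y <= Tu t / eta0.
  move=> tI; have [kf|kf] := eqVneq (k * fm) 0.
    by rewrite /Y kf mul0r divr_ge0 // ltW.
  have kf1 : 0 < k * fm by rewrite lt_neqAle eq_sym kf.
  rewrite /Y mulrC -ler_pdivlMr //; apply: ge_sup.
    by exists (\int[mu]_(s in `[alpha, beta]) G 0 s), 0 => //=; rewrite in_itv /= lexx ler01.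
  by move=> _ [t' t'I <-]; rewrite ler_pdivlMr // mulrC Nn_le.
have Y0 : 0 <= Y.
  rewrite mulr_ge0 // /max_on; set S := (X in sup X).
  have [hS|/sup_out ->//] := pselect (has_sup S); have [[x Sx] uS] := hS.
  apply: le_trans (ub_le_sup uS Sx); case: Sx => t _ <-.
  by apply: Rintegral_ge0.
have e0 : 0 < eta0 `^ pp by rewrite powR_gt0.
have [N' HN'] := Tu_bounded.
have powL1 := modular_L1 w_L1 p_meas pm_gt1 p_bounds (continuous_bm Tu_cont) HN'.
move: ineq; rewrite ltr_pdivrMr // => /lt_le_trans; apply.
rewrite mulrC mulrA.
rewrite -RintegralZl //; last exact: L1_sub.
apply: le_intg_sub => //; first exact: L1Z.
  by move=> s sI; rewrite mulr_ge0 ?w_ge0 ?powR_ge0.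
move=> s sI /=; rewrite [leLHS]mulrC ler_wpM2l ?w_ge0 ?subitv_ab //.
have pb := p_bounds (subitv_ab sI).
apply: le_trans (powR_expand_le pm_gt1 pb Y0 _) _; first by rewrite eta0_gt0.
apply: ge0_ler_powR.
- by case/andP: pb => + _; apply: le_trans; rewrite ltW // (lt_trans ltr01).
- by rewrite nnegrE mulr_ge0 // ltW.
- by rewrite nnegrE.
- by rewrite mulrC -ler_pdivlMr // Y_le.
Qed.

Lemma hammerstein_compresses (fM GM r : R) :
  (forall s : R, s \in `[0, 1] -> f s (u s) <= fM) ->
  (forall t : R, t \in `[0, 1] -> \int[mu]_(s in `[0, 1]) G t s <= GM) ->
  Num.max ((k * fM * GM) `^ pm) ((k * fM * GM) `^ pp) * intg w < r ->
  Phi Tu < r.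
Proof.
move=> f_le G_le; apply: le_lt_trans.
apply: (modular_le w_L1 w_ge0 p_meas pm_gt1 p_bounds (continuous_bm Tu_cont)).
move=> t tI; rewrite Tu_ge0 /= -mulrA ler_pM2l //.
have I0 : (0 : R) \in `[0, 1] by rewrite in_itv /= lexx ler01.
have fM0 : 0 <= fM by exact: le_trans (f_le _ I0).
have iG : L1 (G t) by apply: continuous_L1T; exact: continuous_right.
apply: (@le_trans _ _ (fM * intg (G t))); last by rewrite ler_wpM2l // G_le.
rewrite -intgZ //; apply: le_intg => //; first exact: L1Z.
by move=> s sI; rewrite mulrC ler_wpM2r // f_le.
Qed.

End Image.

End ConeEstimates.

(** * Reflection of the convolution weight *)

Section Reflection.
Context {R : realType}.
Local Notation mu := (@lebesgue_measure R).
Local Notation I01 := (`[0%R, 1%R]%classic : set R).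
Let reflect (s : R) : measurableTypeR R := 1 - s.

Let measurable_reflect : measurable_fun [set: measurableTypeR R] reflect.
Proof. by apply: measurable_funB => //; exact: measurable_cst. Qed.

Lemma lebesgue_measure_reflect (A : set R) : measurable A ->
  pushforward mu reflect A = mu A.
Proof.
move=> mA; apply/esym/lebesgue_measure_unique => //= _ [[a b]] _ <-.
rewrite /pushforward (_ : reflect @^-1` _ = `[1 - b, 1 - a[%classic); last first.
  by apply/seteqP; split => s; rewrite /reflect /= !in_itv /= => /andP[h1 h2];
     apply/andP; split; lra.
rewrite /= !lebesgue_measure_itv /= !lte_fin ltrD2l ltrN2; case: ifP => // _.
by rewrite -!EFinB; congr (_%:E); ring.
Qed.

Lemma integrable_reflect (b : R -> R) : mu.-integrable `]0, 1] (EFin \o b) ->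
  mu.-integrable `[0, 1[ (EFin \o (fun s => b (1 - s))).
Proof.
have pre : reflect @^-1` `]0, 1] = `[0, 1[%classic.
  by apply/seteqP; split => s; rewrite /reflect /= !in_itv /= => /andP[h1 h2];
     apply/andP; split; lra.
case/integrableP => mb ib; apply/integrableP; split.
  refine (@measurable_comp _ _ _ (measurableTypeR R) (measurableTypeR R) _
    `]0, 1]%classic (EFin \o b) `[0, 1[%classic reflect _ _ mb _).
  - exact: measurable_itv.
  - by rewrite -pre => _ [s + <-].
  - exact: measurable_funTS.
have -> : (\int[mu]_(x in `[0%R, 1%R[) `|(b (1 - x)%R)%:E| =
    \int[pushforward mu reflect]_(y in `]0%R, 1%R]) `|(EFin \o b) y|)%E.
  rewrite ge0_integral_pushforward //; first by rewrite pre.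
  exact: measurableT_comp.
rewrite (eq_measure_integral mu) // => A mA _; exact: lebesgue_measure_reflect.
Qed.

Lemma ae_reflect (P : R -> Prop) : {ae mu, forall s, P s} -> {ae mu, forall s, P (1 - s)}.
Proof.
case=> N [mN N0 sub]; exists (reflect @^-1` N); split.
- by have := measurable_reflect measurableT mN; rewrite setTI.
- by rewrite -N0; exact: (lebesgue_measure_reflect mN).
- by move=> s /= Ps; apply: sub.
Qed.

Lemma integrable_endpoint (g : R -> R) : mu.-integrable `[0, 1[ (EFin \o g) -> L1 g.
Proof.
case/integrableP => mg ig.
have mg1 : measurable_fun I01 (EFin \o g).
  have -> : I01 = `[0, 1[%classic `|` [set 1] by rewrite setUitv1 // bnd_simp.
  by apply/measurable_funU => //; split => //; exact: measurable_fun_set1.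
apply/integrableP; split => //.
rewrite -integral_itv_bndo_bndc //; exact: measurableT_comp.
Qed.

Lemma eq_Rintegral_endpoint (a c : R) (g h : R -> R) :
  (forall s : R, s \in `[a, c[ -> g s = h s) -> mu.-integrable `[a, c] (EFin \o h) ->
  \int[mu]_(s in `[a, c]) g s = \int[mu]_(s in `[a, c]) h s.
Proof.
move=> gh ih; have ih' : mu.-integrable `[a, c[ (EFin \o h).
  refine (integrableS _ _ _ ih); [exact: measurable_itv..|].
  by move=> s /=; rewrite !in_itv /= => /andP[-> /ltW].
rewrite -!Rintegral_itv_bndo_bndc //.
  by apply: eq_Rintegral => s; rewrite inE; exact: gh.
apply: eq_integrable ih' => //.
by move=> s; rewrite inE /= => sI; rewrite gh.
Qed.

(** The value 1 at the end point, where [b 0] is not constrained, makes the weight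
    nonnegative everywhere on [0,1]. *)
Definition reflected_weight (b : R -> R) (s : R) := if s < 1 then b (1 - s) else 1.

End Reflection.

Section ReflectedWeight.
Context {R : realType}.
Local Notation mu := (@lebesgue_measure R).
Local Notation I01 := (`[0%R, 1%R]%classic : set R).
Variable b : R -> R.
Hypothesis b_int : mu.-integrable `]0, 1] (EFin \o b).
Hypothesis b_ge0 : forall t : R, t \in `]0, 1] -> 0 <= b t.
Local Notation w := (reflected_weight b).

Lemma reflected_weightE (s : R) : s \in `[0, 1[ -> b (1 - s) = w s.
Proof. by rewrite in_itv /= /reflected_weight => /andP[_ ->]. Qed.

Lemma reflected_weight_L1 : L1 w.
Proof.
apply: integrable_endpoint; apply: eq_integrable (integrable_reflect b_int) => //.
by move=> s; rewrite inE /= => sI; rewrite reflected_weightE.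
Qed.

Lemma reflected_weight_ge0 (s : R) : s \in `[0, 1] -> 0 <= w s.
Proof.
rewrite in_itv /= /reflected_weight => /andP[s0 _]; case: ltP => // s1.
by apply: b_ge0; rewrite in_itv /= subr_gt0 s1 gerBl.
Qed.

Lemma reflected_weight_gt0 : {ae mu, forall t : R, t \in `]0, 1] -> 0 < b t} ->
  {ae mu, forall s : R, s \in `[0, 1] -> 0 < w s}.
Proof.
move=> /ae_reflect; apply: (@filterS _ _ (ae_filter_ringOfSetsType mu)) => s bs.
rewrite in_itv /= /reflected_weight => /andP[s0 _].
have [s1|//] := ltP (s : R) 1.
by apply: bs; rewrite in_itv /= subr_gt0 s1 gerBl.
Qed.

Lemma reflected_weight_pow_L1 (e : R) :
  mu.-integrable `]0, 1] (EFin \o (fun t => b t `^ e)) -> L1 (fun s => w s `^ e).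
Proof.
move=> /integrable_reflect be; apply: integrable_endpoint; apply: eq_integrable be => //.
by move=> s; rewrite inE /= => sI; rewrite reflected_weightE.
Qed.

Lemma nonlocal_modular (p u : R -> R) : L1 (fun s => w s * u s `^ p s) ->
  nonlocal b p u = modular w p u.
Proof.
by move=> iw; apply: eq_Rintegral_endpoint iw => s sI; rewrite reflected_weightE.
Qed.

Lemma fconv_weight1 : fconv b (cst 1) 1 = intg w.
Proof.
apply: eq_Rintegral_endpoint reflected_weight_L1 => s sI.
by rewrite /= mulr1 reflected_weightE.
Qed.

Lemma fconv_weight_pow1 (e : R) :
  mu.-integrable `]0, 1] (EFin \o (fun t => b t `^ e)) ->
  fconv (fun t => b t `^ e) (cst 1) 1 = intg (fun s => w s `^ e).
Proof.
move=> be; apply: eq_Rintegral_endpoint (reflected_weight_pow_L1 be) => s sI.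
by rewrite /= mulr1 reflected_weightE.
Qed.

Lemma Rintegral_weight (alpha beta : R) : 0 <= alpha -> beta <= 1 ->
  \int[mu]_(t in `[alpha, beta]) b (1 - t) = \int[mu]_(t in `[alpha, beta]) w t.
Proof.
move=> a0 b1; apply: eq_Rintegral_endpoint.
  move=> s; rewrite in_itv /= => /andP[h1 h2]; apply: reflected_weightE.
  by rewrite in_itv /= (le_trans a0) // (lt_le_trans h2).
exact: (L1_sub a0 b1 reflected_weight_L1).
Qed.

End ReflectedWeight.

(** * Sections of the Green function *)

Section GreenFunction.
Context {R : realType}.

Lemma derivative_constant (g : R -> R) (a c : R) :
  (forall t, t \in `]a, c[ -> derivable g t 1 /\ g^`()%classic t = 0) ->
  forall x y, x \in `]a, c[ -> y \in `]a, c[ -> g x = g y.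
Proof.
move=> g0 x y; wlog xy : x y / x <= y.
  move=> H xI yI; have [xy|/ltW yx] := leP x y; first exact: H.
  by apply/esym; exact: H.
move=> xI yI; have sub z : z \in `[x, y] -> z \in `]a, c[.
  move: xI yI; rewrite !in_itv /= => /andP[ax _] /andP[_ yc] /andP[xz zy].
  by rewrite (lt_le_trans ax) // (le_lt_trans zy).
have [||z _ /eqP] := @MVT_segment R g (fun=> 0) x y xy.
- move=> z zI; have zI' : z \in `[x, y] by move: zI; rewrite !in_itv /= => /andP[/ltW -> /ltW].
  have [dz ez] := g0 z (sub z zI').
  by rewrite -ez derive1E; exact: derivableP.
- apply: derivable_within_continuous => z zI.
  by case: (g0 z (sub z zI)).
- by rewrite mul0r subr_eq0 => /eqP.
Qed.

Lemma affine_piece (g : R -> R) (a c : R) : a < c ->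
  (forall t, t \in `]a, c[ -> twice_derivable g t /\ g^`(2)%classic t = 0) ->
  {within `[a, c], continuous g} ->
  exists m, (forall t, t \in `]a, c[ -> g^`()%classic t = m) /\
            (forall t, t \in `[a, c] -> g t = g a + m * (t - a)).
Proof.
move=> ac g2 cg; have midI : (a + c) / 2 \in `]a, c[ by rewrite in_itv /= !midf_lt.
have dg t : t \in `]a, c[ -> derivable g t 1.
  by move=> /g2 [[+ _] _] => /nbhs_singleton.
have cst t : t \in `]a, c[ -> g^`()%classic t = g^`()%classic ((a + c) / 2).
  move=> tI; apply: (@derivative_constant g^`()%classic a c) => // x xI.
  by have [[_ d2] e2] := g2 x xI; split.
exists (g^`()%classic ((a + c) / 2)); split=> // t.
rewrite in_itv /= => /andP[]; rewrite le_eqVlt => /predU1P[<- _|at_ tc].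
  by rewrite subrr mulr0 addr0.
have sub z : z \in `]a, t[ -> z \in `]a, c[.
  by rewrite !in_itv /= => /andP[-> zt]; exact: lt_le_trans tc.
have [||z zI /eqP] := @MVT R g (fun=> g^`()%classic ((a + c) / 2)) a t at_.
- by move=> z /sub zI; rewrite -(cst z zI) derive1E; apply: derivableP; exact: dg.
- apply: continuous_subspaceW cg => z /=; rewrite !in_itv /= => /andP[-> zt].
  exact: le_trans tc.
- by rewrite subr_eq addrC => /eqP.
Qed.

Variables (B : 'M[R]_(2, 4)) (G : R -> R -> R).
Hypothesis G_cont : forall s : R, s \in `[0, 1] -> {within `[0, 1], continuous (G ^~ s)}.
Hypothesis green : is_green_function B G.

(** The slope of [G ^~ s] on [[0, s]], read off from its end values: after [s] the
    slope is smaller by 1. *)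
Definition green_slope (s : R) := G 1 s - G 0 s + (1 - s).

(** On either side of the diagonal a section of the Green function is affine, and
    its slope drops by 1; the outer slopes are the one-sided derivatives that
    enter the boundary data. *)
Lemma green_affine (s : R) : s \in `]0, 1[ ->
  (forall t : R, t \in `[0, 1] -> G t s = G 0 s + green_slope s * t - Num.max 0 (t - s)) /\
  B *m (\col_(i < 4) [:: G 0 s; green_slope s; G 1 s; green_slope s - 1]`_i) = 0.
Proof.
move=> sI; have [_ /(_ s sI) [g2 [l [r [cvl cvr rl]]] [d0 [d1 [h0 h1 Bd]]]]] := green.
have [s0 s1] : 0 < s /\ s < 1 by move: sI; rewrite in_itv /= => /andP[].
have cg := G_cont (_ : s \in `[0, 1]).
have {}cg : {within `[0, 1], continuous (G ^~ s)} by apply: cg; rewrite in_itv /= !ltW.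
have [ml [ml1 ml2]] : exists m, (forall t, t \in `]0, s[ -> (G ^~ s)^`()%classic t = m) /\
    (forall t, t \in `[0, s] -> G t s = G 0 s + m * (t - 0)).
  apply: (@affine_piece (G ^~ s)) => //.
    move=> t; rewrite in_itv /= => /andP[t0 ts]; apply: g2; last by rewrite lt_eqF.
    by rewrite in_itv /= t0 (lt_trans ts).
  apply: continuous_subspaceW cg => z /=; rewrite !in_itv /= => /andP[-> zs].
  by rewrite (le_trans zs) // ltW.
have [mr [mr1 mr2]] : exists m, (forall t, t \in `]s, 1[ -> (G ^~ s)^`()%classic t = m) /\
    (forall t, t \in `[s, 1] -> G t s = G s s + m * (t - s)).
  apply: (@affine_piece (G ^~ s)) => //.
    move=> t; rewrite in_itv /= => /andP[ts t1]; apply: g2; last by rewrite gt_eqF.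
    by rewrite in_itv /= t1 (lt_trans s0).
  apply: continuous_subspaceW cg => z /=; rewrite !in_itv /= => /andP[sz ->].
  by rewrite (le_trans (ltW s0)).
have lE : l = ml.
  apply: (cvg_unique _ cvl) => //; apply: cvg_near_cst; near=> t.
  by apply: ml1; rewrite in_itv /=; apply/andP; split; near: t;
    [exact: nbhs_left_gt|exact: nbhs_left_lt].
have rE : r = mr.
  apply: (cvg_unique _ cvr) => //; apply: cvg_near_cst; near=> t.
  by apply: mr1; rewrite in_itv /=; apply/andP; split; near: t;
    [exact: nbhs_right_gt|exact: nbhs_right_lt].
have d0E : d0 = ml.
  apply: (cvg_unique _ h0) => //; apply: cvg_near_cst; near=> h.
  have hgt : 0 < h by near: h; exact: nbhs_right_gt.
  have hs : h < s by near: h; exact: nbhs_right_lt.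
  rewrite add0r ml2; last by rewrite in_itv /= !ltW.
  by rewrite subr0 addrAC subrr add0r mulrCA mulVf ?mulr1 // gt_eqF.
have d1E : d1 = mr.
  apply: (cvg_unique _ h1) => //; apply: cvg_near_cst; near=> h.
  have hlt : h < 0 by near: h; exact: nbhs_left_lt.
  have hs : s - 1 < h by near: h; apply: nbhs_left_gt; rewrite subr_lt0.
  rewrite (mr2 (1 + h)); last by rewrite in_itv /= gerDl (ltW hlt) andbT; move: hs; lra.
  rewrite (mr2 1); last by rewrite in_itv /= lexx (ltW s1).
  rewrite (_ : _ - _ = mr * h); last by ring.
  by rewrite mulrCA mulVf ?mulr1 // lt_eqF.
have mE : mr = ml - 1 by move: rl; rewrite lE rE; lra.
have slE : green_slope s = ml.
  rewrite /green_slope (mr2 1); last by rewrite in_itv /= lexx (ltW s1).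
  rewrite (ml2 s); last by rewrite in_itv /= lexx (ltW s0).
  by rewrite mE; ring.
split; last by rewrite slE -mE -{1}d0E -d1E.
move=> t; rewrite in_itv /= slE => /andP[t0 t1]; have [ts|st] := leP t s.
  rewrite max_l ?subr_le0 // ml2 ?subr0 //.
  by rewrite in_itv /= t0.
rewrite max_r ?subr_ge0 ?(ltW st) // mr2; last by rewrite in_itv /= t1 (ltW st).
rewrite (ml2 s); last by rewrite in_itv /= lexx (ltW s0).
by rewrite mE; ring.
Unshelve. all: by end_near. Qed.

End GreenFunction.

(** * The Green potential of a continuous density *)

Section Potential.
Context {R : realType}.
Local Notation mu := (@lebesgue_measure R).

(** The identities of the Green function are given for [s] inside the interval only;
    continuity carries them to the end points. *)
Lemma eq_on_closed (g h : R -> R) : continuous g -> continuous h ->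
  (forall s : R, s \in `]0, 1[ -> g s = h s) -> forall s : R, s \in `[0, 1] -> g s = h s.
Proof.
move=> cg ch gh s; rewrite in_itv /= => /andP[s0 s1].
move: s0; rewrite le_eqVlt => /predU1P[<-|s0].
  apply: (cvg_unique _ (cvg_at_right_filter (cg 0))) => //.
  apply: cvg_trans (cvg_at_right_filter (ch 0)); apply: near_eq_cvg; near=> t.
  by apply/esym/gh; rewrite in_itv /=; apply/andP; split; near: t;
    [exact: nbhs_right_gt|exact: nbhs_right_lt].
move: s1; rewrite le_eqVlt => /predU1P[->|s1]; last by apply: gh; rewrite in_itv /= s0.
apply: (cvg_unique _ (cvg_at_left_filter (cg 1))) => //.
apply: cvg_trans (cvg_at_left_filter (ch 1)); apply: near_eq_cvg; near=> t.
by apply/esym/gh; rewrite in_itv /=; apply/andP; split; near: t;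
  [exact: nbhs_left_gt|exact: nbhs_left_lt].
Unshelve. all: by end_near. Qed.

Lemma continuous_integrable_itv (g : R -> R) (a c : R) : continuous g ->
  mu.-integrable `[a, c] (EFin \o g).
Proof.
move=> cg; apply: continuous_compact_integrable; first exact: segment_compact.
exact: continuous_subspaceT.
Qed.

(** Starting at -1 makes the fundamental theorem of calculus available on a
    neighbourhood of [0,1], and with it the one-sided derivatives at the ends. *)
Definition primitive (g : R -> R) (t : R) := \int[mu]_(s in `[-1, t]) g s.

Lemma primitiveB (g : R -> R) (t : R) : continuous g -> 0 <= t ->
  primitive g t - primitive g 0 = \int[mu]_(s in `[0, t]) g s.
Proof.
move=> cg t0; rewrite /primitive.
rewrite (Rintegral_itvB (continuous_integrable_itv (-1) t cg)) ?bnd_simp ?lerN10 //.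
rewrite Rintegral_itv_obnd_cbnd //.
refine (integrableS _ _ _ (continuous_integrable_itv 0 t cg)); [exact: measurable_itv..|].
by move=> s /=; rewrite !in_itv /= => /andP[/ltW -> ->].
Qed.

Lemma is_derive_primitive (g : R -> R) (t : R) : continuous g -> -1 < t ->
  is_derive t 1 (primitive g) (g t).
Proof.
move=> cg t1.
have tu : t < t + 1 by rewrite ltrDl.
have [d e] := continuous_FTC1_closed tu (continuous_integrable_itv (-1) (t + 1) cg) t1 (@cg t).
by apply: DeriveDef; rewrite -?derive1E.
Qed.

Lemma intg_ramp (g : R -> R) (t : R) : continuous g -> t \in `[0, 1] ->
  intg (fun s => Num.max 0 (t - s) * g s) =
    t * (primitive g t - primitive g 0)
    - (primitive (fun s => s * g s) t - primitive (fun s => s * g s) 0).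
Proof.
move=> cg; rewrite in_itv /= => /andP[t0 t1].
have csg : continuous (fun s : R => s * g s) by move=> s; apply: cvgM; [exact: cvg_id|exact: cg].
have cramp : continuous (fun s : R => Num.max 0 (t - s) * g s).
  move=> s; apply: cvgM; last exact: cg.
  apply: (@continuous_max _ _ (cst 0) (fun s => t - s)); first exact: cst_continuous.
  by apply: cvgB; [exact: cvg_cst|exact: cvg_id].
have split01 := @Rintegral_itvB R _ (BLeft 0) (BRight 1) t
  (continuous_integrable_itv 0 1 cramp) t0 t1.
have -> : intg (fun s => Num.max 0 (t - s) * g s) =
    \int[mu]_(s in `[0, t]) (Num.max 0 (t - s) * g s).
  apply/eqP; rewrite -subr_eq0; apply/eqP; rewrite /intg split01.
  rewrite (@eq_Rintegral _ _ _ _ _ (cst 0)); last first.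
    move=> s; rewrite inE /= in_itv /= => /andP[ts _].
    by rewrite max_l ?mul0r // subr_le0 ltW.
  by rewrite Rintegral_cst ?mul0r //; exact: measurable_itv.
rewrite !primitiveB //.
have -> : \int[mu]_(s in `[0, t]) (Num.max 0 (t - s) * g s) =
    \int[mu]_(s in `[0, t]) (t * g s - s * g s).
  apply: eq_Rintegral => s; rewrite inE /= in_itv /= => /andP[_ st].
  by rewrite max_r ?subr_ge0 // mulrBl.
rewrite RintegralB ?RintegralZl //; try exact: continuous_integrable_itv.
by apply: continuous_integrable_itv => s; apply: cvgM; [exact: cvg_cst|exact: cg].
Qed.

Variables (B : 'M[R]_(2, 4)) (G0 G : R -> R -> R) (F : R -> R).
Hypothesis G0_cont : forall s : R, s \in `[0, 1] -> {within `[0, 1], continuous (G0 ^~ s)}.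
Hypothesis green : is_green_function B G0.
Hypothesis G_cont : continuous (fun z : R * R => G z.1 z.2).
Hypothesis G_eq : forall t s : R, t \in `[0, 1] -> s \in `[0, 1] -> G t s = G0 t s.
Hypothesis F_cont : continuous F.

Let slope := green_slope G.
Let P := intg (fun s => G 0 s * F s).
Let Q := intg (fun s => slope s * F s).
Let S := primitive (fun s => s * F s).
Let W := primitive F.

(** The Green potential of [F], written with the primitives of [F] and of
    [s * F s], which makes sense and is twice differentiable beyond [0,1]. *)
Definition potential (t : R) := P + Q * t - (t * (W t - W 0) - (S t - S 0)).

Let I0 : (0 : R) \in `[0, 1]. Proof. by rewrite in_itv /= lexx ler01. Qed.
Let I1 : (1 : R) \in `[0, 1]. Proof. by rewrite in_itv /= lexx ler01. Qed.

Let Gt_cont t : continuous (G t). Proof. exact: continuous_right. Qed.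

Let slope_cont : continuous slope.
Proof.
move=> s; apply: cvgD; first by apply: cvgB; exact: Gt_cont.
by apply: cvgB; [exact: cvg_cst|exact: cvg_id].
Qed.

Let slopeE s : s \in `]0, 1[ -> slope s = green_slope G0 s.
Proof. by move=> /subitv01 sI; rewrite /slope /green_slope !G_eq. Qed.

Let sF_cont : continuous (fun s : R => s * F s).
Proof. by move=> s; apply: cvgM; [exact: cvg_id|exact: F_cont]. Qed.

Let GF_L1 t : L1 (fun s => G t s * F s).
Proof. by apply: continuous_L1T => s; apply: cvgM; [exact: Gt_cont|exact: F_cont]. Qed.

Let slopeF_L1 : L1 (fun s => slope s * F s).
Proof. by apply: continuous_L1T => s; apply: cvgM; [exact: slope_cont|exact: F_cont]. Qed.

Lemma potentialE (t : R) : t \in `[0, 1] -> intg (fun s => G t s * F s) = potential t.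
Proof.
move=> tI; rewrite /potential -intg_ramp //.
have cmax : continuous (fun s : R => Num.max 0 (t - s)).
  move=> s; apply: (@continuous_max _ _ (cst 0) (fun s => t - s)); first exact: cst_continuous.
  by apply: cvgB; [exact: cvg_cst|exact: cvg_id].
have ramp_L1 : L1 (fun s => Num.max 0 (t - s) * F s).
  by apply: continuous_L1T => s; apply: cvgM; [exact: cmax|exact: F_cont].
rewrite mulrC -intgZ // -intgD //; last exact: L1Z.
rewrite -intgB //; last by apply: L1D => //; exact: L1Z.
apply: eq_intg => s sI; rewrite mulrA -mulrDl -mulrBl; congr (_ * _).
apply: (@eq_on_closed (G t) (fun s => G 0 s + t * slope s - Num.max 0 (t - s))) => //.
  move=> x; apply: cvgB; last exact: cmax.
  by apply: cvgD; [exact: Gt_cont|apply: cvgM; [exact: cvg_cst|exact: slope_cont]].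
move=> x xI; have xI' := subitv01 xI.
have [affine _] := green_affine G0_cont green xI.
by rewrite !G_eq // affine // slopeE // [t * _]mulrC.
Qed.

Let slope_at (t : R) := Q - (W t - W 0).

Lemma is_derive_potential (t : R) : -1 < t -> is_derive t 1 potential (slope_at t).
Proof.
move=> t1.
have dW : is_derive t 1 W (F t) by exact: is_derive_primitive.
have dS : is_derive t 1 S (t * F t) by apply: is_derive_primitive.
rewrite (_ : potential = (cst P + Q \*: id) - (id * (W - cst (W 0)) - (S - cst (S 0)))) //.
apply: is_derive_eq; rewrite /GRing.scale /= /slope_at.
by rewrite (_ : (W - cst (W 0)) t = W t - W 0) //; ring.
Qed.

Lemma is_derive_slope_at (t : R) : -1 < t -> is_derive t 1 slope_at (- F t).
Proof.
move=> t1; have dW : is_derive t 1 W (F t) by exact: is_derive_primitive.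
rewrite (_ : slope_at = cst Q - (W - cst (W 0))) //.
by apply: is_derive_eq; ring.
Qed.

Lemma potential_continuous : {within `[0, 1], continuous potential}.
Proof.
apply: derivable_within_continuous => t; rewrite in_itv /= => /andP[t0 _].
by have [] := is_derive_potential (lt_le_trans (ltrN10 R) t0).
Qed.

Lemma potential_second_derivative (t : R) : t \in `]0, 1[ ->
  twice_derivable potential t /\ potential^`(2)%classic t = - F t.
Proof.
rewrite in_itv /= => /andP[t0 t1].
have near1 : \forall x \near t, -1 < x by apply: lt_nbhsr; rewrite (lt_trans _ t0) // ltrN10.
have near_slope : \forall x \near t, slope_at x = potential^`()%classic x.
  apply: filterS near1 => x x1; have dx := is_derive_potential x1.
  by rewrite derive1E derive_val.
have d2 : is_derive t 1 potential^`()%classic (- F t).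
  apply: near_eq_is_derive near_slope _.
  by apply: is_derive_slope_at; rewrite (lt_trans _ t0) // ltrN10.
split; first split.
- by apply: filterS near1 => x /is_derive_potential [].
- by case: d2.
- by rewrite -[LHS]/(potential^`()%classic^`()%classic t) derive1E derive_val.
Qed.

Let one_sided_derivative (x : R) : -1 < x ->
  h^-1 * (potential (x + h) - potential x) @[h --> 0^'] --> slope_at x.
Proof.
move=> x1; have [dx ex] := is_derive_potential x1.
rewrite (_ : (fun h => _) = (fun h => h^-1 *: (potential (h *: 1 + x) - potential x))).
  by rewrite -ex; exact: dx.
by apply/funext => h; rewrite /GRing.scale /= mulr1 [h + x]addrC.
Qed.

(** The boundary values of the potential are the integrals against [F] of those of
    the sections, and the boundary relations of the sections are linear. *)
Lemma potential_boundary_data : boundary_data B potential.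
Proof.
exists (slope_at 0), (slope_at 1); split.
- exact: cvg_dnbhs_at_right (one_sided_derivative (ltrN10 R)).
- exact: cvg_dnbhs_at_left (one_sided_derivative (lt_trans (ltrN10 R) ltr01)).
have e0 : slope_at 0 = Q by rewrite /slope_at !subrr subr0.
have e1 : slope_at 1 = intg (fun s => (slope s - 1) * F s).
  rewrite /slope_at (primitiveB F_cont ler01) -/(intg F).
  under [RHS]eq_intg do rewrite mulrBl mul1r.
  by rewrite intgB //; exact: continuous_L1T.
rewrite e0 e1 -(potentialE I0) -(potentialE I1).
pose v (s : R) : 'cV[R]_4 := \col_(i < 4) [:: G 0 s; slope s; G 1 s; slope s - 1]`_i.
have vE i s : v s i 0 = [:: G 0 s; slope s; G 1 s; slope s - 1]`_i by rewrite mxE.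
have v_cont i : continuous (fun s : R => v s i 0).
  have c1 : continuous (fun s : R => slope s - 1).
    by move=> s; apply: cvgB; [exact: slope_cont|exact: cvg_cst].
  rewrite (_ : (fun s => v s i 0) = (fun s => [:: G 0 s; slope s; G 1 s; slope s - 1]`_i)); last first.
    by apply/funext => s; rewrite vE.
  by case: i => [[|[|[|[|]]]] //= _].
have vF_L1 i : L1 (fun s => v s i 0 * F s).
  by apply: continuous_L1T => s; apply: cvgM; [exact: v_cont|exact: F_cont].
have Bv s : s \in `[0, 1] -> B *m v s = 0.
  move=> sI; apply/matrixP => i j; rewrite [RHS]mxE ord1 mxE.
  apply: (@eq_on_closed (fun s => \sum_k B i k * v s k 0) (fun=> 0)) => //.
  - apply: continuous_big => [|k _]; first exact: add_continuous.
    by move=> x; apply: cvgM; [exact: cvg_cst|exact: v_cont].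
  - by move=> x; exact: cvg_cst.
  move=> x xI; have [_ /matrixP/(_ i 0)] := green_affine G0_cont green xI.
  rewrite !mxE => {2}<-; apply: eq_bigr => k _; rewrite !mxE.
  by rewrite !G_eq ?slopeE // subitv01.
rewrite (_ : \col_i _ = \col_i intg (fun s => v s i 0 * F s)); last first.
  apply/colP => i; rewrite !mxE.
  by case: i => [[|[|[|[|]]]] //= i_lt]; apply: eq_intg => s _; rewrite vE.
apply/matrixP => i j; rewrite !mxE.
transitivity (\sum_k intg (fun s => B i k * (v s k 0 * F s))).
  by apply: eq_bigr => k _; rewrite mxE intgZ.
rewrite -intg_sum => [|k]; last exact: L1Z.
rewrite -[RHS](intg_cst (0 : R)); apply: eq_intg => s sI.
have e : (B *m v s) i 0 = 0 by rewrite Bv // mxE.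
rewrite mxE in e.
transitivity ((\sum_k B i k * v s k 0) * F s); last by rewrite e mul0r.
by rewrite mulr_suml; apply: eq_bigr => k _; rewrite mulrA.
Qed.

End Potential.

(** * Extrema and extension of the data *)

Section Extremum.
Context {R : realType} {T : Type}.
Implicit Types (g h : T -> R) (D : set T) (N : R).

Lemma max_on_ge D g N x : (forall y, D y -> g y <= N) -> D x -> g x <= max_on D g.
Proof. by move=> gN Dx; apply: ub_le_sup; [exists N => _ [y Dy <-]; exact: gN|exists x]. Qed.

Lemma max_on_le D g N : D !=set0 -> (forall y, D y -> g y <= N) -> max_on D g <= N.
Proof.
move=> [x Dx] gN; apply: ge_sup; first by exists (g x), x.
by move=> _ [y Dy <-]; exact: gN.
Qed.

Lemma min_on_le D g N x : (forall y, D y -> N <= g y) -> D x -> min_on D g <= g x.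
Proof. by move=> gN Dx; apply: ge_inf; [exists N => _ [y Dy <-]; exact: gN|exists x]. Qed.

Lemma min_on_ge D g N : D !=set0 -> (forall y, D y -> N <= g y) -> N <= min_on D g.
Proof.
move=> [x Dx] gN; apply: lb_le_inf; first by exists (g x), x.
by move=> _ [y Dy <-]; exact: gN.
Qed.

Lemma min_on_ge0 D g : (forall y, D y -> 0 <= g y) -> 0 <= min_on D g.
Proof.
move=> g0; have [/min_on_ge|/set0P/negP] := pselect (D !=set0); first exact.
by rewrite negbK => /eqP ->; rewrite /min_on image_set0 inf0.
Qed.

Lemma eq_max_on D g h : (forall y, D y -> g y = h y) -> max_on D g = max_on D h.
Proof. by move=> gh; congr sup; apply: eq_imagel. Qed.

End Extremum.

Lemma continuous_comp_into (S T U : topologicalType) (D : set T) (h : T -> U) (g : S -> T) :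
  {within D, continuous h} -> continuous g -> (forall x, D (g x)) -> continuous (h \o g).
Proof.
move=> /subspace_continuousP hc gc gD x P /(hc _ (gD x)) hP.
have {}hP : nbhs (g x) [set y | D y -> P (h y)] := hP.
by apply: (@filterS _ (nbhs x) _ _ _ _ (gc x _ hP)) => y /= ; apply; exact: gD.
Qed.

Section ClampedData.
Context {R : realType}.
Implicit Types t s x : R.

(** Extension by a retraction keeps the kernel and the source continuous and
    nonnegative, now on the whole plane; the fixed point only sees the original
    values. *)
Definition clamp_kernel (G : R -> R -> R) t s := G (clamp 0 1 t) (clamp 0 1 s).
Definition clamp_source (f : R -> R -> R) s x := f (clamp 0 1 s) (Num.max 0 x).

Lemma clamp01_id t : t \in `[0, 1] -> clamp 0 1 t = t.
Proof. by rewrite in_itv; exact: clamp_id. Qed.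

Lemma clamp_kernelE G t s : t \in `[0, 1] -> s \in `[0, 1] -> clamp_kernel G t s = G t s.
Proof. by move=> tI sI; rewrite /clamp_kernel !clamp01_id. Qed.

Lemma clamp_sourceE f s x : s \in `[0, 1] -> 0 <= x -> clamp_source f s x = f s x.
Proof. by move=> sI x0; rewrite /clamp_source clamp01_id // max_r. Qed.

Let pair_continuous (g h : R -> R) : continuous g -> continuous h ->
  continuous (fun z : R * R => (g z.1, h z.2)).
Proof.
move=> cg ch z.
have c1 : continuous (fun z : R * R => g z.1).
  by move=> y; apply: (@continuous_comp _ _ _ fst g); [exact: cvg_fst|exact: cg].
have c2 : continuous (fun z : R * R => h z.2).
  by move=> y; apply: (@continuous_comp _ _ _ snd h); [exact: cvg_snd|exact: ch].
exact: (cvg_pair (@c1 z) (@c2 z)).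
Qed.

Lemma clamp_kernel_continuous G :
  {within `[0, 1] `*` `[0, 1], continuous (fun z : R * R => G z.1 z.2)} ->
  continuous (fun z : R * R => clamp_kernel G z.1 z.2).
Proof.
move=> cG; apply: (continuous_comp_into (g := fun z => (clamp 0 1 z.1, clamp 0 1 z.2)) cG).
  by apply: pair_continuous; exact: clamp_continuous.
by move=> z; split => /=; exact: clamp01_in.
Qed.

Lemma clamp_source_continuous f :
  {within `[0, 1] `*` `[0, +oo[, continuous (fun z : R * R => f z.1 z.2)} ->
  continuous (fun z : R * R => clamp_source f z.1 z.2).
Proof.
move=> cf; apply: (@continuous_comp_into _ _ _ _ _ (fun z : R * R => (clamp 0 1 z.1, Num.max 0 z.2)) cf).
  apply: (@pair_continuous (clamp 0 1) (Num.max 0)); first exact: clamp_continuous.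
  by move=> x; apply: continuous_max; [exact: cvg_cst|exact: cvg_id].
move=> z; split => /=; first exact: clamp01_in.
by rewrite in_itv /= le_max lexx.
Qed.

End ClampedData.

(** * Solution of the nonlocal problem *)

Section NonlocalProblem.
Context {R : realType}.
Local Notation mu := (@lebesgue_measure R).
Local Notation I01 := (`[0%R, 1%R]%classic : set R).
Variables (lambda : R) (A : R -> R) (f : R -> R -> R) (b : R -> R) (rho1 rho2 : R).
Variables (p : R -> R) (pm pp q : R) (B : 'M[R]_(2, 4)) (G : R -> R -> R) (alpha beta eta0 : R).
Hypothesis lambda_gt0 : 0 < lambda.
Hypothesis A_cont : {within `[0, +oo[, continuous A}.
Hypothesis f_cont : {within `[0, 1] `*` `[0, +oo[, continuous (fun z : R * R => f z.1 z.2)}.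
Hypothesis f_ge0 : forall t x : R, t \in `[0, 1] -> 0 <= x -> 0 <= f t x.
Hypothesis b_int : mu.-integrable `]0, 1] (EFin \o b).
Hypothesis b_ge0 : forall t : R, t \in `]0, 1] -> 0 <= b t.
Hypothesis b_gt0 : {ae mu, forall t : R, t \in `]0, 1] -> 0 < b t}.
Hypothesis b_neq0 : fconv b (cst 1) 1 != 0.
Hypotheses (rho1_gt0 : 0 < rho1) (rho12 : rho1 < rho2).
Hypothesis A_gt0 : forall t : R, t \in `[rho1, rho2] -> 0 < A t.
Hypothesis p_cont : {within `[0, 1], continuous p}.
Hypothesis pm_gt1 : 1 < pm.
Hypothesis p_bounds : forall t : R, t \in `[0, 1] -> pm <= p t <= pp.
Hypothesis G_cont : {within `[0, 1] `*` `[0, 1], continuous (fun z : R * R => G z.1 z.2)}.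
Hypothesis G_ge0 : forall t s : R, t \in `[0, 1] -> s \in `[0, 1] -> 0 <= G t s.
Hypotheses (alpha_ge0 : 0 <= alpha) (alpha_beta : alpha < beta) (beta_le1 : beta <= 1).
Hypotheses (eta0_gt0 : 0 < eta0) (eta0_le1 : eta0 <= 1).
Hypothesis G_harnack : forall s : R, s \in `[0, 1] ->
  min_on `[alpha, beta] (G ^~ s) >= eta0 * green_max G s.
Hypothesis green_max_gt0 : forall s : R, s \in `]0, 1[ -> 0 < green_max G s.
Hypothesis C0_gt0 : 0 < C0 G.
Hypotheses (q_gt1 : 1 < q) (q_lt_pm : q < pm).
Hypothesis bq_int : mu.-integrable `]0, 1] (EFin \o (fun t : R => b t `^ (1 - q)^-1)).

Local Notation w := (reflected_weight b).
Local Notation Gc := (clamp_kernel G).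
Local Notation fc := (clamp_source f).
Local Notation Phi := (modular w p).
Local Notation M := (M_rho G b pm pp q).
Local Notation kcone := (kernel_cone alpha beta eta0 (C0 G)).
Let k (r : R) := lambda / A (clamp rho1 rho2 r).

Let I0 : (0 : R) \in `[0, 1]. Proof. by rewrite in_itv /= lexx ler01. Qed.

Let A_clamp_gt0 r : 0 < A (clamp rho1 rho2 r).
Proof. by apply: A_gt0; rewrite in_itv /= clamp_bounds // ltW. Qed.

Let k_gt0 r : 0 < k r.
Proof. exact: divr_gt0. Qed.

Let k_id r : r \in `[rho1, rho2] -> k r = lambda / A r.
Proof. by rewrite in_itv /= => rI; rewrite /k clamp_id. Qed.

Let k_cont : continuous k.
Proof.
have cA : continuous (A \o clamp rho1 rho2).
  apply: (continuous_comp_into A_cont); first exact: clamp_continuous.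
  move=> r; rewrite /= in_itv /= andbT (le_trans (ltW rho1_gt0)) //.
  by have /andP[] := clamp_bounds r (ltW rho12).
move=> r; apply: cvgM; first exact: cvg_cst.
by apply: cvgV; [rewrite gt_eqF|exact: cA].
Qed.

Let k_bounded : exists abar, forall r, k r <= abar.
Proof.
have [c _ kc] := EVT_max (ltW rho12) (continuous_subspaceT k_cont).
exists (k c) => r; have rb := clamp_bounds r (ltW rho12).
by have := kc (clamp rho1 rho2 r); rewrite in_itv /= => /(_ rb); rewrite /k (clamp_id rb).
Qed.

Let w_L1 : L1 w. Proof. exact: reflected_weight_L1. Qed.
Let w_ge0 (s : R) : s \in `[0, 1] -> 0 <= w s. Proof. exact: reflected_weight_ge0. Qed.
Let wq_L1 : L1 (fun s => w s `^ (1 - q)^-1). Proof. exact: reflected_weight_pow_L1. Qed.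
Let w_gt0 : {ae mu, forall s : R, s \in `[0, 1] -> 0 < w s}. Proof. exact: reflected_weight_gt0. Qed.
Let p_meas : measurable_fun I01 p. Proof. exact: continuous_measurable_I01. Qed.

Let W_gt0 : 0 < intg w.
Proof. by rewrite lt_neqAle eq_sym -fconv_weight1 // b_neq0 fconv_weight1 // intg_ge0. Qed.

Let Gc_cont : continuous (fun z : R * R => Gc z.1 z.2). Proof. exact: clamp_kernel_continuous. Qed.
Let fc_cont : continuous (fun z : R * R => fc z.1 z.2). Proof. exact: clamp_source_continuous. Qed.
Let Gc_ge0 t s : 0 <= Gc t s. Proof. by apply: G_ge0; exact: clamp01_in. Qed.
Let fc_ge0 s x : 0 <= fc s x.
Proof. by apply: f_ge0; [exact: clamp01_in|rewrite le_max lexx]. Qed.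

Let le_green_max (t s : R) : t \in `[0, 1] -> s \in `[0, 1] -> Gc t s <= green_max G s.
Proof.
move=> tI sI; have [N HN] := bounded_on_rectangle G_cont; rewrite clamp_kernelE //.
by apply: (max_on_ge (g := G ^~ s) (N := N)) => // y yI; exact: HN.
Qed.

Let Gc_harnack (t t' s : R) : t \in `[alpha, beta] -> t' \in `[0, 1] -> s \in `[0, 1] ->
  eta0 * Gc t' s <= Gc t s.
Proof.
move=> tI t'I sI; have tI' := subitv_ab alpha_ge0 beta_le1 tI.
apply: (@le_trans _ _ (eta0 * green_max G s)); first by rewrite ler_pM2l // le_green_max.
rewrite clamp_kernelE //; apply: le_trans (G_harnack sI) _.
apply: (min_on_le (g := G ^~ s) (N := 0)) => // y yI; apply: G_ge0 => //.
exact: subitv_ab yI.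
Qed.

Let C0_green_max (s : R) : s \in `]0, 1[ -> C0 G * green_max G s <= intg (Gc ^~ s).
Proof.
move=> sI; have sI' := subitv01 sI; rewrite mulrC -ler_pdivlMl ?green_max_gt0 //.
have -> : intg (Gc ^~ s) = \int[mu]_(t in `[0, 1]) G t s.
  by apply: eq_intg => t tI; rewrite clamp_kernelE.
apply: (min_on_le (g := fun s => (green_max G s)^-1 * \int[mu]_(t in `[0, 1]) G t s) (N := 0)) => //.
move=> y yI; rewrite mulr_ge0 ?invr_ge0 ?(ltW (green_max_gt0 yI)) //.
by apply: intg_ge0 => t tI; rewrite G_ge0 // subitv01.
Qed.

Let Gc_mass (s t' : R) : s \in `]0, 1[ -> t' \in `[0, 1] -> C0 G * Gc t' s <= intg (Gc ^~ s).
Proof.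
move=> sI tI; apply: le_trans (C0_green_max sI).
by rewrite ler_pM2l // le_green_max // subitv01.
Qed.

Let Gc_mass_gt0 (s : R) : s \in `]0, 1[ -> 0 < intg (Gc ^~ s).
Proof. by move=> sI; apply: lt_le_trans (C0_green_max sI); rewrite mulr_gt0 ?green_max_gt0. Qed.

Let M_gt0 r : 0 < r -> 0 < M r.
Proof.
move=> r0; rewrite /M_rho !mulr_gt0 ?invr_gt0 ?powR_gt0 //.
by rewrite ltr_wpDl // mulr_ge0 ?powR_ge0.
Qed.

Let le_M (u : R -> R) (N r t : R) : measurable_fun I01 u ->
  (forall s : R, s \in `[0, 1] -> 0 <= u s <= N) -> 0 < r -> Phi u <= r ->
  C0 G * u t <= intg u -> u t <= M r.
Proof.
move=> mu_ uN r0 Phir; rewrite -ler_pdivlMl // => /le_trans; apply.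
have := modular_upper w_L1 w_ge0 p_meas pm_gt1 p_bounds q_gt1 q_lt_pm w_gt0 wq_L1 mu_ uN r0 Phir.
rewrite /M_rho fconv_weight_pow1 // -mulrA ler_pM2l ?invr_gt0 // => /le_trans; apply.
rewrite ler_peMl ?powR_ge0 // powR_ge1 ?ler1n // divr_ge0 //; last by rewrite ltW // (lt_trans ltr01).
by rewrite subr_ge0 (le_trans (ltW q_lt_pm)) //; exact: exponents_le p_bounds.
Qed.

Let kcone_bounded (u : R -> R) : continuous u -> (forall t, 0 <= u t) ->
  exists N, forall s : R, s \in `[0, 1] -> 0 <= u s <= N.
Proof.
move=> cu u0; have [N HN] := continuous_bounded_I01 (continuous_subspaceT cu).
by exists N => s /HN; rewrite ger0_norm // u0.
Qed.

Let kcone_le_M (u : R -> R) (r : R) : kcone u -> 0 < r -> Phi u <= r ->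
  forall t : R, t \in `[0, 1] -> u t <= M r.
Proof.
move=> [cu u0 _ um] r0 Phir t tI; have [N HN] := kcone_bounded cu u0.
by apply: (le_M (continuous_bm cu) HN r0 Phir); exact: um.
Qed.

Let m_rhoE r : m_rho b pm pp r = (r / intg w) `^ pp^-1 +
  (if 0 < (r / intg w) `^ pp^-1 < 1
   then (r / intg w) `^ pm^-1 - (r / intg w) `^ pp^-1 else 0).
Proof. by rewrite /m_rho /eps_rho fconv_weight1. Qed.

Let m_rho_ge0 r : 0 <= m_rho b pm pp r.
Proof.
by rewrite m_rhoE; case: ifP => _; rewrite ?addr0 ?powR_ge0 // addrC subrK powR_ge0.
Qed.

Let kcone_ge_m (u : R -> R) (r s : R) : kcone u -> 0 < r -> r <= Phi u ->
  s \in `[alpha, beta] -> eta0 * m_rho b pm pp r <= u s.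
Proof.
move=> [cu u0 uH _] r0 Phir sI; rewrite mulrC -ler_pdivlMr // m_rhoE.
apply: (modular_lower w_L1 w_ge0 p_meas pm_gt1 p_bounds (continuous_bm cu)) => //.
by move=> t tI; rewrite u0 ler_pdivlMr // mulrC uH.
Qed.

Hypothesis ineq1 :
  (2 `^ (1 - pp) *
     (lambda * rect_min f alpha beta (eta0 * m_rho b pm pp rho1) (M rho1) / A rho1 *
      max_on `[0, 1] (fun tau : R => \int[mu]_(s in `[alpha, beta]) G tau s)) `^ pm - 1) *
  \int[mu]_(t in `[alpha, beta]) b (1 - t) > rho1 / eta0 `^ pp.
Hypothesis ineq2 :
  let X := lambda * rect_max f 0 1 0 (M rho2) * green_int_max G / A rho2 in
  Num.max (X `^ pm) (X `^ pp) * \int[mu]_(t in `[0, 1]) b (1 - t) < rho2.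

Let rho2_gt0 : 0 < rho2. Proof. exact: lt_trans rho12. Qed.

Let cone_expand (u : R -> R) : kcone u -> Phi u = rho1 ->
  rho1 < Phi (fun t => k (Phi u) * hammerstein fc Gc u t).
Proof.
move=> uK Phiu; have [cu u0 _ _] := uK.
pose fm := rect_min f alpha beta (eta0 * m_rho b pm pp rho1) (M rho1).
have f0 (z : R * R) : (`[alpha, beta] `*` `[eta0 * m_rho b pm pp rho1, M rho1])%classic z ->
    0 <= f z.1 z.2.
  move=> [/= z1]; rewrite in_itv /= => /andP[z2 _]; apply: f_ge0; first exact: subitv_ab z1.
  by apply: le_trans z2; rewrite mulr_ge0 // ltW.
apply: (hammerstein_expands (fm := fm) fc_cont fc_ge0 Gc_cont Gc_ge0 w_L1 w_ge0 p_meas pm_gt1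
  p_bounds (k_gt0 _) eta0_gt0 eta0_le1 alpha_ge0 beta_le1 Gc_harnack cu).
- exact: min_on_ge0.
- exact: rho1_gt0.
- move=> s sI; have sI' := subitv_ab alpha_ge0 beta_le1 sI; rewrite clamp_sourceE //.
  apply: (min_on_le (g := fun z : R * R => f z.1 z.2) (x := (s, u s)) f0); split => //=.
  rewrite in_itv /= kcone_ge_m ?Phiu //=.
  by apply: kcone_le_M => //; rewrite Phiu.
rewrite k_id; last by rewrite Phiu in_itv /= lexx ltW.
rewrite Phiu -(Rintegral_weight b_int alpha_ge0 beta_le1) [X in (X * _) `^ _]mulrAC.
rewrite (eq_max_on (h := fun tau : R => \int[mu]_(s in `[alpha, beta]) G tau s)); first exact: ineq1.
move=> t tI; apply: eq_Rintegral => s; rewrite inE /= => sI.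
by rewrite clamp_kernelE //; exact: subitv_ab sI.
Qed.

Let cone_compress (u : R -> R) : kcone u -> Phi u = rho2 ->
  Phi (fun t => k (Phi u) * hammerstein fc Gc u t) < rho2.
Proof.
move=> uK Phiu; have [cu u0 _ _] := uK.
apply: (hammerstein_compresses (fM := rect_max f 0 1 0 (M rho2)) (GM := green_int_max G)
  fc_cont fc_ge0 Gc_cont Gc_ge0 w_L1 w_ge0 p_meas pm_gt1 p_bounds (k_gt0 _) cu).
- move=> s sI; rewrite clamp_sourceE //.
  have [N HN] := bounded_on_rectangle (a := 0) (b := 1) (c := 0) (d := M rho2)
    (continuous_subspaceT fc_cont).
  apply: (max_on_ge (g := fun z : R * R => f z.1 z.2) (x := (s, u s)) (N := N)); last first.
    by split => //=; rewrite in_itv /= u0; apply: kcone_le_M => //; rewrite Phiu.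
  move=> [y x] [/= yI xI]; rewrite -clamp_sourceE //; first exact: HN.
  by move: xI; rewrite in_itv /= => /andP[].
- move=> t tI; have [N HN] := bounded_on_rectangle G_cont.
  have GE (y : R) : y \in `[0, 1] -> \int[mu]_(s in `[0, 1]) G y s = intg (Gc y).
    by move=> yI; apply: eq_intg => s sI; rewrite clamp_kernelE.
  rewrite -/(intg (Gc t)) -GE //.
  apply: (max_on_ge (g := fun t : R => \int[mu]_(s in `[0, 1]) G t s) (N := N)) => // y yI.
  rewrite GE //; apply: intg_le_cst; first by apply: continuous_L1T; exact: (continuous_right Gc_cont).
  by move=> s sI; rewrite clamp_kernelE //; exact: (HN y s).
rewrite k_id; last by rewrite Phiu in_itv /= lexx ltW.
move: ineq2 => /=; rewrite Phiu Rintegral_weight // -/(intg w).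
by rewrite (_ : lambda / A rho2 * _ * _ = lambda * rect_max f 0 1 0 (M rho2) * green_int_max G / A rho2)
  // -!mulrA; congr (_ * _); rewrite mulrCA; congr (_ * _); rewrite mulrC.
Qed.

Let fixed_point : exists u, [/\ kcone u, rho1 < Phi u < rho2 &
  forall t : R, t \in `[0, 1] -> u t = k (Phi u) * hammerstein fc Gc u t].
Proof.
have [abar k_le] := k_bounded.
have [Gmax HG] := bounded_on_rectangle G_cont.
have [H HH] := bounded_on_rectangle (a := 0) (b := 1) (c := 0) (d := M rho2)
  (continuous_subspaceT fc_cont).
apply: (@hammerstein_fixed_point R fc Gc w p k pm pp alpha beta eta0 (C0 G) (M rho2) rho1 rho2
  abar Gmax H) => //.
- by move=> t s tI sI; rewrite clamp_kernelE //; exact: (HG t s).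
- exact: M_gt0.
- by move=> u uK Phiu; exact: kcone_le_M.
Qed.

Local Notation K := (cone G alpha beta eta0).

Let within_bounded (u : R -> R) : {within `[0, 1], continuous u} ->
  (forall t : R, t \in `[0, 1] -> 0 <= u t) ->
  exists N, forall s : R, s \in `[0, 1] -> 0 <= u s <= N.
Proof.
move=> cu u0; have [N HN] := continuous_bounded_I01 cu.
by exists N => s sI; rewrite u0 // -(ger0_norm (u0 s sI)) HN.
Qed.

Let nonlocalE (u : R -> R) : {within `[0, 1], continuous u} ->
  (forall t : R, t \in `[0, 1] -> 0 <= u t) -> nonlocal b p u = Phi u.
Proof.
move=> cu u0; have [N HN] := within_bounded cu u0; apply: nonlocal_modular.
exact: (modular_L1 w_L1 p_meas pm_gt1 p_bounds (continuous_measurable_I01 cu) HN).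
Qed.

(** The modular is continuous for uniform convergence of bounded functions, so on the
    closure of a sublevel set the inequality survives in weak form. *)
Let modular_closure (u : R -> R) (r : R) : K u ->
  closure (Vhat K b p r : set {uniform` `[0, 1] -> R}) u -> Phi u <= r.
Proof.
move=> [cu u0 _ _] clu.
have near_v (n : nat) : exists v : R -> R, Vhat K b p r v /\
    forall s : R, s \in `[0, 1] -> `|v s - u s| <= n.+1%:R^-1.
  pose e : {posnum R} := PosNum (ltac:(by rewrite invr_gt0 ltr0n) : 0 < n.+1%:R^-1 :> R).
  have : nbhs (u : {uniform` `[0, 1] -> R})
      [set v : R -> R | forall s : R, s \in `[0, 1] -> `|v s - u s| <= n.+1%:R^-1].
    apply/uniform_nbhs; exists [set z : R * R | ball z.1 e%:num z.2]; split.
      exact: entourage_ball.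
    by move=> v /= Hv s sI; rewrite distrC ltW //; exact: Hv.
  by move=> /clu [v [Vv Hv]]; exists v.
have [v Hv] := choice near_v.
have vK n : K (v n) by case: (Hv n) => -[].
have [N HN] := within_bounded cu u0.
have vu (s : R) : s \in `[0, 1] -> v n s @[n --> \oo] --> u s.
  move=> sI; apply: (cvgn_close (v := harmonic) (w := fun=> u s)).
  - by move=> n; case: (Hv n) => _; exact.
  - exact: cvg_harmonic.
  - exact: cvg_cst.
have Phiv : Phi (v n) @[n --> \oo] --> Phi u.
  apply: (cvg_modular w_L1 p_meas pm_gt1 p_bounds (M := N + 1)) vu.
  - by move=> n; apply: continuous_measurable_I01; case: (vK n).
  - move=> n s sI; have [_ v0 _ _] := vK n; rewrite v0 //=.
    have /andP[_ uN] := HN s sI; have [_ /(_ s sI)] := Hv n.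
    have : n.+1%:R^-1 <= 1 :> R by rewrite invf_le1 ?ltr0n // ler1n.
    move=> h1 /(le_trans (ler_norm _)) /le_trans /(_ h1) h2.
    by rewrite -[v n s](subrK (u s)) [leRHS]addrC lerD.
apply: (cvgn_le _ Phiv (cvg_cst r)) => n.
have [cv v0 _ _] := vK n; rewrite -nonlocalE //.
by case: (Hv n) => -[_ /ltW].
Qed.

Hypothesis green : is_green_function B G.

Let G_left_cont (s : R) : s \in `[0, 1] -> {within `[0, 1], continuous (G ^~ s)}.
Proof.
move=> sI; apply: (@subspace_eq_continuous _ _ _ (Gc ^~ s)).
  by move=> t; rewrite inE => tI; rewrite clamp_kernelE.
by apply: continuous_subspaceT; exact: (continuous_left Gc_cont).
Qed.

(** The fixed point is replaced by the potential of its density, which agrees with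
    it on [0,1] and is differentiable across the end points. *)
Let solution_data : exists (u F : R -> R) (r : R),
  [/\ {within `[0, 1], continuous u}, (forall t : R, t \in `[0, 1] -> 0 <= u t),
      (forall t : R, t \in `[0, 1] -> u t <= M rho2),
      (forall t t' : R, t \in `[alpha, beta] -> t' \in `[0, 1] -> eta0 * u t' <= u t) &
      (forall t' : R, t' \in `[0, 1] -> C0 G * u t' <= intg u)] /\
  [/\ rho1 < r < rho2, Phi u = r,
      (forall t : R, t \in `[0, 1] -> u t = intg (fun s => Gc t s * F s)),
      (forall s : R, s \in `[0, 1] -> F s = lambda / A r * f s (u s)) &
      forall t, L1 (fun s => Gc t s * F s)] /\
  (forall t : R, t \in `]0, 1[ -> twice_derivable u t /\ u^`(2)%classic t = - F t) /\
  boundary_data B u.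
Proof.
have [u [uK r12 uE]] := fixed_point.
have uM := kcone_le_M uK rho2_gt0; have {uK} [cu u_ge0 uH um] := uK.
pose F s := k (Phi u) * fc s (u s).
have F_cont : continuous F.
  by move=> s; apply: cvgM; [exact: cvg_cst|exact: (continuous_graph fc_cont cu)].
have GE : forall t s : R, t \in `[0, 1] -> s \in `[0, 1] -> Gc t s = G t s.
  by move=> t s; exact: clamp_kernelE.
have Gf_L1 t : L1 (fun s => Gc t s * fc s (u s)).
  apply: continuous_L1T => s; apply: cvgM; first exact: (continuous_right Gc_cont).
  exact: (continuous_graph fc_cont cu).
have potE := potentialE G_left_cont green Gc_cont GE F_cont.
have vE (t : R) : t \in `[0, 1] -> potential Gc F t = u t.
  move=> tI; rewrite -(potE t tI) (uE t tI) -(intgZ _ (Gf_L1 t)).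
  by apply: eq_intg => s _; exact: mulrCA.
exists (potential Gc F), F, (Phi u); split; [split|split; [split|split]].
- exact: potential_continuous.
- by move=> t tI; rewrite vE.
- by move=> t tI; rewrite vE // uM //; case/andP: r12 => _ /ltW.
- by move=> t t' tI t'I; rewrite !vE ?uH //; exact: subitv_ab tI.
- move=> t' t'I; rewrite vE //; apply: le_trans (um t' t'I) _.
  by rewrite (@eq_intg _ (potential Gc F) u).
- exact: r12.
- by apply: eq_intg => s sI; rewrite vE.
- by move=> t tI; rewrite potE.
- move=> s sI; rewrite vE // /F k_id; first by rewrite clamp_sourceE.
  by case/andP: r12 => h1 h2; rewrite in_itv /= (ltW h1) (ltW h2).
- by move=> t; apply: continuous_L1T => s; apply: cvgM; [exact: (continuous_right Gc_cont)|exact: F_cont].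
- exact: potential_second_derivative.
- exact: (potential_boundary_data G_left_cont green Gc_cont GE F_cont).
Qed.

Theorem nonlocal_problem_solvable : exists u : R -> R,
  [/\ positive_solution K lambda A f b p G u,
      solves_bvp B lambda A f b p u,
      u \in Vhat K b p rho2 `\` rel_closure K (Vhat K b p rho1),
      m_rho b pm pp rho1 <= sup_norm u & sup_norm u <= M rho2].
Proof.
have [u [F [r [[cu u0 uM uH um] [[/andP[r1 r2] Phiu uE FE GF_L1] [u'' uB]]]]]] := solution_data.
have nl : nonlocal b p u = r by rewrite nonlocalE.
have r0 : 0 < r by exact: lt_trans r1.
have A_r : 0 < A r by apply: A_gt0; rewrite in_itv /= (ltW r1) (ltW r2).
have sup_le X : (forall t : R, t \in `[0, 1] -> u t <= X) -> sup_norm u <= X.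
  move=> uX; apply: max_on_le; first by exists 0; exact: I0.
  by move=> t tI; rewrite (ger0_norm (u0 t tI)); exact: uX.
have le_sup (t : R) : t \in `[0, 1] -> 0 <= u t <= sup_norm u.
  move=> tI; rewrite u0 //= -[u t](ger0_norm (u0 t tI)).
  apply: (max_on_ge (g := fun t => `|u t|) (N := M rho2)) => // y yI.
  by rewrite (ger0_norm (u0 y yI)); exact: uM.
have Ku : K u.
  split; [exact: cu|exact: u0| |].
    apply: min_on_ge; first by exists alpha; rewrite /= in_itv /= lexx ltW.
    move=> t tI; rewrite mulrC -ler_pdivlMr //.
    by apply: sup_le => t' t'I; rewrite ler_pdivlMr // mulrC; exact: uH.
  have -> : fconv (cst 1) u 1 = intg u by apply: eq_intg => s sI; exact: mul1r.
  rewrite -ler_pdivlMl //; apply: sup_le => t tI.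
  by rewrite ler_pdivlMl //; exact: um.
exists u; split; last exact: sup_le.
- split; [exact: Ku| |by rewrite nl|].
    apply: contrapT => u00; suff Phi0 : Phi u = 0 by move: r0; rewrite -Phiu Phi0 ltxx.
    rewrite -[RHS](intg_cst (0 : R)); apply: eq_intg => s sI.
    have -> : u s = 0 by apply/eqP/negP => /negP us; apply: u00; exists s.
    have /andP[ps _] := p_bounds sI.
    have ps0 : p s != 0 by rewrite gt_eqF // (lt_le_trans _ ps) // (lt_trans ltr01).
    by rewrite (powR0 ps0) mulr0.
  move=> t tI; rewrite /operT nl uE //.
  have ->: \int[mu]_(s in `[0, 1]) ((A r)^-1 * G t s * f s (u s)) =
      intg (fun s => lambda^-1 * (Gc t s * F s)).
    apply: eq_intg => s sI; rewrite clamp_kernelE // FE //.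
    by field; rewrite !gt_eqF.
  by rewrite intgZ ?mulVKf ?gt_eqF.
- split=> // t tI; have [d2 e2] := u'' t tI.
  split; first exact: d2.
  rewrite e2 nl FE; last exact: subitv01.
  by field; rewrite gt_eqF.
- rewrite inE; split; first by split; [exact: Ku|rewrite nl].
  by move=> [_ /(modular_closure Ku)]; rewrite Phiu leNgt r1.
- rewrite m_rhoE.
  apply: (modular_lower w_L1 w_ge0 p_meas pm_gt1 p_bounds _ le_sup rho1_gt0 W_gt0).
    exact: continuous_measurable_I01.
  by rewrite Phiu ltW.
Qed.

End NonlocalProblem.

Theorem theorem2p8 (R : realType)
  (lambda : R) (A : R -> R) (f : R -> R -> R) (b : R -> R) (rho1 rho2 : R)
  (p : R -> R) (pm pp q : R)
  (B : 'M[R]_(2, 4)) (G : R -> R -> R) (alpha beta eta0 : R)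
  (lambda_gt0 : 0 < lambda)
  (A_cont : {within `[0, +oo[, continuous A})
  (f_cont : {within `[0, 1] `*` `[0, +oo[, continuous (fun z : R * R => f z.1 z.2)})
  (f_ge0 : forall t x : R, t \in `[0, 1] -> 0 <= x -> 0 <= f t x)
  (b_int : lebesgue_measure.-integrable `]0, 1] (EFin \o b))
  (b_ge0 : forall t : R, t \in `]0, 1] -> 0 <= b t)
  (b_gt0 : {ae lebesgue_measure, forall t : R, t \in `]0, 1] -> 0 < b t})
  (b_neq0 : fconv b (cst 1) 1 != 0)
  (rho1_gt0 : 0 < rho1) (rho12 : rho1 < rho2)
  (A_gt0 : forall t : R, t \in `[rho1, rho2] -> 0 < A t)
  (p_cont : {within `[0, 1], continuous p})
  (pm_gt1 : 1 < pm)
  (p_bounds : forall t : R, t \in `[0, 1] -> pm <= p t <= pp)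
  (G_cont : {within `[0, 1] `*` `[0, 1], continuous (fun z : R * R => G z.1 z.2)})
  (G_ge0 : forall t s : R, t \in `[0, 1] -> s \in `[0, 1] -> 0 <= G t s)
  (G_green : is_green_function B G)
  (alpha_ge0 : 0 <= alpha) (alpha_beta : alpha < beta) (beta_le1 : beta <= 1)
  (eta0_gt0 : 0 < eta0) (eta0_le1 : eta0 <= 1)
  (G_harnack : forall s : R, s \in `[0, 1] ->
     min_on `[alpha, beta] (G ^~ s) >= eta0 * green_max G s)
  (green_max_gt0 : forall s : R, s \in `]0, 1[ -> 0 < green_max G s)
  (C0_gt0 : 0 < C0 G)
  (q_gt1 : 1 < q) (q_lt_pm : q < pm)
  (bq_int : lebesgue_measure.-integrable `]0, 1]
     (EFin \o (fun t : R => b t `^ (1 - q)^-1)))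
  (ineq1 :
     (2 `^ (1 - pp) *
        (lambda * rect_min f alpha beta (eta0 * m_rho b pm pp rho1) (M_rho G b pm pp q rho1)
           / A rho1 *
         max_on `[0, 1] (fun tau : R =>
           \int[lebesgue_measure]_(s in `[alpha, beta]) G tau s)) `^ pm - 1) *
     \int[lebesgue_measure]_(t in `[alpha, beta]) b (1 - t)
     > rho1 / eta0 `^ pp)
  (ineq2 :
     let X := lambda * rect_max f 0 1 0 (M_rho G b pm pp q rho2) * green_int_max G
                / A rho2 in
     Num.max (X `^ pm) (X `^ pp) *
     \int[lebesgue_measure]_(t in `[0, 1]) b (1 - t) < rho2) :
  let K := cone G alpha beta eta0 in
  exists u0 : R -> R,
    [/\ positive_solution K lambda A f b p G u0,
        solves_bvp B lambda A f b p u0,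
        u0 \in Vhat K b p rho2 `\` rel_closure K (Vhat K b p rho1),
        (rho1 / fconv b (cst 1) 1) `^ pp^-1 + eps_rho b pm pp rho1 <= sup_norm u0 &
        sup_norm u0 <=
          (C0 G)^-1 * 2 `^ ((pp - q) / pm) *
          (rho2 `^ q^-1 *
             fconv (fun t : R => b t `^ (1 - q)^-1) (cst 1) 1 `^ ((q - 1) / q) + 1)
            `^ (q / pm)].
Proof.
move=> K.
have [u0 [sol bvp u0V lower upper]] := nonlocal_problem_solvable lambda_gt0 A_cont f_cont f_ge0
  b_int b_ge0 b_gt0 b_neq0 rho1_gt0 rho12 A_gt0 p_cont pm_gt1 p_bounds G_cont G_ge0
  alpha_ge0 alpha_beta beta_le1 eta0_gt0 eta0_le1 G_harnack green_max_gt0 C0_gt0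
  q_gt1 q_lt_pm bq_int ineq1 ineq2 G_green.
by exists u0.
Qed.
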